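(* Let $M$ be a complete Riemannian manifold and let $\Omega \subset M$ be a bounded open domain with (nonempty) smooth boundary. Let $\tau$ be the first exit time of Brownian motion from $\Omega$, let $u_k(x) = \mathbb{E}^x[\tau^k]$, and for positive integers $k$ let $$\mathrm{Var}_k(\Omega) = \int_\Omega (u_{2k} - u_k^2)\, dx$$ be the $L^1$-norm of the variance of $\tau^k$. Suppose $\lambda = \lambda(\Omega)$ is a Dirichlet eigenvalue of $\Omega$ whose associated eigenspace is not orthogonal to constants, and let $a_\lambda^2$ be the square of the $L^2(\Omega)$-norm of the orthogonal projection of the constant function $1$ on the eigenspace corresponding to $\lambda$. Then for every positive integer $k$, $$\left(a_\lambda^2\, \frac{(2k)!-(k!)^2}{\mathrm{Var}_k(\Omega)} \right)^{\frac{1}{2k}} \leq \lambda.$$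
   Context: $\Delta = \operatorname{div}\nabla$ is the Laplace operator of $M$ and $dx$ is the Riemannian measure. Brownian motion $X_t$ on $M$ is the diffusion with infinitesimal generator $\Delta$ (not $\tfrac12\Delta$); $\mathbb{P}^x$ is the probability measure charging Brownian paths started at $x$, and $\mathbb{E}^x$ is the corresponding expectation. The first exit time is $\tau = \inf\{t \ge 0 : X_t \notin \Omega\}$. A Dirichlet eigenvalue of $\Omega$ is a number $\lambda$ for which $-\Delta\phi = \lambda\phi$ in $\Omega$, $\phi = 0$ on $\partial\Omega$ has a nonzero solution; its eigenspace in $L^2(\Omega)$ is the (finite-dimensional) space of all solutions, and orthogonality and orthogonal projection are with respect to the $L^2(\Omega)$ inner product. Background fact: with $u_0 = 1$, the functions $u_k$ ($k \ge 1$) are the solutions of $\Delta u_k = -k u_{k-1}$ in $\Omega$, $u_k = 0$ on $\partial\Omega$. *)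

(* Defs.v *)
From HB Require Import structures.
From mathcomp Require Import all_boot all_order all_algebra.
From mathcomp Require Import all_classical all_reals all_analysis.
From mathcomp Require Import measurable_realfun.

Set Implicit Arguments.
Unset Strict Implicit.
Unset Printing Implicit Defensive.

Import Order.TTheory GRing.Theory Num.Theory.
Import numFieldNormedType.Exports.

Local Open Scope classical_set_scope.
Local Open Scope ring_scope.

(** * Calculus on open subsets of R^n *)

Definition partial (R : realType) (n : nat) (a : 'I_n) (f : 'rV[R]_n -> R) :
  'rV[R]_n -> R := fun x => 'D_(delta_mx 0 a) f x.

(* [f] is of class C^k on the open set [V]; its values off [V] are irrelevant *)
Fixpoint Ck (R : realType) (n k : nat) (V : set 'rV[R]_n) (f : 'rV[R]_n -> R) :
    Prop :=
  (forall x, V x -> {for x, continuous f}) /\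
  match k with
  | 0 => True
  | k'.+1 => forall a : 'I_n,
      (forall x, V x -> derivable f x (delta_mx 0 a)) /\ Ck k' V (partial a f)
  end.

(** * Smooth and Riemannian manifolds *)

(* An n-dimensional smooth manifold without boundary.  The i-th chart is the
   homeomorphism [fwd i] from the open set [cdom i] of [M] onto the open set
   [ccod i] of R^n, with inverse [bwd i]; both maps are total functions that carry
   no information off [cdom i] and [ccod i].  [chart_at p] is a choice of a chart
   around [p]. *)
Record smooth_atlas (R : realType) (M : topologicalType) (n : nat) :=
  SmoothAtlas {
  chart : Type;
  cdom : chart -> set M;
  ccod : chart -> set 'rV[R]_n;
  fwd : chart -> M -> 'rV[R]_n;
  bwd : chart -> 'rV[R]_n -> M;
  chart_at : M -> chart;
  atlas_hausdorff : hausdorff_space M;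
  atlas_second_countable : @second_countable M;
  cdom_open : forall i, open (cdom i);
  ccod_open : forall i, open (ccod i);
  fwdP : forall i p, cdom i p -> ccod i (fwd i p) /\ bwd i (fwd i p) = p;
  bwdP : forall i x, ccod i x -> cdom i (bwd i x) /\ fwd i (bwd i x) = x;
  fwd_continuous : forall i p, cdom i p -> {for p, continuous (fwd i)};
  bwd_continuous : forall i x, ccod i x -> {for x, continuous (bwd i)};
  chart_atP : forall p, cdom (chart_at p) p;
  transition_smooth : forall i j (b : 'I_n) k,
    Ck k (ccod i `&` bwd i @^-1` cdom j) (fun x => fwd j (bwd i x) 0 b) }.

Definition Ck_on (R : realType) (M : topologicalType) (n : nat)
    (A : smooth_atlas R M n) (k : nat) (W : set M) (f : M -> R) : Prop :=
  forall i : chart A, Ck k (ccod i `&` bwd i @^-1` W) (f \o bwd i).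

Definition C2c (R : realType) (M : topologicalType) (n : nat)
    (A : smooth_atlas R M n)
    (f : M -> R) : Prop :=
  Ck_on A 2 setT f /\ exists2 K, compact K & forall p, ~ K p -> f p = 0.

Definition boundary (M : topologicalType) (W : set M) : set M := closure W `\` interior W.

(* near each boundary point, [W] is the side [rho < 0] of a regular level set of
   a smooth function [rho] *)
Definition smooth_boundary (R : realType) (M : topologicalType) (n : nat)
    (A : smooth_atlas R M n)
    (W : set M) : Prop :=
  forall p, boundary W p ->
    exists (V : set M) (rho : M -> R),
      [/\ open V, V p, (forall k, Ck_on A k V rho),
          W `&` V = [set q | rho q < 0] `&` V
        & let i := chart_at A p in
          exists a : 'I_n, partial a (rho \o bwd i) (fwd i p) != 0].

(* [g i x] is the matrix of the metric at the point [bwd i x] in the coordinate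
   frame of the chart [i]; vectors are rows, so that the Jacobian matrix [J] of the
   transition map acts on the right *)
Record riemannian_metric (R : realType) (M : topologicalType) (n : nat)
    (A : smooth_atlas R M n) := RiemannianMetric {
  gmx :> chart A -> 'rV[R]_n -> 'M[R]_n;
  gmx_smooth : forall i a b k, Ck k (ccod i) (fun x => gmx i x a b);
  gmx_sym : forall i x, ccod i x -> (gmx i x)^T = gmx i x;
  gmx_pos : forall i x (v : 'rV[R]_n), ccod i x -> v != 0 ->
    0 < (v *m gmx i x *m v^T) 0 0;
  gmx_compat : forall i j x, ccod i x -> cdom j (bwd i x) ->
    let J := \matrix_(a < n, b < n)
               partial a (fun y => fwd j (bwd i y) 0 b) x in
    gmx i x = J *m gmx j (fwd j (bwd i x)) *m J^T }.

Section riemannian_geometry.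
Context {R : realType} {M : topologicalType} {n : nat}.
Context {A : smooth_atlas R M n} (g : riemannian_metric A).

Definition sqrt_det (i : chart A) (x : 'rV[R]_n) : R := Num.sqrt (\det (g i x)).

(* coordinates of the gradient: sum_b g^{ab} d_b f *)
Definition gradient_in (i : chart A) (f : 'rV[R]_n -> R) (a : 'I_n)
    (x : 'rV[R]_n) : R :=
  \sum_(b < n) invmx (g i x) a b * partial b f x.

(* coordinate expression of the divergence of the vector field of components [X],
   (1 / sqrt |g|) sum_a d_a (sqrt |g| X^a) *)
Definition divergence_in (i : chart A) (X : 'I_n -> 'rV[R]_n -> R)
    (x : 'rV[R]_n) : R :=
  (sqrt_det i x)^-1 * \sum_(a < n) partial a (fun y => sqrt_det i y * X a y) x.

Definition laplacian (f : M -> R) (p : M) : R :=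
  let i := chart_at A p in
  divergence_in i (gradient_in i (f \o bwd i)) (fwd i p).

Definition coord (c : R -> M) (i : chart A) (b : 'I_n) (t : R) : R :=
  fwd i (c t) 0 b.

Definition C1_curve (c : R -> M) : Prop :=
  continuous c /\
  forall (t : R) (i : chart A) (b : 'I_n), cdom i (c t) ->
    derivable (coord c i b) t 1 /\ {for t, continuous (derive1 (coord c i b))}.

Definition speed (c : R -> M) (t : R) : R :=
  let i := chart_at A (c t) in
  let v := \row_(b < n) derive1 (coord c i b) t in
  Num.sqrt ((v *m g i (fwd i (c t)) *m v^T) 0 0).

Definition arc_length (c : R -> M) : \bar R :=
  (\int[lebesgue_measure]_(t in `[0%R, 1%R]) (speed c t)%:E)%E.

(* [joined p q l]: a piecewise C^1 curve, i.e. a finite chain of arcs c|[0,1] with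
   c of class C^1, of length [l] goes from [p] to [q] *)
Inductive joined (p : M) : M -> \bar R -> Prop :=
| joined_refl : joined p p 0%E
| joined_step (q : M) (l : \bar R) (c : R -> M) :
    joined p q l -> C1_curve c -> c 0 = q -> joined p (c 1) (l + arc_length c)%E.

Definition rdist (p q : M) : \bar R := ereal_inf [set l | joined p q l].

Definition riemannian_complete : Prop :=
  forall u : nat -> M,
    (forall e : R, 0 < e -> exists N : nat, forall i j : nat,
       (N <= i)%N -> (N <= j)%N -> (rdist (u i) (u j) < e%:E)%E) ->
    exists p : M, u @ \oo --> p.

Definition rbounded (W : set M) : Prop :=
  exists C : R, forall p q : M, W p -> W q -> (rdist p q <= C%:E)%E.

(* phi is a classical solution of -Delta phi = lambda phi in W, phi = 0 on the
   boundary of W; the values of [phi] off the closure of W are irrelevant *)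
Definition dirichlet_solution (W : set M) (lambda : R) (phi : M -> R) : Prop :=
  [/\ Ck_on A 2 W phi,
      {within closure W, continuous phi},
      (forall p, W p -> - laplacian phi p = lambda * phi p)
    & (forall p, boundary W p -> phi p = 0)].

Definition dirichlet_eigenvalue (W : set M) (lambda : R) : Prop :=
  exists2 phi, dirichlet_solution W lambda phi & exists2 p, W p & phi p != 0.

End riemannian_geometry.

(** * Riemannian measure *)

Definition borel (T : ptopologicalType) := g_sigma_algebraType (@open T).

Definition is_lebesgue_measure (R : realType) (n : nat)
    (L : {measure set (borel 'rV[R]_n) -> \bar R}) : Prop :=
  forall a b : 'rV[R]_n, (forall i, a 0 i <= b 0 i) ->
    L [set x | forall i, a 0 i <= x 0 i <= b 0 i] =
    (\prod_(i < n) (b 0 i - a 0 i))%:E.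

(* dx = sqrt |g| dx^1 ... dx^n in every chart *)
Definition is_riemannian_measure (R : realType) (M : ptopologicalType) (n : nat)
    (A : smooth_atlas R M n) (g : riemannian_metric A)
    (vol : {measure set (borel M) -> \bar R}) : Prop :=
  exists2 L : {measure set (borel 'rV[R]_n) -> \bar R}, is_lebesgue_measure L &
  forall (i : chart A) (B : set (borel 'rV[R]_n)), measurable B -> B `<=` ccod i ->
    vol (bwd i @` B) = (\int[L]_(x in B) (sqrt_det g i x)%:E)%E.

(** * Brownian motion *)

Section processes.
Context {R : realType} {M : ptopologicalType}.
Context {d : measure_display} {T : measurableType d}.
Variable X : R -> T -> one_point_compactification M.

(* the event X_t \in B, for a subset B of M *)
Definition hits (t : R) (B : set M) : set T := [set w | (Some @` B) (X t w)].

Definition past (s : R) : set (set T) :=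
  <<s [set F | exists r U, [/\ 0 <= r <= s, open U & F = hits r U]] >>.

Definition extend_infty (S : Type) (z : S) (f : M -> S)
    (y : one_point_compactification M) : S :=
  if y is Some p then f p else z.

End processes.

(* Brownian motion may explode in finite time even when M is complete: paths are
   continuous in the one-point compactification of M, whose added point [None] is
   a cemetery (it is isolated, hence never reached, when M is compact).

   The process is the diffusion whose transition semigroup P_t has infinitesimal
   generator Delta.  [bm_generator] says that (P_t f - f) / t converges uniformly
   to Delta f for f in C^2 with compact support.  [bm_symmetric] says that P_t is
   symmetric for the Riemannian measure, so that its generator on L^2(M, dx) is
   the self-adjoint extension of Delta (unique, as M is complete), i.e. P_t is
   the heat semigroup. *)
Record brownian_motion (R : realType) (M : ptopologicalType) (n : nat)
    (A : smooth_atlas R M n) (g : riemannian_metric A)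
    (vol : {measure set (borel M) -> \bar R})
    (d : measure_display) (T : measurableType d) := BrownianMotion {
  bm_law : M -> probability T R;
  bm_path : R -> T -> one_point_compactification M;
  bm_measurable : forall (t : R) (U : set M), 0 <= t -> open U ->
    measurable (hits bm_path t U);
  bm_law_measurable : forall (t : R) (B : set (borel M)), 0 <= t ->
    measurable B ->
    measurable_fun [set: borel M]
      (fun x : borel M => bm_law x (hits bm_path t B));
  bm_continuous : forall w, {within [set t | 0 <= t], continuous (bm_path ^~ w)};
  bm_absorbed : forall w (s t : R), 0 <= s -> s <= t ->
    bm_path s w = None -> bm_path t w = None;
  bm_start : forall x, bm_law x (hits bm_path 0 [set x]) = 1%E;
  bm_markov : forall x (s t : R) F (B : set (borel M)), 0 <= s -> 0 <= t ->
    past bm_path s F -> measurable B ->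
    bm_law x (F `&` hits bm_path (s + t) B) =
    (\int[bm_law x]_(w in F)
       extend_infty 0 (fun y => bm_law y (hits bm_path t B)) (bm_path s w))%E;
  bm_generator : forall f, C2c A f -> forall e : R, 0 < e ->
    \forall t \near 0^'+, forall x,
      `| t^-1 * (\int[bm_law x]_w extend_infty 0 f (bm_path t w) - f x)
         - laplacian g f x | < e;
  bm_symmetric : forall (t : R) (B C : set (borel M)), 0 <= t ->
    measurable B -> measurable C ->
    (\int[vol]_(x in B) bm_law x (hits bm_path t C) =
     \int[vol]_(x in C) bm_law x (hits bm_path t B))%E }.

Section exit_time_moments.
Context {R : realType} {M : ptopologicalType} {n : nat}.
Context {A : smooth_atlas R M n} {g : riemannian_metric A}.
Context {vol : {measure set (borel M) -> \bar R}}.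
Context {d : measure_display} {T : measurableType d}.
Variables (X : brownian_motion g vol T) (W : set M).

Local Open Scope ereal_scope.

Definition exit_time (w : T) : \bar R :=
  ereal_inf [set t%:E | t in [set t : R | (0 <= t)%R /\ ~ hits (bm_path X) t W w]].

Definition moment (k : nat) (x : M) : \bar R :=
  \int[bm_law X x]_w (exit_time w) ^+ k.

Definition variance_L1 (k : nat) : \bar R :=
  \int[vol]_(x in W) (moment (2 * k) x - (moment k x) ^+ 2).

End exit_time_moments.

(** * Projection of constants on an eigenspace *)

Section eigenspace_projection.
Context {R : realType} {M : ptopologicalType} {n : nat}.
Context {A : smooth_atlas R M n} (g : riemannian_metric A).
Variables (vol : {measure set (borel M) -> \bar R}) (W : set M) (lambda : R).

Definition orthogonal_to_constants : Prop :=
  forall phi, dirichlet_solution g W lambda phi ->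
    (\int[vol]_(x in W) (phi x)%:E = 0)%E.

(* [p] represents the orthogonal projection, in L^2(W), of the constant function 1
   on the eigenspace of [lambda] *)
Definition is_projection_of_1 (p : M -> R) : Prop :=
  dirichlet_solution g W lambda p /\
  forall phi, dirichlet_solution g W lambda phi ->
    (\int[vol]_(x in W) ((1 - p x) * phi x)%:E = 0)%E.

Definition sq_L2norm (p : M -> R) : \bar R :=
  (\int[vol]_(x in W) ((p x) ^+ 2)%:E)%E.

End eigenspace_projection.

(* Main.v *)
Require Import Defs.
From HB Require Import structures.
From mathcomp Require Import all_boot all_order all_algebra.
From mathcomp Require Import all_classical all_reals all_analysis.
From mathcomp Require Import measurable_realfun.
From mathcomp Require Import ring lra.

Set Implicit Arguments.
Unset Strict Implicit.
Unset Printing Implicit Defensive.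

Import Order.TTheory GRing.Theory Num.Theory.
Import numFieldNormedType.Exports.

Local Open Scope classical_set_scope.
Local Open Scope ring_scope.

(* Write F_t(x) = P^x(tau > t) and H(t) = \int_Omega F_t dx.  Completeness makes
   the closure of Omega compact (Hopf-Rinow), so Omega has finite volume.

   Upper bound for (E tau^k)^2.  Killing the symmetric heat semigroup outside a
   compact set, along finer and finer time grids, gives
   \int F_s F_t dx <= H(s + t).  With w(s) = k s^(k-1), (E^x tau^k)^2 is the double
   integral of w(s) w(t) F_s(x) F_t(x), while that of w(s) w(t) 1_{s + t < T} is
   (k!)^2 / (2k)! T^(2k).  Hence \int (E tau^k)^2 <= (k!)^2 / (2k)! \int E tau^(2k).
   As these integrals may be infinite, tau is first stopped at N, which can only
   decrease the variance of tau^k.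

   Lower bound for E tau^(2k).  Let p be the projection of 1 and lambda' > lambda.
   Applying the generator to a C^2 truncation of p (Kato's inequality) gives
   e^(-lambda' t) \int p^+ <= \int p^+ F_t.  Since \int p = \int p^2 = a^2,
   Cauchy-Schwarz and the product inequality give H(t) >= a^2 e^(-lambda' t), so
   \int E tau^(2k) = \int_0^oo 2k t^(2k-1) H(t) dt >= a^2 (2k)! / lambda'^(2k).

   If E^x tau^k is infinite on a set of positive measure, then oo - oo = -oo makes
   Var_k = -oo, and (a^2 c / -oo)^(1/2k) = (-oo)^(1/2k) = 0. *)

(** * Differential calculus on R^n *)

Section multivariable_calculus.
Context {R : realType}.

(** Only deterministic times are available: the Markov property and symmetry at fixed times, and the
    generator on C^2 functions of compact support. Hence three choices. Killing is done on compact
    sets: their complements are open in the one-point compactification, so a continuous path that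
    leaves one is seen outside at some grid time. The function p is cut at a level e > 0: since p =
    0 on the boundary, {p >= e} is compact in Omega, and a convex C^2 function of p has compact
    support and satisfies the differential inequality up to O(e). The slack lambda' - lambda absorbs
    the second-order error of a time step, as e^(-lambda' t) <= 1 - lambda t for small t. Stopping
    at N costs a boundary term. On {tau > N} the region s + t < tau may fill the square [0, N]^2,
    which gives an excess (1 - beta) N^(2k) H(N) with beta = (k!)^2 / (2k)!, and this excess is not
    shown to vanish. It is paid for by the mass N^(2k) that the stopped moment of order 2k has on
    {tau > N}: comparison with a fixed N_0 leaves N_0^(2k) H(N), and H(N) tends to 0 when E tau^k is
    finite almost everywhere. *)

Lemma derivable_line n (f : 'rV[R]_n -> R) (z v : 'rV[R]_n) (s : R) :
  derivable f (z + s *: v) v ->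
  is_derive s 1 (fun t => f (z + t *: v)) ('D_v f (z + s *: v)).
Proof.
move=> df.
have E : (fun h : R => h^-1 *: ((fun t => f (z + t *: v)) (h *: 1 + s) - f (z + s *: v)))
   = (fun h => h^-1 *: (f (h *: v + (z + s *: v)) - f (z + s *: v))).
  apply/funext => h; congr (_ *: (f _ - _)).
  by rewrite -[h *: 1]/(h * 1) mulr1 scalerDl addrCA.
by split; rewrite /derivable /derive E.
Qed.

Lemma coord_le_norm n (v : 'rV[R]_n) a : `|v 0 a| <= `|v|.
Proof.
rewrite [leRHS]/Num.norm /= mx_normrE.
exact: (le_bigmax _ (fun ij : 'I_1 * 'I_n => `|v ij.1 ij.2|) (0, a)).
Qed.

Lemma norm_le_coord n (v : 'rV[R]_n) (r : R) :
  0 <= r -> (forall a, `|v 0 a| <= r) -> `|v| <= r.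
Proof.
move=> r0 vr; rewrite [leLHS]/Num.norm /= mx_normrE.
by apply/bigmax_leP; split => // -[i a] _ /=; rewrite ord1.
Qed.

Lemma mean_value_line n (f : 'rV[R]_n -> R) (z v : 'rV[R]_n) (h : R) :
  (forall s : R, `|s| <= `|h| -> derivable f (z + s *: v) v) ->
  exists2 s : R, `|s| <= `|h| & f (z + h *: v) - f z = h * 'D_v f (z + s *: v).
Proof.
move=> df; pose g (t : R) : R := f (z + t *: v); pose dg (t : R) : R := 'D_v f (z + t *: v).
have dgP (s : R) : `|s| <= `|h| -> is_derive s 1 g (dg s).
  by move=> /df; exact: derivable_line.
have cg (s : R) : `|s| <= `|h| -> {for s, continuous g}.
  by move=> /dgP[ds _]; apply/differentiable_continuous/derivable1_diffP.
have g0 : g 0 = f z by rewrite /g scale0r addr0.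
have [h0|h0] := leP 0 h.
- have sh (s : R) : s \in `[0, h] -> `|s| <= `|h|.
    by rewrite in_itv/= => /andP[s0 sh]; rewrite !ger0_norm.
  have [] := @MVT_segment R g dg 0 h h0.
  + by move=> s /subset_itv_oo_cc /sh; exact: dgP.
  + by apply: continuous_in_subspaceT => s /[!inE] /sh; exact: cg.
  + move=> s /sh sh'; rewrite subr0 g0 mulrC => E.
    by exists s.
- have sh (s : R) : s \in `[h, 0] -> `|s| <= `|h|.
    rewrite in_itv/= => /andP[hs s0].
    by rewrite !ler0_norm ?lerN2// ltW.
  have [] := @MVT_segment R g dg h 0 (ltW h0).
  + by move=> s /subset_itv_oo_cc /sh; exact: dgP.
  + by apply: continuous_in_subspaceT => s /[!inE] /sh; exact: cg.
  + move=> s /sh sh'; rewrite sub0r g0 => E.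
    exists s => //; rewrite -opprB E mulrN opprK mulrC//.
Qed.

(* Hadamard's form of differentiability: it reduces the chain rule to sums and
   products of limits *)
Lemma Ck1_hadamard n (V : set 'rV[R]_n) (f : 'rV[R]_n -> R) x :
  open V -> Ck 1 V f -> V x ->
  exists G : 'I_n -> 'rV[R]_n -> R,
    (forall a, G a y @[y --> x] --> partial a f x) /\
    \forall y \near x, f y - f x = \sum_a (y 0 a - x 0 a) * G a y.
Proof.
move=> oV [_ df] Vx.
have /nbhs_ballP[e /= e0 eV] : nbhs x V by exact: open_nbhs_nbhs.
(* [z y k] has the first k coordinates of y and the others of x: the increment of f telescopes along
   the coordinate axes, and the mean value theorem applies to each edge. *)
pose z (y : 'rV[R]_n) (k : nat) : 'rV[R]_n :=
  \row_j (if (j < k)%N then y 0 j else x 0 j).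
have zS (y : 'rV[R]_n) (k : 'I_n) : z y k.+1 = z y k + (y 0 k - x 0 k) *: delta_mx 0 k.
  apply/rowP => j; rewrite !mxE eqxx /=.
  have [->|jk] := eqVneq j k; first by rewrite ltnSn ltnn mulr1 addrC subrK.
  by rewrite mulr0 addr0 ltnS leq_eqVlt val_eqE (negbTE jk).
have zs (y : 'rV[R]_n) (k : 'I_n) (s : R) : `|s| <= `|y 0 k - x 0 k| ->
    `|z y k + s *: delta_mx 0 k - x| <= `|y - x|.
  move=> hs; apply: norm_le_coord => // j; rewrite !mxE eqxx /=.
  have yj : `|y 0 j - x 0 j| <= `|y - x|.
    by have := coord_le_norm (y - x) j; rewrite !mxE.
  have [jk|jk] := eqVneq j k.
    rewrite jk ltnn mulr1 addrAC subrr add0r (le_trans hs)//.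
    by rewrite -jk.
  rewrite mulr0 addr0; case: ifP => // _.
  by rewrite subrr normr0.
have mv (k : 'I_n) (y : 'rV[R]_n) : exists w : 'rV[R]_n, ball x e y -> `|w - x| <= `|y - x| /\
    f (z y k.+1) - f (z y k) = (y 0 k - x 0 k) * partial k f w.
  have [by_|nby] := pselect (ball x e y); last by exists x.
  have yxe : `|y - x| < e by move: by_; rewrite -ball_normE /= distrC.
  have [s hs E] : exists2 s : R, `|s| <= `|y 0 k - x 0 k| &
    f (z y k + (y 0 k - x 0 k) *: delta_mx 0 k) - f (z y k) =
    (y 0 k - x 0 k) * 'D_(delta_mx 0 k) f (z y k + s *: delta_mx 0 k).
    apply: mean_value_line => s hs; apply: (df k).1; apply: eV.
    by rewrite -ball_normE /= distrC (le_lt_trans (zs _ _ _ hs)).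
  exists (z y k + s *: delta_mx 0 k) => _; split; first exact: zs.
  by rewrite zS.
have /choice[w wP] : forall k : 'I_n, exists w : 'rV[R]_n -> 'rV[R]_n, forall y,
    ball x e y -> `|w y - x| <= `|y - x| /\
    f (z y k.+1) - f (z y k) = (y 0 k - x 0 k) * partial k f (w y).
  by move=> k; have /choice[w wP] := mv k; exists w.
exists (fun a y => partial a f (w a y)); split.
- move=> a; have [_ [ca _]] := df a.
  suff wx : w a y @[y --> x] --> x by exact: cvg_comp wx (ca x Vx).
  move=> U /nbhs_ballP[r /= r0 rU].
  apply/nbhs_ballP; exists (Num.min e r) => /=; first by rewrite lt_min e0.
  move=> y; rewrite -ball_normE /= distrC lt_min => /andP[ye yr]; apply: rU.
  have by_ : ball x e y by rewrite -ball_normE /= distrC.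
  rewrite -ball_normE /= distrC; exact: le_lt_trans ((wP a y by_).1) yr.
- near=> y.
  have by_ : ball x e y by near: y; exact: nbhsx_ballx.
  have -> : f y - f x = \sum_(0 <= k < n) (f (z y k.+1) - f (z y k)).
    rewrite telescope_sumr//; congr (f _ - f _); apply/rowP => j; rewrite mxE//.
    by rewrite ltn_ord.
  rewrite big_mkord; apply: eq_bigr => k _; exact: (wP k y by_).2.
Unshelve. all: by end_near. Qed.

Lemma Ck1_chain_rule n (V : set 'rV[R]_n) (f : 'rV[R]_n -> R) (c : R -> 'rV[R]_n) (t : R)
    (v : 'I_n -> R) :
  open V -> Ck 1 V f -> V (c t) -> {for t, continuous c} ->
  (forall a, is_derive t 1 (fun s => c s 0 a) (v a)) ->
  is_derive t 1 (f \o c) (\sum_a v a * partial a f (c t)).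
Proof.
move=> oV Cf Vc cc dc.
have [G [cG GP]] := Ck1_hadamard oV Cf Vc.
have lim : (fun h : R => h^-1 *: ((f \o c) (h *: 1 + t) - (f \o c) t)) @ 0^' -->
    (\sum_a v a * partial a f (c t) : R).
  have sh : (fun h : R => h *: 1 + t) @ 0^' --> t.
    rewrite (_ : (fun h : R => h *: 1 + t) = (fun h => h + t)); last first.
      by apply/funext => h; rewrite -[h *: 1]/(h * 1) mulr1.
    rewrite -[X in _ --> X]add0r; apply: cvgD; last exact: cvg_cst.
    exact: cvg_within.
  apply: (@cvg_trans _ ((fun h : R => \sum_a
     (h^-1 *: (c (h *: 1 + t) 0 a - c t 0 a)) * G a (c (h *: 1 + t))) @ 0^')).
    apply: near_eq_cvg; near=> h.
    have -> : (f \o c) (h *: 1 + t) - (f \o c) t =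
        \sum_a (c (h *: 1 + t) 0 a - c t 0 a) * G a (c (h *: 1 + t)).
      near: h; exact: (cvg_comp _ _ sh cc) GP.
    rewrite scaler_sumr; apply: eq_bigr => a _.
    by rewrite scalerAl.
  apply: cvg_big => [|a _]; first exact: add_continuous.
  apply: cvgM.
    by have [d <-] := dc a; exact: d.
  exact: cvg_comp (cvg_comp _ _ sh cc) (cG a).
split; last exact/cvg_lim.
by apply/cvg_ex; exists (\sum_a v a * partial a f (c t)).
Unshelve. all: by end_near. Qed.

End multivariable_calculus.

(** * Curves and arc length *)

Section curves.
Context {R : realType} {M : topologicalType} {n : nat}.
Context {A : smooth_atlas R M n} (g : riemannian_metric A).

Lemma open_chart_preimage (i : chart A) (W : set M) :
  open W -> open (ccod i `&` bwd i @^-1` W).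
Proof.
move=> oW; rewrite openE => x [xi Wx]; apply: (@filterI _ (nbhs x)).
  by apply: open_nbhs_nbhs; split => //; exact: ccod_open.
by apply: (bwd_continuous xi); exact: open_nbhs_nbhs.
Qed.

Lemma near_cdom (i : chart A) p : cdom i p -> \forall q \near p, cdom i q.
Proof. by move=> pi; apply: open_nbhs_nbhs; split => //; exact: cdom_open. Qed.

Lemma chart_curve_continuous (c : R -> M) (i : chart A) t :
  {for t, continuous c} -> cdom i (c t) -> {for t, continuous (fwd i \o c)}.
Proof. by move=> cc ci; exact: cvg_comp cc (fwd_continuous ci). Qed.

Lemma transition_chain_rule (c : R -> M) (i j : chart A) (b : 'I_n) t
    (v : 'I_n -> R) :
  {for t, continuous c} -> cdom i (c t) -> cdom j (c t) ->
  (forall a, is_derive t 1 (Defs.coord c i a) (v a)) ->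
  is_derive t 1 (Defs.coord c j b)
    (\sum_a v a * partial a (fun y => fwd j (bwd i y) 0 b) (fwd i (c t))).
Proof.
move=> cc ci cj dv; pose f y : R := fwd j (bwd i y) 0 b.
have := @Ck1_chain_rule R n (ccod i `&` bwd i @^-1` cdom j) f (fwd i \o c) t v.
move=> /(_ (open_chart_preimage (cdom_open j))).
move=> /(_ (transition_smooth i j b 1)).
have [fi bfi] := fwdP ci.
have Vt : (ccod i `&` bwd i @^-1` cdom j) (fwd i (c t)).
  by split => //; rewrite /preimage/= bfi.
move=> /(_ Vt (chart_curve_continuous cc ci) dv).
apply: near_eq_is_derive.
near=> s; rewrite /Defs.coord /f /=.
have [_ ->//] : ccod i (fwd i (c s)) /\ bwd i (fwd i (c s)) = c s.
apply: fwdP; near: s; exact: cc (near_cdom ci).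
Unshelve. all: by end_near. Qed.

Definition velocity (c : R -> M) (i : chart A) (t : R) : 'rV[R]_n :=
  \row_(b < n) derive1 (Defs.coord c i b) t.

Lemma coord_is_derive (c : R -> M) (i : chart A) t b :
  C1_curve (A:=A) c -> cdom i (c t) ->
  is_derive t 1 (Defs.coord c i b) (velocity c i t 0 b).
Proof.
move=> [_ /(_ t i b)] dc /dc[d _]; rewrite mxE derive1E.
exact: DeriveDef.
Qed.

Lemma velocity_transition (c : R -> M) (i j : chart A) t :
  C1_curve (A:=A) c -> cdom i (c t) -> cdom j (c t) ->
  velocity c j t = velocity c i t *m
    \matrix_(a < n, b < n)
      partial a (fun y => fwd j (bwd i y) 0 b) (fwd i (c t)).
Proof.
move=> cc ci cj; apply/rowP => b; rewrite mxE [RHS]mxE derive1E.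
have dv a : is_derive t 1 (Defs.coord c i a) (velocity c i t 0 a).
  exact: coord_is_derive.
have [_ ->] := transition_chain_rule b (cc.1 t) ci cj dv.
by apply: eq_bigr => a _; rewrite [X in _ = _ * X]mxE.
Qed.

(** Velocities change charts by the Jacobian of the transition map, the matrix that appears in
    [gmx_compat], so the norm of the velocity is the same in every chart. *)
Lemma speed_chart (c : R -> M) (i : chart A) t :
  C1_curve (A:=A) c -> cdom i (c t) ->
  speed g c t = Num.sqrt
    ((velocity c i t *m g i (fwd i (c t)) *m (velocity c i t)^T) 0 0).
Proof.
move=> cc ci; rewrite /speed -/(velocity c _ t).
set j := chart_at A (c t); have cj : cdom j (c t) by exact: chart_atP.
have [fi bfi] := fwdP ci.
rewrite (velocity_transition cc ci cj) trmx_mul.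
rewrite (@gmx_compat _ _ _ _ g i j (fwd i (c t)))// ?bfi//.
by rewrite !mulmxA.
Qed.

Lemma quadratic_formE (v : 'rV[R]_n) (B : 'M[R]_n) :
  (v *m B *m v^T) 0 0 = \sum_b (\sum_a v 0 a * B a b) * v 0 b.
Proof. by rewrite mxE; apply: eq_bigr => b _; rewrite mxE [v^T _ _]mxE. Qed.

Lemma cvg_quadratic_form {T : Type} (F : set_system T) (FF : Filter F)
    (v : T -> 'rV[R]_n) (B : T -> 'M[R]_n) (v0 : 'rV[R]_n) (B0 : 'M[R]_n) :
  (forall a, v x 0 a @[x --> F] --> v0 0 a) ->
  (forall a b, B x a b @[x --> F] --> B0 a b) ->
  (v x *m B x *m (v x)^T) 0 0 @[x --> F] --> (v0 *m B0 *m v0^T) 0 0.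
Proof.
move=> cv cB; rewrite quadratic_formE.
under eq_cvg do rewrite quadratic_formE.
apply: cvg_big => [|b _]; first exact: add_continuous.
apply: cvgM; last exact: cv.
apply: cvg_big => [|a _]; first exact: add_continuous.
by apply: cvgM; [exact: cv|exact: cB].
Qed.

Lemma metric_continuous (i : chart A) x a b :
  ccod i x -> {for x, continuous (fun y => g i y a b)}.
Proof. by have [h _] := gmx_smooth g i a b 0; exact: h. Qed.

Lemma speed_continuous (c : R -> M) : C1_curve (A:=A) c -> continuous (speed g c).
Proof.
move=> cc t; set i := chart_at A (c t).
have ci : cdom i (c t) by exact: chart_atP.
(* [speed] reads the chart [chart_at A (c s)], which may jump with s; near t it is replaced by the
   single chart i. *)
rewrite /prop_for/continuous_at (speed_chart cc ci).
have near_i : \forall s \near t, cdom i (c s) by exact: cc.1 t _ (near_cdom ci).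
apply: (@cvg_trans _ ((fun s => Num.sqrt ((velocity c i s *m g i (fwd i (c s))
    *m (velocity c i s)^T) 0 0)) @ t)).
  apply: near_eq_cvg; near=> s; apply/esym/speed_chart => //.
  by near: s.
suff Q : ((velocity c i s *m g i (fwd i (c s)) *m (velocity c i s)^T) 0 0)
    @[s --> t] --> (velocity c i t *m g i (fwd i (c t)) *m (velocity c i t)^T) 0 0.
  exact: (cvg_comp _ _ Q (@sqrt_continuous R _)).
apply: cvg_quadratic_form => [a|a b].
  rewrite mxE; under eq_cvg do rewrite mxE.
  by have [_] := cc.2 t i a ci.
have [fi _] := fwdP ci.
have mc := metric_continuous (a := a) (b := b) fi.
exact: (@cvg_comp _ _ _ (fwd i \o c) (fun y => g i y a b) _ _ _
  (chart_curve_continuous (cc.1 t) ci) mc).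
Unshelve. all: by end_near. Qed.

Lemma speed_ge0 c t : 0 <= speed g c t.
Proof. exact: sqrtr_ge0. Qed.

Lemma is_derive_affine (a b t : R) : is_derive t 1 (fun t => a + b * t) b.
Proof.
by apply: is_derive_eq; rewrite add0r mul1r -[LHS]/(b * 1) mulr1.
Qed.

Lemma is_derive_affine_comp (f : R -> R) (a b t d : R) :
  is_derive (a + b * t) 1 f d -> is_derive t 1 (fun t => f (a + b * t)) (b * d).
Proof.
move=> df; rewrite mulrC.
exact: (@is_derive1_comp _ f (fun t => a + b * t) t d b df (is_derive_affine a b t)).
Qed.

Lemma C1_curve_affine (c : R -> M) (a b : R) :
  C1_curve (A:=A) c -> C1_curve (A:=A) (fun t => c (a + b * t)).
Proof.
move=> cc; have ca t : {for t, continuous (fun t : R => a + b * t)}.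
  by apply: cvgD; [exact: cvg_cst|apply: cvgM; [exact: cvg_cst|exact: cvg_id]].
have da (t : R) (i : chart A) k : cdom i (c (a + b * t)) ->
    is_derive t 1 (Defs.coord (fun t => c (a + b * t)) i k)
      (b * derive1 (Defs.coord c i k) (a + b * t)).
  move=> ci; have [d _] := cc.2 _ _ k ci.
  have d1 : is_derive (a + b * t) 1 (Defs.coord c i k) (derive1 (Defs.coord c i k) (a + b * t)).
    by rewrite derive1E; exact: DeriveDef.
  exact: is_derive_affine_comp.
split=> [t|t i k ci]; first exact: cvg_comp (ca t) (cc.1 _).
have [d _] := da t i k ci.
split; first exact: d.
rewrite /prop_for/continuous_at derive1E.
have [_ ->] := da t i k ci.
apply: (@cvg_trans _ ((fun s => b * derive1 (Defs.coord c i k) (a + b * s)) @ t)).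
  have ns : \forall s \near t, cdom i (c (a + b * s)).
    exact: (cvg_comp _ _ (ca t) (cc.1 _)) (near_cdom ci).
  apply: near_eq_cvg; apply: filterS ns => s cs.
  by rewrite [RHS]derive1E; have [_ ->] := da s i k cs.
have cd := cvg_comp _ _ (ca t) (cc.2 _ i k ci).2.
by apply: (@cvgM _ _ (nbhs t)) cd; exact: cvg_cst.
Qed.

Lemma speed_affine (c : R -> M) (a b t : R) :
  C1_curve (A:=A) c -> speed g (fun t => c (a + b * t)) t = `|b| * speed g c (a + b * t).
Proof.
move=> cc; rewrite /speed -!/(velocity _ _ _).
set i := chart_at _ _; have ci : cdom i (c (a + b * t)) by exact: chart_atP.
have -> : velocity (fun t => c (a + b * t)) i t = b *: velocity c i (a + b * t).
  apply/rowP => k; rewrite !mxE derive1E.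
  have [d _] := cc.2 _ _ k ci.
  have d1 : is_derive (a + b * t) 1 (Defs.coord c i k) (derive1 (Defs.coord c i k) (a + b * t)).
    by rewrite derive1E; exact: DeriveDef.
  by have [_ ->] : is_derive t 1 (Defs.coord (fun t => c (a + b * t)) i k)
      (b * derive1 (Defs.coord c i k) (a + b * t)) by exact: is_derive_affine_comp.
rewrite linearZ /= -!scalemxAl -scalemxAr !scalerA mxE -expr2 sqrtrM ?sqr_ge0//.
by rewrite sqrtr_sqr.
Qed.

(** The interval ]-1, 2[ is a margin around [0, 1] that gives a two-sided derivative at both end
    points of an arc. *)
Lemma primitive_of_continuous (f : R -> R) : continuous f ->
  exists L : R -> R, forall t : R, -1 < t -> t < 2 -> is_derive t 1 L (f t).
Proof.
move=> cf; exists (fun x => \int[lebesgue_measure]_(t in [set` `[-1, x]]) f t).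
move=> t t0 t1.
have [] := @continuous_FTC1 R f (BLeft (-1)) t 2 t1 _ _ (cf t).
- apply: continuous_compact_integrable; first exact: segment_compact.
  exact: continuous_subspaceT.
- by [].
- by move=> d <-; rewrite derive1E; exact: DeriveDef.
Qed.

Lemma arc_lengthE (c : R -> M) (L : R -> R) : C1_curve (A:=A) c ->
  (forall t : R, 0 <= t <= 1 -> is_derive t 1 L (speed g c t)) ->
  arc_length g c = (L 1 - L 0)%:E.
Proof.
move=> cc dL; have cL (t : R) : 0 <= t <= 1 -> {for t, continuous L}.
  by move=> /dL[d _]; apply/differentiable_continuous/derivable1_diffP.
rewrite /arc_length (@continuous_FTC2 R (speed g c) L)//.
- exact/continuous_subspaceT/speed_continuous.
- split.
  + move=> t; rewrite in_itv/= => /andP[t0 t1].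
    by have [|d _] := dL t; rewrite ?(ltW t0) ?(ltW t1).
  + by apply: cvg_at_right_filter; apply: cL; rewrite lexx ler01.
  + by apply: cvg_at_left_filter; apply: cL; rewrite lexx ler01.
- move=> t; rewrite in_itv/= => /andP[t0 t1].
  by have [|_ <-] := dL t; rewrite ?(ltW t0) ?(ltW t1)// derive1E.
Qed.

(** Pieces of an arc are reparametrized over [0, 1], as [joined_step] requires. *)
Lemma arc_length_subarc (c : R -> M) (L : R -> R) (a b : R) : C1_curve (A:=A) c ->
  (forall t : R, 0 <= t <= 1 -> is_derive t 1 L (speed g c t)) ->
  0 <= a -> a <= b -> b <= 1 ->
  arc_length g (fun t => c (a + (b - a) * t)) = (L b - L a)%:E.
Proof.
move=> cc dL a0 ab b1.
have dL' (t : R) : 0 <= t <= 1 -> is_derive t 1 (fun t => L (a + (b - a) * t))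
    (speed g (fun t => c (a + (b - a) * t)) t).
  move=> /andP[t0 t1]; rewrite speed_affine// ger0_norm ?subr_ge0//.
  by apply: is_derive_affine_comp; apply: dL; nra.
rewrite (arc_lengthE (C1_curve_affine a (b - a) cc) dL').
by rewrite mulr1 mulr0 addr0 addrCA subrr addr0.
Qed.

Lemma arc_length_rev (c : R -> M) : C1_curve (A:=A) c ->
  arc_length g (fun t => c (1 + (-1) * t)) = arc_length g c.
Proof.
move=> cc; have [L dL] := primitive_of_continuous (speed_continuous cc).
have dL' (t : R) : 0 <= t <= 1 -> is_derive t 1 L (speed g c t).
  by move=> /andP[t0 t1]; apply: dL; lra.
have dLr (t : R) : 0 <= t <= 1 -> is_derive t 1 (fun t => - L (1 + (-1) * t))
    (speed g (fun t => c (1 + (-1) * t)) t).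
  move=> /andP[t0 t1]; rewrite speed_affine// normrN1 mul1r.
  have d1 : is_derive (1 + (-1) * t) 1 L (speed g c (1 + (-1) * t)).
    by apply: dL'; lra.
  have d3 := is_derive_affine_comp d1.
  have E (s : R) : - (-1 * s) = s by rewrite mulN1r opprK.
  by have := is_deriveN d3; rewrite E.
rewrite (arc_lengthE cc dL') (arc_lengthE (C1_curve_affine 1 (-1) cc) dLr).
by congr (_%:E); rewrite mulr1 mulr0 addr0 subrr opprK addrC.
Qed.

End curves.

(** * Riemannian distance and completeness *)

Section riemannian_distance.
Context {R : realType} {M : topologicalType} {n : nat}.
Context {A : smooth_atlas R M n} (g : riemannian_metric A).

Lemma arc_length_primitive (c : R -> M) : C1_curve (A:=A) c ->
  exists L : R -> R,
    [/\ forall t : R, 0 <= t <= 1 -> is_derive t 1 L (speed g c t),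
        {within `[0, 1], continuous L},
        {in `[0, 1] &, {homo L : s t / s <= t}}
      & arc_length g c = (L 1 - L 0)%:E].
Proof.
move=> cc; have [L dL] := primitive_of_continuous (speed_continuous (g := g) cc).
have dL' (t : R) : 0 <= t <= 1 -> is_derive t 1 L (speed g c t).
  by move=> /andP[t0 t1]; apply: dL; lra.
have cL : {within `[0, 1], continuous L}.
  apply: continuous_in_subspaceT => t; rewrite inE/= in_itv/= => /dL'[d _].
  exact/differentiable_continuous/derivable1_diffP.
exists L; split => //; last exact: arc_lengthE.
have dL1 (t : R) : t \in `]0, 1[ -> derivable L t 1 /\ 0 <= derive1 L t.
  rewrite in_itv/= => /andP[t0 t1].
  have [|d E] := dL' t; first by rewrite !ltW.
  by split=> //; rewrite derive1E E speed_ge0.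
move=> s t sI tI st; apply: (@ger0_derive1_le_cc _ L 0 1) => //.
- by move=> u /dL1[].
- by move=> u /dL1[].
Qed.

Lemma joined_real x y l : joined g x y l -> exists2 r : R, 0 <= r & l = r%:E.
Proof.
elim=> [|{}y {}l c _ [r r0 ->] cc _]; first by exists 0.
have [L [_ _ mL ->]] := arc_length_primitive cc.
exists (r + (L 1 - L 0)); last by rewrite EFinD.
by rewrite addr_ge0// subr_ge0 mL// in_itv/= lexx ler01.
Qed.

Lemma joined_trans x y z l m :
  joined g x y l -> joined g y z m -> joined g x z (l + m)%E.
Proof.
move=> xy; elim=> [|{}z {}m c _ IH cc cz]; first by rewrite adde0.
by rewrite addeA; exact: joined_step IH cc cz.
Qed.

Lemma joined_arc (c : R -> M) :
  C1_curve (A:=A) c -> joined g (c 0) (c 1) (arc_length g c).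
Proof.
by move=> cc; have := joined_step (joined_refl g (c 0)) cc erefl; rewrite add0e.
Qed.

Lemma joined_sym x y l : joined g x y l -> joined g y x l.
Proof.
elim=> [|{}y {}l c _ IH cc cy]; first exact: joined_refl.
rewrite addeC; apply: joined_trans IH.
have := joined_arc (C1_curve_affine 1 (-1) cc).
by rewrite mulr0 addr0 mulr1 subrr arc_length_rev// cy.
Qed.

(** Length-space property: a chain is cut where its length reaches a. By induction on the chain, the
    cut falls either in the earlier arcs, and the last arc is charged to b, or inside the last arc,
    at a parameter given by the intermediate value theorem. *)
Lemma joined_split x z l (a b : R) : joined g x z l ->
  (l < (a + b)%:E)%E -> 0 <= a -> 0 < b ->
  exists y l1 l2, [/\ joined g x y l1, joined g y z l2,
    (l1 <= a%:E)%E & (l2 < b%:E)%E].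
Proof.
move=> xz; elim: xz a b => [a b _ a0 b0|{}z {}l c xz IH cc cz a b].
  by exists x, 0%E, 0%E; split => //; exact: joined_refl.
have [r r0 lr] := joined_real xz; rewrite lr in xz IH *.
have [L [dL cL mL Ec]] := arc_length_primitive cc.
have L01 : L 0 <= L 1 by rewrite mL// in_itv/= lexx ler01.
rewrite Ec -EFinD lte_fin => lab a0 b0.
have [ra|ar] := leP r a; last first.
  have [|||y [l1 [l2 [j1 j2 l1a l2b]]]] := IH a (b - (L 1 - L 0)).
  - by rewrite lte_fin; lra.
  - by [].
  - by lra.
  exists y, l1, (l2 + (L 1 - L 0)%:E)%E; split => //.
    by rewrite -Ec; exact: joined_step j2 cc cz.
  by have [r2 _ ?] := joined_real j2; subst l2; rewrite -EFinD lte_fin; move: l2b; rewrite lte_fin; lra.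
(* The length still to be covered on the last arc, capped by the length of that arc. *)
pose s := Num.min (a - r) (L 1 - L 0).
have s0 : 0 <= s by rewrite le_min; apply/andP; split; lra.
have sm : s <= L 1 - L 0 by rewrite ge_min lexx orbT.
have sa : s <= a - r by rewrite ge_min lexx.
have [||t] := @IVT _ L 0 1 (L 0 + s) _ cL; first exact: ler01.
  by rewrite min_l// max_r//; apply/andP; split; lra.
rewrite in_itv/= => /andP[t0 t1] Lt.
have j1 := joined_arc (C1_curve_affine 0 (t - 0) cc).
have j2 := joined_arc (C1_curve_affine t (1 - t) cc).
rewrite (arc_length_subarc cc dL)// in j1.
rewrite (arc_length_subarc cc dL)// in j2.
rewrite mulr0 mulr1 add0r subr0 add0r in j1.
rewrite mulr0 mulr1 addr0 addrCA subrr addr0 in j2.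
exists (c t), (r%:E + (L t - L 0)%:E)%E, (L 1 - L t)%:E; split => //.
- by apply: joined_trans j1; rewrite cz.
- by rewrite -EFinD lee_fin; lra.
- rewrite lte_fin Lt; rewrite /s; have [] := leP (a - r) (L 1 - L 0); lra.
Qed.

(** Open balls as a relation: Hopf-Rinow is proved below for any relation with the properties of
    such balls. *)
Definition rnear (r : R) (x y : M) := (rdist g x y < r%:E)%E.

Lemma rnearP r x y : rnear r x y <-> exists2 l, joined g x y l & (l < r%:E)%E.
Proof.
split=> [/ereal_inf_lt[l xy lr]|[l xy]]; first by exists l.
by apply: le_lt_trans; exact: ereal_inf_lbound.
Qed.

Lemma rnear_refl r x : 0 < r -> rnear r x x.
Proof. by move=> r0; apply/rnearP; exists 0%E => //; exact: joined_refl. Qed.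

Lemma rnear_sym r x y : rnear r x y -> rnear r y x.
Proof. by move=> /rnearP[l /joined_sym xy lr]; apply/rnearP; exists l. Qed.

Lemma rnear_trans r s x y z : rnear r x y -> rnear s y z -> rnear (r + s) x z.
Proof.
move=> /rnearP[l xy lr] /rnearP[m yz ms]; apply/rnearP.
by exists (l + m)%E; [exact: joined_trans yz|rewrite EFinD lteD].
Qed.

Lemma rnearW r s x y : r <= s -> rnear r x y -> rnear s x y.
Proof. by move=> rs h; apply: lt_le_trans h _; rewrite lee_fin. Qed.

Lemma rnear_split a b x z : 0 < a -> 0 < b -> rnear (a + b) x z ->
  exists2 y, rnear a x y & rnear b y z.
Proof.
move=> a0 b0 /rnearP[l xz].
have [r r0 lr] := joined_real xz; rewrite lr lte_fin => rab.
(* [joined_split] bounds the first length only by <=, so it is applied to a - e; 2 e is at most the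
   slack a + b - r, and e < a. *)
pose e := Num.min (a + b - r) a / 2.
have e0 : 0 < e by rewrite divr_gt0// lt_min a0 andbT; lra.
have ea : e < a.
  rewrite ltr_pdivrMr// (@le_lt_trans _ _ a)// ?ge_min ?lexx ?orbT//; lra.
have er : 2 * e <= a + b - r.
  by rewrite mulrC divfK// ge_min lexx.
rewrite lr in xz.
have [|||y [l1 [l2 [j1 j2 l1a l2b]]]] := joined_split (a := a - e) (b := b) xz.
- by rewrite lte_fin; lra.
- lra.
- exact: b0.
exists y; apply/rnearP; last by exists l2.
by exists l1 => //; apply: le_lt_trans l1a _; rewrite lte_fin; lra.
Qed.

End riemannian_distance.

(** If P failed on K, the sets B for which P holds on K minus B would form a proper filter
    containing K; a cluster point of it in K contradicts the local hypothesis. *)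
Lemma compact_local_property (T : topologicalType) (K : set T) (P : set T -> Prop) :
  compact K -> P set0 -> (forall B C, P B -> P C -> P (B `|` C)) ->
  (forall B C, B `<=` C -> P C -> P B) ->
  (forall x, K x -> exists2 U, nbhs x U & P U) -> P K.
Proof.
move=> cK P0 PU PS locP; apply: contrapT => nPK.
pose F : set_system T := [set B | P (K `\` B)].
have FF : ProperFilter F.
  apply: Build_ProperFilter; first by rewrite /F/= setD0.
  split; rewrite /F/=.
  - by rewrite setDT.
  - by move=> B C PB PC; have := PU _ _ PB PC; rewrite -setDIr.
  - by move=> B C BC; apply: PS; exact: setDS.
have FK : F K by rewrite /F/= setDv.
have [x [Kx clx]] := cK F FF FK.
have [U xU PUx] := locP x Kx.
have FU : F (~` U) by apply: PS PUx => y [_ /contrapT].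
by have [y []] := clx _ _ FU xU.
Qed.

(** * Hopf-Rinow theorem in a length space *)

Section hopf_rinow.
Context {R : realType} {M : topologicalType}.
Variable E : R -> M -> M -> Prop.
Hypothesis E_refl : forall r x, 0 < r -> E r x x.
Hypothesis E_sym : forall r x y, E r x y -> E r y x.
Hypothesis E_trans : forall r s x y z, E r x y -> E s y z -> E (r + s) x z.
Hypothesis E_le : forall r s x y, r <= s -> E r x y -> E s x y.
Hypothesis E_split : forall a b x z, 0 < a -> 0 < b -> E (a + b) x z ->
  exists2 y, E a x y & E b y z.
Hypothesis E_nbhs : forall x r, 0 < r -> \forall y \near x, E r x y.

Definition relatively_compact (B : set M) := exists2 K, compact K & B `<=` K.

Hypothesis E_locally_compact :
  forall x, exists2 r, 0 < r & relatively_compact (E r x).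
Hypothesis E_complete : forall u : nat -> M,
  (forall e : R, 0 < e -> exists N : nat, forall i j : nat,
       (N <= i)%N -> (N <= j)%N -> E e (u i) (u j)) ->
  exists p : M, u @ \oo --> p.
Hypothesis M_hausdorff : hausdorff_space M.

Lemma relatively_compactS B C :
  B `<=` C -> relatively_compact C -> relatively_compact B.
Proof. by move=> BC [K cK CK]; exists K => //; exact: subset_trans CK. Qed.

Lemma relatively_compactU B C :
  relatively_compact B -> relatively_compact C -> relatively_compact (B `|` C).
Proof.
move=> [K cK BK] [L cL CL]; exists (K `|` L); first exact: compactU.
exact: setUSS.
Qed.

(** By [E_split] the ball of radius r + h is covered by h-balls centred in the r-ball. The closure
    of the r-ball is compact, and near each of its points the h-balls with nearby centres all lie in
    one ball of radius 2 h. *)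
Lemma relatively_compact_thicken r h x : 0 < r -> 0 < h ->
  relatively_compact (E r x) ->
  (forall y, E r x y -> relatively_compact (E (2 * h) y)) ->
  relatively_compact (E (r + h) x).
Proof.
move=> r0 h0 [K cK EK] locRC; have clK := compact_closed M_hausdorff cK.
have cE : compact (closure (E r x)).
  apply: subclosed_compact cK _; first exact: closed_closure.
  by apply: (subset_trans (closure_subset EK)); rewrite -(closure_id K).1.
pose P (B : set M) :=
  relatively_compact [set z | exists2 y, B y /\ E r x y & E h y z].
suff : P (closure (E r x)).
  apply: relatively_compactS => z /(E_split r0 h0)[y xy yz].
  by exists y => //; split => //; exact: subset_closure.
apply: (compact_local_property cE).
- exists set0; first exact: compact0.
  by move=> z [y [[]]].
- move=> B C PB PC; apply: relatively_compactS (relatively_compactU PB PC).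
  by move=> z [y [[By|Cy] xy] yz]; [left|right]; exists y.
- move=> B C BC; apply: relatively_compactS => z [y [By xy] yz].
  by exists y => //; split => //; exact: BC.
(* Both y0 and y lie within h / 4 of k, and z within h of y, so z is within 3 h / 2 of y0. *)
move=> k Ek; have h4 : 0 < h / 4 by rewrite divr_gt0.
have [y0 [xy0 ky0]] := Ek _ (E_nbhs k h4).
exists (E (h / 4) k); first exact: E_nbhs.
apply: relatively_compactS (locRC _ xy0) => z [y [ky xy] yz].
have := E_trans (E_trans (E_sym ky0) ky) yz.
by apply: E_le; lra.
Qed.

(** Otherwise two thickenings by s / 4 carry relative compactness from s / 2 to 3 s / 4 and then to
    s; each of them asks for balls of radius 2 (s / 4) = s / 2. *)
Lemma not_relatively_compact_half s x : 0 < s -> ~ relatively_compact (E s x) ->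
  exists2 y, E s x y & ~ relatively_compact (E (s / 2) y).
Proof.
move=> s0 nRC; apply: contrapT => H; apply: nRC.
have {}H y : E s x y -> relatively_compact (E (s / 2) y).
  by move=> xy; apply: contrapT => nRC; apply: H; exists y.
have s4 : 0 < s / 4 by lra.
have RC1 : relatively_compact (E (s / 2 + s / 4) x).
  apply: relatively_compact_thicken => //; first lra.
    by apply: H; exact: E_refl.
  move=> y xy; have -> : 2 * (s / 4) = s / 2 by lra.
  by apply: H; apply: E_le xy; lra.
have -> : s = s / 2 + s / 4 + s / 4 by lra.
apply: relatively_compact_thicken => //; first lra.
move=> y xy; have -> : 2 * (s / 4) = s / 2 by lra.
by apply: H; apply: E_le xy; lra.
Qed.

(* Starting from a ball that is not relatively compact, one finds such balls of
   radii [s / 2 ^ i] whose centres form a Cauchy sequence; this contradicts local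
   compactness at its limit. *)
Theorem hopf_rinow s x : 0 < s -> relatively_compact (E s x).
Proof.
move=> s0; apply: contrapT => nRC.
pose Q (p : nat * M) := ~ relatively_compact (E (s / 2 ^+ p.1) p.2).
have sn i : 0 < s / 2 ^+ i by rewrite divr_gt0// exprn_gt0.
have sS i : s / 2 ^+ i / 2 = s / 2 ^+ i.+1.
  by rewrite exprSr invfM mulrA.
have step p : exists q, Q p -> [/\ Q q, q.1 = p.1.+1 & E (s / 2 ^+ p.1) p.2 q.2].
  have [Qp|] := pselect (Q p); last by exists p.
  have [y py nRCy] := not_relatively_compact_half (sn p.1) Qp.
  by exists (p.1.+1, y) => _; split => //; rewrite /Q /= -sS.
have [f fP] := choice step.
pose p i := iter i f (0%N, x).
have pP i : Q (p i) /\ (p i).1 = i.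
  elim: i => [|i [Qi ei]]; first by split => //; rewrite /Q /= expr0 divr1.
  by have [Q1 e1 _] := fP _ Qi; split => //; rewrite -[(p i.+1).1]/((f (p i)).1) e1 ei.
pose u i := (p i).2.
have uS i : E (s / 2 ^+ i) (u i) (u i.+1).
  by have [Qi ei] := pP i; have [_ _] := fP _ Qi; rewrite ei.
have uD i j : E (3 * (s / 2 ^+ i)) (u i) (u (i + j)%N).
  (* Partial sums of a geometric series. The subtracted term closes the induction, and the factor 3
     instead of 2 keeps the radius positive at j = 0. *)
  suff : E (3 * (s / 2 ^+ i) - 2 * (s / 2 ^+ (i + j))) (u i) (u (i + j)%N).
    by apply: E_le; have := sn (i + j)%N; lra.
  elim: j => [|j IH].
    rewrite addn0; apply: E_refl; have := sn i; lra.
  rewrite addnS; apply: E_le (E_trans IH (uS _)).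
  have := sS (i + j)%N; lra.
have small (e : R) : 0 < e -> exists N : nat, forall i, (N <= i)%N -> 6 * (s / 2 ^+ i) < e.
  move=> e0.
  have /cvgrPdist_lt/(_ (e / (6 * s))) : (fun i => (2^-1 : R) ^+ i) @ \oo --> (0 : R).
    by apply: cvg_expr; rewrite ger0_norm; lra.
  rewrite divr_gt0// ?mulr_gt0// => /(_ isT)[N _ NP]; exists N => i /NP/=.
  rewrite sub0r normrN ger0_norm ?exprn_ge0 ?invr_ge0//.
  by rewrite ltr_pdivlMr ?mulr_gt0// mulrC exprVn -mulrA.
have /E_complete[l ul] : forall e : R, 0 < e -> exists N : nat,
    forall i j : nat, (N <= i)%N -> (N <= j)%N -> E e (u i) (u j).
  move=> e /small[N NP]; exists N => i j Ni Nj.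
  have iN : E (3 * (s / 2 ^+ N)) (u N) (u i) by rewrite -(subnKC Ni); exact: uD.
  have jN : E (3 * (s / 2 ^+ N)) (u N) (u j) by rewrite -(subnKC Nj); exact: uD.
  apply: E_le (E_trans (E_sym iN) jN); apply: ltW; have := NP _ (leqnn N); lra.
have [r r0 RC] := E_locally_compact l.
have r2 : 0 < r / 2 by lra.
have [N NP] := small _ r2.
have [N' _ N'P] := ul _ (E_nbhs l r2).
pose i := maxn N N'.
have [Qi ei] := pP i; apply: Qi; apply: relatively_compactS RC => z uz.
have lu : E (r / 2) l (u i) by apply: N'P; rewrite /= leq_maxr.
apply: E_le (E_trans lu uz); rewrite ei. 
have := NP i (leq_maxl _ _); have := sn i; lra.
Qed.

End hopf_rinow.

(** * Comparison of the metric with the coordinate norm *)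

Section local_geometry.
Context {R : realType} {M : topologicalType} {n : nat}.
Context {A : smooth_atlas R M n} (g : riemannian_metric A).

(** The norm on row vectors is the sup norm: these closed balls are boxes, compact and of known
    Lebesgue measure. *)
Definition cube (x : 'rV[R]_n) (r : R) : set 'rV[R]_n := [set y | `|y - x| <= r].

Lemma cubeE x (r : R) : 0 <= r -> cube x r =
  [set y | forall a, (x - const_mx r) 0 a <= y 0 a <= (x + const_mx r) 0 a].
Proof.
move=> r0; apply/seteqP; split=> y /= yr.
  move=> a; rewrite !mxE -ler_distlC distrC.
  by have := coord_le_norm (y - x) a; rewrite !mxE => /le_trans; exact.
apply: norm_le_coord => // a; have := yr a.
by rewrite !mxE -ler_distlC distrC.
Qed.

Lemma cube_compact x (r : R) : 0 <= r -> compact (cube x r).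
Proof.
move=> r0; rewrite cubeE//.
apply: (@rV_compact _ n (fun a => `[(x - const_mx r) 0 a, (x + const_mx r) 0 a]%classic)).
by move=> a; exact: segment_compact.
Qed.

Lemma cube_nbhs x (r : R) : 0 < r -> nbhs x (cube x r).
Proof.
move=> r0; apply/nbhs_ballP; exists r => //= y.
by rewrite -ball_normE /= distrC => /ltW.
Qed.

Lemma cube_in_chart (i : chart A) x : ccod i x ->
  exists2 r : R, 0 < r & cube x r `<=` ccod i.
Proof.
move=> xi; have /nbhs_ballP[e /= e0 eV] : nbhs x (ccod i).
  by apply: open_nbhs_nbhs; split => //; exact: ccod_open.
exists (e / 2) => [|y /= yx]; first by rewrite divr_gt0.
by apply: eV; rewrite -ball_normE /= distrC (le_lt_trans yx)//; lra.
Qed.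

Lemma quadratic_formZ (a : R) (w : 'rV[R]_n) (B : 'M[R]_n) :
  (a *: w *m B *m (a *: w)^T) 0 0 = a ^+ 2 * (w *m B *m w^T) 0 0.
Proof. by rewrite linearZ /= -!scalemxAl -scalemxAr scalerA mxE expr2. Qed.

(** Homogeneity reduces the estimate to unit vectors; there the quadratic form is continuous and
    positive on a compact set, hence lies between two positive constants. *)
Lemma metric_comparison (i : chart A) x (r : R) : 0 <= r -> cube x r `<=` ccod i ->
  exists k K : R, [/\ 0 < k, 0 < K &
    forall y (v : 'rV[R]_n), cube x r y ->
      k * `|v| <= Num.sqrt ((v *m g i y *m v^T) 0 0) <= K * `|v|].
Proof.
move=> r0 xri.
pose q (p : 'rV[R]_n * 'rV[R]_n) : R := (p.2 *m g i p.1 *m p.2^T) 0 0.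
pose S : set 'rV[R]_n := [set v | `|v| = 1].
(* An empty unit sphere forces every v to be 0, and any constants serve. *)
have [[v0 Sv0]|S0] := pselect (S !=set0); last first.
  exists 1, 1; split => // y v _.
  have [->|v0] := eqVneq v 0; first by rewrite !mul0mx mxE sqrtr0 normr0 mulr0 lexx.
  exfalso; apply: S0; exists (`|v|^-1 *: v).
  by rewrite /S/= normrZ normfV normr_id mulVf// normr_eq0.
have cS : compact S.
  apply: bounded_closed_compact.
    by exists 1; split => // s s1 v /= ->; exact: ltW.
  have -> : S = (fun v : 'rV[R]_n => `|v|) @^-1` [set x | x = 1] by [].
  apply: preimage_closed; last exact: closed_eq.
  by move=> v _; exact: norm_continuous.
pose D := cube x r `*` S.
have cD : compact D by apply: compact_setX => //; exact: cube_compact.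
have D0 : D !=set0 by exists (x, v0); split => //=; rewrite /cube/= subrr normr0.
have cq : {within D, continuous q}.
  apply: continuous_in_subspaceT => -[y v] /[!inE] -[/= /xri yi _].
  apply: (@cvg_quadratic_form R n _ (nbhs (y, v)) _ snd (fun p => g i p.1) v (g i y)).
    move=> a; apply: (@cvg_comp _ _ _ snd (fun w : 'rV[R]_n => w 0 a)).
      exact: cvg_snd.
    exact: coord_continuous.
  move=> a b; apply: (@cvg_comp _ _ _ fst (fun w : 'rV[R]_n => g i w a b)).
    exact: cvg_fst.
  exact: metric_continuous.
have [[y1 v1] /[!inE] -[/= D1 S1] minq] := compact_EVT_min D0 cD cq.
have [[y2 v2] /[!inE] -[/= D2 S2] maxq] := compact_EVT_max D0 cD cq.
have nz (w : 'rV[R]_n) : S w -> w != 0.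
  by rewrite /S/= => w1; rewrite -normr_eq0 w1 oner_neq0.
have q1 : 0 < q (y1, v1) by apply: gmx_pos; [exact: xri|exact: nz].
have q2 : 0 < q (y2, v2) by apply: gmx_pos; [exact: xri|exact: nz].
exists (Num.sqrt (q (y1, v1))), (Num.sqrt (q (y2, v2))).
split; rewrite ?sqrtr_gt0// => y v yxr.
have [->|v0'] := eqVneq v 0; first by rewrite !mul0mx mxE sqrtr0 normr0 !mulr0 lexx.
have nv : 0 < `|v| by rewrite normr_gt0.
pose w := `|v|^-1 *: v.
have Sw : S w by rewrite /S/= normrZ normfV normr_id mulVf// gt_eqF.
have -> : v = `|v| *: w by rewrite scalerA divff ?gt_eqF// scale1r.
have -> : (`|v| *: w *m g i y *m (`|v| *: w)^T) 0 0 = `|v| ^+ 2 * q (y, w).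
  exact: quadratic_formZ.
rewrite sqrtrM ?sqr_ge0// sqrtr_sqr normr_id normrZ normr_id.
rewrite (_ : `|w| = 1)// mulr1 ![_ * `|v|]mulrC !ler_pM2l//.
have yw : (y, w) \in D by rewrite inE.
by rewrite !ler_wsqrtr ?minq ?maxq.
Qed.

Lemma chart_image_compact (i : chart A) x (r : R) : 0 <= r -> cube x r `<=` ccod i ->
  compact (bwd i @` cube x r).
Proof.
move=> r0 xri; apply: continuous_compact; last exact: cube_compact.
apply: continuous_in_subspaceT => y /[!inE] /xri yi; exact: bwd_continuous.
Qed.

Lemma chart_image_nbhs (i : chart A) p (r : R) : 0 < r -> cdom i p ->
  nbhs p (bwd i @` cube (fwd i p) r).
Proof.
move=> r0 pi; have h : \forall q \near p, cube (fwd i p) r (fwd i q).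
  exact: fwd_continuous pi _ (cube_nbhs _ r0).
near=> q; exists (fwd i q); first by near: q.
by have [_ ->//] : ccod i (fwd i q) /\ bwd i (fwd i q) = q;
  apply: fwdP; near: q; exact: near_cdom.
Unshelve. all: by end_near. Qed.

(** * Short curves stay in a chart *)

Section trap.
Variables (i : chart A) (x : 'rV[R]_n) (r k : R).
Hypotheses (r0 : 0 < r) (k0 : 0 < k) (xri : cube x r `<=` ccod i).
Hypothesis lower : forall y (v : 'rV[R]_n), cube x r y ->
  k * `|v| <= Num.sqrt ((v *m g i y *m v^T) 0 0).

Let in_cube (p : M) := cdom i p /\ cube x r (fwd i p).

(** For each coordinate and each sign u, L / k minus u times the coordinate has a nonnegative
    derivative, because the speed is at least k times the norm of the coordinate velocity. *)
Lemma displacement_le (c : R -> M) (L : R -> R) (t : R) : C1_curve (A:=A) c ->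
  (forall s : R, 0 <= s <= 1 -> is_derive s 1 L (speed g c s)) ->
  0 <= t -> t <= 1 -> (forall s : R, 0 <= s <= t -> in_cube (c s)) ->
  `|fwd i (c t) - fwd i (c 0)| <= (L t - L 0) / k.
Proof.
move=> cc dL t0 t1 ct.
have dc (s : R) b : 0 <= s <= t ->
    is_derive s 1 (Defs.coord c i b) (velocity c i s 0 b).
  by move=> /ct[ci _]; exact: coord_is_derive.
have vk (s : R) b : 0 <= s <= t -> `|velocity c i s 0 b| <= speed g c s / k.
  move=> /ct[ci cis]; rewrite ler_pdivlMr// mulrC (speed_chart g cc ci).
  by apply: le_trans (lower _ cis); rewrite ler_pM2l// coord_le_norm.
have step (u : R) b : `|u| = 1 ->
    u * (Defs.coord c i b t - Defs.coord c i b 0) <= (L t - L 0) / k.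
  move=> u1; pose h (s : R) : R := k^-1 * L s - u * Defs.coord c i b s.
  have dh (s : R) : 0 <= s <= t ->
      is_derive s 1 h (k^-1 * speed g c s - u * velocity c i s 0 b).
    move=> st; have d1 := dc s b st.
    have d2 : is_derive s 1 L (speed g c s).
      by apply: dL; move: st => /andP[? ?]; apply/andP; split => //; lra.
    exact: is_deriveB (is_deriveZ k^-1 d2) (is_deriveZ u d1).
  have hle : h 0 <= h t.
    apply: (@ger0_derive1_le_cc _ h 0 t); rewrite ?bound_itvE// ?in_itv/= ?lexx ?t0//.
    - by move=> s; rewrite in_itv/= => /andP[s0 st]; have [|d _] := dh s; rewrite ?ltW.
    - move=> s; rewrite in_itv/= => /andP[s0 st]; have st' : 0 <= s <= t by rewrite !ltW.
      have [_] := dh s st'; rewrite derive1E => ->; rewrite subr_ge0 [leRHS]mulrC.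
      have := vk s b st'; apply: le_trans.
      by rewrite -[X in _ <= X]mul1r -u1 -normrM ler_norm.
    - apply: continuous_in_subspaceT => s; rewrite inE/= in_itv/= => /dh[d _].
      exact/differentiable_continuous/derivable1_diffP.
  move: hle; rewrite /h [(_ - _) / k]mulrC; lra.
apply: norm_le_coord => [|b].
  rewrite divr_ge0 ?(ltW k0)// subr_ge0.
  have tI (s : R) : 0 <= s <= t -> 0 <= s <= 1.
    by move=> /andP[? ?]; apply/andP; split => //; lra.
  apply: (@ger0_derive1_le_cc _ L 0 t); rewrite ?bound_itvE// ?in_itv/= ?lexx ?t0//.
  - move=> s /subset_itv_oo_cc; rewrite in_itv/= => /tI st.
    by have [d _] := dL s st.
  - move=> s /subset_itv_oo_cc; rewrite in_itv/= => /tI st.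
    by have [_] := dL s st; rewrite derive1E => ->; exact: speed_ge0.
  - apply: continuous_in_subspaceT => s; rewrite inE/= in_itv/= => /tI/dL[d _].
    exact/differentiable_continuous/derivable1_diffP.
rewrite !mxE ler_norml -lerN2 opprK.
have := step 1 b (normr1 _); have := step (-1) b (normrN1 _).
rewrite /Defs.coord; lra.
Qed.

Let inner (p : M) := cdom i p /\ `|fwd i p - x| < r.

Let inner_open : open inner.
Proof.
rewrite openE => p [pi px].
have h : \forall q \near p, ball x r (fwd i q).
  apply: fwd_continuous => //; apply: open_nbhs_nbhs; split; first exact: ball_open.
  by rewrite -ball_normE /= distrC.
apply: (@filterS2 _ (nbhs p) _ _ _ _ _ (near_cdom pi) h) => q qi.
by rewrite -ball_normE /= distrC.
Qed.

Let inner_cube p : inner p -> in_cube p.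
Proof. by move=> [pi /ltW]. Qed.

(** At a first time u outside the open cube the curve is still in the closed one, so the
    displacement bound holds up to u and puts the curve at distance < r from the centre, a
    contradiction. *)
Lemma curve_trapped (c : R -> M) (L : R -> R) : C1_curve (A:=A) c ->
  (forall s : R, 0 <= s <= 1 -> is_derive s 1 L (speed g c s)) ->
  {in `[0, 1] &, {homo L : s t / s <= t}} ->
  cdom i (c 0) -> `|fwd i (c 0) - x| + (L 1 - L 0) / k < r ->
  cdom i (c 1) /\ `|fwd i (c 1) - x| <= `|fwd i (c 0) - x| + (L 1 - L 0) / k.
Proof.
move=> cc dL mL c0i c0r.
have dist (t : R) : 0 <= t -> t <= 1 -> (forall s : R, 0 <= s <= t -> in_cube (c s)) ->
    `|fwd i (c t) - x| <= `|fwd i (c 0) - x| + (L 1 - L 0) / k.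
  move=> t0 t1 ct; rewrite -(subrK (fwd i (c 0)) (fwd i (c t))) -addrA addrC.
  rewrite (le_trans (ler_normD _ _))// lerD2l (le_trans (displacement_le cc dL t0 t1 ct))//.
  by rewrite ler_pM2r ?invr_gt0// lerD2r mL// ?in_itv/= ?t0 ?t1 ?lexx ?ler01.
suff ct (t : R) : 0 <= t <= 1 -> inner (c t).
  split; first by have [] := ct 1; rewrite ?ler01 ?lexx.
  by apply: dist => // s /ct/inner_cube.
apply: contrapT => nct.
pose Z : set R := `[0, 1]%classic `&` c @^-1` (~` inner).
have Z0 : Z !=set0.
  apply: contrapT => nZ; apply: nct => t01; apply: contrapT => nin.
  by apply: nZ; exists t; split => //=; rewrite in_itv.
have cZ : compact Z.
  apply: subclosed_compact (@segment_compact R 0 1) _; last by move=> s [].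
  apply: closedI; first exact: interval_closed.
  apply: preimage_closed; last exact: open_closedC.
  by move=> s _; exact: cc.1.
have [] := compact_EVT_min Z0 cZ (f := id); first by apply: continuous_subspaceT => s; exact: cvg_id.
move=> u /[!inE] -[/=]; rewrite in_itv/= => /andP[u0 u1] nu minu.
have before (s : R) : 0 <= s -> s < u -> inner (c s).
  move=> s0 su; apply: contrapT => ns.
  suff : u <= s by rewrite leNgt su.
  by apply: minu; rewrite inE; split => //=; rewrite in_itv/= s0 (le_trans (ltW su)).
have inner0 : inner (c 0).
  split => //; apply: le_lt_trans c0r; rewrite lerDl divr_ge0 ?(ltW k0)// subr_ge0.
  by rewrite mL// in_itv/= ?lexx ?ler01.
have u_gt0 : 0 < u.
  by rewrite lt_neqAle u0 andbT; apply/eqP => E; apply: nu; rewrite -E.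
(* The chart image of the closed cube is compact, hence closed as M is Hausdorff, and it contains c
   s for every s in [0, u[. *)
have cu : in_cube (c u).
  suff [y yr yu] : (bwd i @` cube x r) (c u).
    by have [? fb] := bwdP (xri yr); rewrite /in_cube -yu fb.
  have clK := compact_closed (atlas_hausdorff A) (chart_image_compact (ltW r0) xri).
  apply: contrapT => nK.
  have : \forall s \near u, ~ (bwd i @` cube x r) (c s).
    have N : nbhs (c u) (~` (bwd i @` cube x r)).
      by apply: open_nbhs_nbhs; split => //; exact: closed_openC.
    exact: (cc.1 u _ N).
  move=> /nbhs_ballP[e /= e0 eP].
  pose s := Num.max 0 (u - e / 2).
  have su : s < u by rewrite gt_max u_gt0/=; lra.
  have s0 : 0 <= s by rewrite le_max lexx.
  apply: (eP s).
    rewrite -ball_normE /= ger0_norm ?subr_ge0 ?(ltW su)//.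
    have us : u - e / 2 <= s by rewrite le_max lexx orbT.
    lra.
  have [ci cr] := inner_cube (before s s0 su); exists (fwd i (c s)) => //.
  by have [_] := fwdP ci.
apply: nu; split; first exact: cu.1.
apply: le_lt_trans c0r; apply: dist => // s /andP[s0].
by rewrite le_eqVlt => /predU1P[->//|su]; apply: inner_cube; exact: before.
Qed.

(** The whole chain has the length budget k * r, so each arc starts with the margin that
    [curve_trapped] asks for. *)
Lemma joined_trapped p q l : joined g p q l -> cdom i p -> fwd i p = x ->
  (l < (k * r)%:E)%E -> cdom i q /\ ((k * `|fwd i q - x|)%:E <= l)%E.
Proof.
move=> pq pi px; elim: pq => [_|{}q {}l c pq IH cc cq].
  by split => //; rewrite px subrr normr0 mulr0.
have [s s0 ls] := joined_real pq; rewrite ls in IH *.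
have [L [dL _ mL ->]] := arc_length_primitive g cc.
rewrite -EFinD lte_fin => skr.
have L01 : L 0 <= L 1 by rewrite mL// in_itv/= ?lexx ?ler01.
have [|qi] := IH; first by rewrite lte_fin; lra.
rewrite lee_fin => ks; rewrite -cq in qi ks.
have qs : `|fwd i (c 0) - x| <= s / k by rewrite ler_pdivlMr// mulrC.
have [|ci1 cr1] := curve_trapped cc dL mL qi.
  apply: (@le_lt_trans _ _ ((s + (L 1 - L 0)) / k)); first by rewrite [leRHS]mulrDl lerD2r.
  by rewrite ltr_pdivrMr// mulrC.
split => //; rewrite lee_fin mulrC -ler_pdivlMr//.
by apply: le_trans cr1 _; rewrite [leRHS]mulrDl lerD2r.
Qed.

End trap.

(** Chains from p of length < k * r cannot leave the chart image of the cube, which is compact. *)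
Lemma rnear_locally_compact p : exists2 r : R, 0 < r & relatively_compact (rnear g r p).
Proof.
have pi := chart_atP A p; set i := chart_at A p in pi.
have [fi bfi] := fwdP pi.
have [r r0 xri] := cube_in_chart fi.
have [k [K [k0 K0 kK]]] := metric_comparison (ltW r0) xri.
exists (k * r); first exact: mulr_gt0.
exists (bwd i @` cube (fwd i p) r); first exact: chart_image_compact (ltW r0) _.
move=> q /rnearP[l pq lr].
have lower y (v : 'rV[R]_n) : cube (fwd i p) r y ->
    k * `|v| <= Num.sqrt ((v *m g i y *m v^T) 0 0).
  by move=> yr; have /andP[] := kK y v yr.
have [qi ql] := joined_trapped r0 k0 xri lower pq pi erefl lr.
exists (fwd i q); last by have [] := fwdP qi.
have := le_lt_trans ql lr; rewrite lte_fin ltr_pM2l// => /ltW; exact.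
Qed.

(** The integral of a nonnegative function is the supremum over the simple functions below it, so
    monotonicity holds for arbitrary nonnegative functions. *)
Lemma le_integral_ge0 d (T : measurableType d) (mu : {measure set T -> \bar R})
    (D : set T) (f h : T -> \bar R) :
  (forall x, D x -> (0 <= f x)%E) -> (forall x, D x -> (f x <= h x)%E) ->
  (\int[mu]_(x in D) f x <= \int[mu]_(x in D) h x)%E.
Proof.
move=> f0 fh; rewrite integral_mkcond [leRHS]integral_mkcond.
have f0' x : (0 <= (f \_ D) x)%E by exact: erestrict_ge0.
have h0' x : (0 <= (h \_ D) x)%E.
  by apply: erestrict_ge0 => y Dy; exact: le_trans (f0 y Dy) (fh y Dy).
rewrite !ge0_integralTE//; apply: ereal_sup_le => _ [s sf <-]; exists s => // x.
by apply: le_trans (sf x) _; exact: lee_restrict.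
Qed.

End local_geometry.

(** * Coordinate segments as admissible curves *)

Section chart_segment.
Context {R : realType} {M : topologicalType} {n : nat}.
Context {A : smooth_atlas R M n} (g : riemannian_metric A).
Variables (i : chart A) (x y : 'rV[R]_n) (r : R).
Hypothesis r0 : 0 < r.
Hypotheses (xri : cube x r `<=` ccod i) (yr : cube x r y).

(** [C1_curve] concerns the whole real line, on which an affine parametrization could leave the
    chart. The sine runs from 0 to 1 on [0, 1] and stays in [-1, 1], so the curve never leaves the
    cube, and its derivative is at most pi / 2. The summand 0 fits the form of
    [is_derive_affine_comp]. *)
Let th (t : R) : R := sin (0 + pi / 2 * t).
Let dth (t : R) : R := pi / 2 * cos (0 + pi / 2 * t).
Let line (t : R) : 'rV[R]_n := x + th t *: (y - x).
Let c (t : R) : M := bwd i (line t).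

Let d_th (t : R) : is_derive t 1 th (dth t).
Proof. exact: is_derive_affine_comp. Qed.

Let c_dth : continuous dth.
Proof.
move=> t; apply: (@cvgM _ _ (nbhs t)); first exact: cvg_cst.
apply: (@cvg_comp _ _ _ (fun t => 0 + pi / 2 * t) cos _ (nbhs (0 + pi / 2 * t))); last exact: continuous_cos.
apply: (@cvgD _ _ _ (nbhs t)); first exact: cvg_cst.
by apply: (@cvgM _ _ (nbhs t)); [exact: cvg_cst|exact: cvg_id].
Qed.

Let d_line (t : R) a : is_derive t 1 (fun s => line s 0 a) (dth t * (y - x) 0 a).
Proof.
have -> : (fun s => line s 0 a) = (fun s => (y - x) 0 a *: th s + x 0 a).
  by apply/funext => s; rewrite !mxE addrC mulrC.
have := is_deriveD (is_deriveZ ((y - x) 0 a) (d_th t)) (is_derive_cst (x 0 a) t 1).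
by rewrite addr0 -[_ *: dth t]/(_ * _) mulrC.
Qed.

Let c_th : continuous th.
Proof. by move=> t; have [d _] := d_th t; exact/differentiable_continuous/derivable1_diffP. Qed.

Let c_line : continuous line.
Proof.
move=> t; apply: (@cvgD _ _ _ (nbhs t)); first exact: cvg_cst.
apply: cvgZr_tmp; exact: c_th.
Qed.

Let line_cube t : cube x r (line t).
Proof.
rewrite /cube/= /line addrC addrA addNr add0r normrZ (le_trans _ yr)//.
by rewrite ler_piMl// ler_norml sin_geN1 sin_le1.
Qed.

Let line_chart t : ccod i (line t). Proof. exact: xri. Qed.

Let coord_line (j : chart A) (b : 'I_n) t : cdom j (c t) ->
  is_derive t 1 (Defs.coord c j b)
    (\sum_a dth t * (y - x) 0 a *
       partial a (fun z => fwd j (bwd i z) 0 b) (line t)).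
Proof.
move=> cj; apply: (@Ck1_chain_rule R n (ccod i `&` bwd i @^-1` cdom j)
  (fun z => fwd j (bwd i z) 0 b) line t (fun a => dth t * (y - x) 0 a)).
- exact: open_chart_preimage (cdom_open j).
- exact: transition_smooth.
- by split.
- exact: c_line.
- exact: d_line.
Qed.

Lemma chart_segment_C1 : C1_curve (A:=A) c.
Proof.
have cc : continuous c.
  by move=> t; exact: cvg_comp (@c_line t) (bwd_continuous (line_chart t)).
split=> // t j b cj; have [d E] := coord_line b cj; split; first exact: d.
rewrite /prop_for/continuous_at derive1E E.
apply: (@cvg_trans _ ((fun s => \sum_a dth s * (y - x) 0 a *
       partial a (fun z => fwd j (bwd i z) 0 b) (line s)) @ t)).
  have ns : \forall s \near t, cdom j (c s) by exact: cc _ _ (near_cdom cj).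
  apply: near_eq_cvg; apply: filterS ns => s cs.
  by rewrite [RHS]derive1E; have [_ ->] := coord_line b cs.
apply: (@cvg_big _ _ +%R 0 xpredT (@add_continuous R) _ (nbhs t)) => a _.
have [_ /(_ a)[_ [ca _]]] := transition_smooth i j b 1.
have H1 : dth s * (y - x) 0 a @[s --> t] --> dth t * (y - x) 0 a.
  by apply: (@cvgM _ _ (nbhs t)); [exact: c_dth|exact: cvg_cst].
have H2 := cvg_comp _ _ (@c_line t) (ca (line t) (conj (line_chart t) cj)).
apply: (@cvgM _ _ (nbhs t)); [exact: H1|exact: H2].
Qed.

Lemma chart_segment_length (K : R) : 0 < K ->
  (forall z (v : 'rV[R]_n), cube x r z ->
     Num.sqrt ((v *m g i z *m v^T) 0 0) <= K * `|v|) ->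
  (arc_length g c <= (K * (pi / 2 * `|y - x|))%:E)%E.
Proof.
move=> K0 upper.
have ci t : cdom i (c t) by have [] := bwdP (line_chart t).
have fc t : fwd i (c t) = line t by have [] := bwdP (line_chart t).
have vE t : velocity c i t = dth t *: (y - x).
  apply/rowP => b; rewrite !mxE derive1E.
  have -> : Defs.coord c i b = (fun s => line s 0 b).
    by apply/funext => s; rewrite /Defs.coord fc.
  by have [_ ->] := d_line t b; rewrite !mxE.
apply: (@le_trans _ _ (\int[lebesgue_measure]_(t in `[0%R, 1%R])
    (K * (pi / 2 * `|y - x|))%:E)%E).
  apply: le_integral_ge0 => t _; first by rewrite lee_fin speed_ge0.
  rewrite lee_fin (speed_chart g chart_segment_C1 (ci t)) fc vE.
  apply: (le_trans (upper _ _ (line_cube t))).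
  rewrite ler_pM2l// normrZ ler_wpM2r// normrM ger0_norm ?divr_ge0 ?pi_ge0//.
  by rewrite ler_piMr ?divr_ge0 ?pi_ge0// ler_norml cos_geN1 cos_le1.
rewrite integral_cst//= lebesgue_measure_itv/= lte_fin ltr01 oppr0 adde0.
by rewrite mule1.
Qed.

Lemma chart_segment_joined : joined g (bwd i x) (bwd i y) (arc_length g c).
Proof.
have := joined_arc g chart_segment_C1.
rewrite /c /line /th mulr0 addr0 mulr1 add0r sin0 scale0r addr0 sin_pihalf scale1r.
by rewrite addrC subrK.
Qed.

End chart_segment.

(** * Compact closure of bounded sets *)

Section bounded_domains.
Context {R : realType} {M : topologicalType} {n : nat}.
Context {A : smooth_atlas R M n} (g : riemannian_metric A).

Lemma rnear_nbhs p (e : R) : 0 < e -> \forall q \near p, rnear g e p q.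
Proof.
move=> e0; have pi' := chart_atP A p; set i := chart_at A p in pi'.
have [fi bfi] := fwdP pi'.
have [r r0 xri] := cube_in_chart fi.
have [k [K [k0 K0 kK]]] := metric_comparison g (ltW r0) xri.
have upper z (v : 'rV[R]_n) : cube (fwd i p) r z ->
    Num.sqrt ((v *m g i z *m v^T) 0 0) <= K * `|v|.
  by move=> zr; have /andP[] := kK z v zr.
(* With this s the coordinate segment has length at most K (pi / 2) s <= e / 2 < e. *)
pose s := Num.min r (e / (K * pi)).
have s0 : 0 < s by rewrite lt_min r0 divr_gt0// mulr_gt0// pi_gt0.
have h : \forall q \near p, cube (fwd i p) s (fwd i q).
  exact: fwd_continuous pi' _ (cube_nbhs _ s0).
near=> q.
have qi : cdom i q by near: q; exact: near_cdom.
have qs : cube (fwd i p) s (fwd i q) by near: q.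
have [_ bfq] := fwdP qi.
have qr : cube (fwd i p) r (fwd i q) by apply: le_trans qs _; rewrite ge_min lexx.
have J := chart_segment_joined g xri qr; rewrite bfi bfq in J.
apply/rnearP; eexists; first exact: J.
apply: le_lt_trans (chart_segment_length xri qr K0 upper) _; rewrite lte_fin.
have : `|fwd i q - fwd i p| <= e / (K * pi).
  by apply: le_trans qs _; rewrite ge_min lexx orbT.
rewrite ler_pdivlMr ?mulr_gt0 ?pi_gt0// => H.
apply: (@le_lt_trans _ _ (e / 2)); last lra.
rewrite (_ : K * _ = `|fwd i q - fwd i p| * (K * pi) / 2); first by rewrite ler_pM2r.
by field.
Unshelve. all: by end_near. Qed.

Lemma closure_bounded_compact (W : set M) : riemannian_complete g ->
  rbounded g W -> compact (closure W).
Proof.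
move=> gc [C WC].
have [[p Wp]|W0] := pselect (W !=set0); last first.
  have -> : W = set0 by apply/seteqP; split => // x Wx; apply: W0; exists x.
  by rewrite closure0; exact: compact0.
have [K cK EK] : relatively_compact (rnear g (`|C| + 1) p).
  apply: (@hopf_rinow R M (rnear g)).
  - exact: rnear_refl.
  - exact: rnear_sym.
  - exact: rnear_trans.
  - exact: rnearW.
  - exact: rnear_split.
  - exact: rnear_nbhs.
  - exact: rnear_locally_compact.
  - exact: gc.
  - exact: atlas_hausdorff A.
  - by rewrite ltr_wpDl.
have clK := compact_closed (atlas_hausdorff A) cK.
have WK : W `<=` K.
  move=> q Wq; apply: EK; apply: le_lt_trans (WC _ _ Wp Wq) _.
  by rewrite lte_fin (le_lt_trans (ler_norm _))// ltrDl.
apply: subclosed_compact cK _; first exact: closed_closure.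
by apply: (subset_trans (closure_subset WK)); rewrite -(closure_id K).1.
Qed.

End bounded_domains.

(** * Borel sets and volume *)

Section borel_sets.
Context {T : ptopologicalType}.

Lemma open_borel (U : set (borel T)) : open (U : set T) -> measurable U.
Proof. by move=> oU; exact: sub_sigma_algebra. Qed.

Lemma closed_borel (C : set (borel T)) : closed (C : set T) -> measurable C.
Proof.
move=> cC; rewrite -(setCK C); apply: measurableC.
by apply: open_borel; exact: closed_openC.
Qed.

Lemma continuous_borel_measurable {R : realType} (D : set (borel T)) (f : T -> R) :
  measurable D -> {within (D : set T), continuous f} ->
  measurable_fun D (f : borel T -> R).
Proof.
move=> mD cf _; apply: (measurability _ (RGenOInfty.measurableE R)) => //.
move=> /= _ [_ [a ->] <-].
have oV : open ((f : subspace (D : set T) -> R) @^-1` `]a, +oo[%classic).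
  by move/continuousP : cf; apply; exact: interval_open.
have [V oV' VE] := (open_subspaceP _ _).1 oV.
rewrite setIC -VE; apply: measurableI => //; exact: open_borel.
Qed.

End borel_sets.

Section riemannian_volume.
Context {R : realType} {M : ptopologicalType} {n : nat}.
Context {A : smooth_atlas R M n} (g : riemannian_metric A).
Variable vol : {measure set (borel M) -> \bar R}.
Hypothesis volP : is_riemannian_measure g vol.

Lemma det_continuous (i : chart A) x :
  ccod i x -> {for x, continuous (fun y => \det (g i y))}.
Proof.
move=> xi; rewrite /prop_for/continuous_at /determinant.
apply: (@cvg_big _ _ +%R 0 xpredT (@add_continuous R) _ (nbhs x)) => s _.
apply: (@cvgM _ _ (nbhs x)); first exact: cvg_cst.
apply: (@cvg_big _ _ _ _ _ (@mul_continuous R) _ (nbhs x)) => a _.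
exact: metric_continuous.
Qed.

Lemma volume_cube_lty (i : chart A) x (r : R) : 0 <= r -> cube x r `<=` ccod i ->
  (vol (bwd i @` cube x r) < +oo)%E.
Proof.
move=> r0 xri; have [L LP volE] := volP.
have mC : measurable (cube x r : set (borel 'rV[R]_n)).
  by apply: closed_borel; apply: compact_closed; [exact: norm_hausdorff|exact: cube_compact].
rewrite volE//.
have [||y _ maxy] := @compact_EVT_max _ R (sqrt_det g i) (cube x r) _ (cube_compact r0) _.
- by exists x; rewrite /cube/= subrr normr0.
- apply: continuous_in_subspaceT => y /[!inE] /xri yi.
  exact: (cvg_comp _ _ (det_continuous yi) (@sqrt_continuous R _)).
apply: (@le_lt_trans _ _ (\int[L]_(z in cube x r) (sqrt_det g i y)%:E)%E).
  apply: le_integral_ge0 => z zr; first by rewrite lee_fin sqrtr_ge0.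
  by rewrite lee_fin maxy// inE.
rewrite integral_cst// cubeE//= LP; last by move=> a; rewrite !mxE; lra.
by rewrite -EFinM ltry.
Qed.

Lemma volume_compact_lty (K : set M) (W : set (borel M)) :
  compact K -> W `<=` K -> measurable W -> (vol W < +oo)%E.
Proof.
move=> cK WK mW.
suff [C [mC KC Coo]] : exists C : set (borel M),
    [/\ measurable C, K `<=` C & (vol C < +oo)%E].
  apply: le_lt_trans Coo; apply: le_measure; rewrite ?inE//.
  exact: subset_trans KC.
(* The compactness argument meets arbitrary sets, so the property used is finite volume of a
   measurable cover. *)
pose P (B : set M) := exists C : set (borel M),
    [/\ measurable C, B `<=` C & (vol C < +oo)%E].
apply: (compact_local_property cK (P := P)).
- by exists set0; split => //; rewrite measure0.
- move=> B C [B' [mB BB volB]] [C' [mC CC volC]]; exists (B' `|` C'); split.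
  + exact: measurableU.
  + exact: setUSS.
  + by apply: le_lt_trans (measureU2 _ mB mC) _; exact: lte_add_pinfty.
- by move=> B C BC [C' [mC CC volC]]; exists C'; split => //; exact: subset_trans CC.
move=> p _; have pi := chart_atP A p; set i := chart_at A p in pi.
have [fi bfi] := fwdP pi.
have [r r0 xri] := cube_in_chart fi.
exists (bwd i @` cube (fwd i p) r); first exact: chart_image_nbhs.
exists (bwd i @` cube (fwd i p) r); split => //.
  apply: closed_borel; apply: compact_closed; first exact: atlas_hausdorff A.
  by apply: chart_image_compact => //; exact: ltW.
by apply: volume_cube_lty => //; exact: ltW.
Qed.

End riemannian_volume.

(** * Positive functionals on measurable functions *)

Section nonnegative_measurable_functions.
Import HBNNSimple.
Local Open Scope ereal_scope.
Context {d : measure_display} {T : measurableType d} {R : realType}.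

Lemma ge0_measurable_fun_ind (P : (T -> \bar R) -> Prop) :
  (forall B, measurable B -> P (fun x => (\1_B x)%:E)) ->
  (forall f h, measurable_fun setT f -> measurable_fun setT h ->
     (forall x, 0 <= f x) -> (forall x, 0 <= h x) -> P f -> P h ->
     P (fun x => f x + h x)) ->
  (forall (r : R) f, (0 <= r)%R -> measurable_fun setT f -> (forall x, 0 <= f x) ->
     P f -> P (fun x => r%:E * f x)) ->
  (forall (s : nat -> T -> \bar R) f,
     (forall k, measurable_fun setT (s k)) -> (forall k x, 0 <= s k x) ->
     (forall x, nondecreasing_seq (s ^~ x)) ->
     (forall x, s ^~ x @ \oo --> f x) -> (forall k, P (s k)) -> P f) ->
  forall f, measurable_fun setT f -> (forall x, 0 <= f x) -> P f.
Proof.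
move=> PB PD PM Plim f mf f0.
have Psum (I : Type) (s : seq I) (r : I -> R) (B : I -> set T) :
    (forall i, 0 <= r i)%R -> (forall i, measurable (B i)) ->
    P (fun x => \sum_(i <- s) ((r i)%:E * (\1_(B i) x)%:E)).
  move=> r0 mB; elim: s => [|i s IH].
    have -> : (fun x => \sum_(j <- [::]) ((r j)%:E * (\1_(B j) x)%:E)) =
        (fun x => 0%:E * (\1_set0 x)%:E).
      by apply/funext => x; rewrite big_nil mul0e.
    apply: PM => //; [|exact: PB].
    by apply/measurable_EFinP; exact: measurable_indic.
  have -> : (fun x => \sum_(j <- i :: s) ((r j)%:E * (\1_(B j) x)%:E)) =
      (fun x => (r i)%:E * (\1_(B i) x)%:E +
      \sum_(j <- s) ((r j)%:E * (\1_(B j) x)%:E)).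
    by apply/funext => x; rewrite big_cons.
  have m1 j : measurable_fun setT (fun x => (r j)%:E * (\1_(B j) x)%:E).
    by apply: measurable_funeM; apply/measurable_EFinP; exact: measurable_indic.
  have g1 j x : 0 <= (r j)%:E * (\1_(B j) x)%:E by rewrite mule_ge0// lee_fin.
  apply: PD => //; last 2 first.
  - by move=> x; exact: sume_ge0.
  - apply: PM => //; [|exact: PB].
    by apply/measurable_EFinP; exact: measurable_indic.
  - by apply: emeasurable_sum.
pose s := nnsfun_approx measurableT mf.
apply: (Plim (fun k x => (s k x)%:E)).
- by move=> k; apply/measurable_EFinP.
- by move=> k x; rewrite lee_fin.
- move=> x k l kl; rewrite lee_fin.
  by have /asboolP := nd_nnsfun_approx measurableT mf kl; exact.
- by move=> x; exact: cvg_nnsfun_approx.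
move=> k; pose e := fset_set (s k @` setT).
(* The maximum with 0 makes every coefficient nonnegative; on the values of [s k] it changes
   nothing. *)
have -> : (fun x => (s k x)%:E) = (fun x => \sum_(y <- finmap.enum_fset e)
    ((Num.max y 0)%:E * (\1_(s k @^-1` [set y]) x)%:E)).
  apply/funext => x; rewrite {1}(fimfunE (s k)) fsbig_finite//= -sumEFin.
  rewrite !big_seq; apply: eq_bigr => y.
  rewrite in_fset_set// inE => -[z _ <-]; rewrite -EFinM max_l//.
apply: Psum => [y|y]; first by rewrite le_max lexx orbT.
by rewrite -[X in measurable X]setTI; exact: measurable_funP.
Qed.

(** Common abstraction of integrals, evaluations and kernels. By [pos_integral_ext] two such
    functionals that agree on indicators agree on all nonnegative measurable functions; in this way
    the Markov property and the symmetry, assumed for events, extend to functions. *)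
Definition pos_integral (L : (T -> \bar R) -> \bar R) := [/\
  (forall f, measurable_fun setT f -> (forall x, 0 <= f x) -> 0 <= L f),
  (forall f h, measurable_fun setT f -> measurable_fun setT h ->
     (forall x, 0 <= f x) -> (forall x, 0 <= h x) ->
     L (fun x => f x + h x) = L f + L h),
  (forall (r : R) f, (0 <= r)%R -> measurable_fun setT f -> (forall x, 0 <= f x) ->
     L (fun x => r%:E * f x) = r%:E * L f) &
  (forall (s : nat -> T -> \bar R) f,
     (forall k, measurable_fun setT (s k)) -> (forall k x, 0 <= s k x) ->
     (forall x, nondecreasing_seq (s ^~ x)) ->
     (forall x, s ^~ x @ \oo --> f x) ->
     nondecreasing_seq (L \o s) /\ L \o s @ \oo --> L f)].

Lemma pos_integral_ext (L1 L2 : (T -> \bar R) -> \bar R) :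
  pos_integral L1 -> pos_integral L2 ->
  (forall B, measurable B ->
     L1 (fun x => (\1_B x)%:E) = L2 (fun x => (\1_B x)%:E)) ->
  forall f, measurable_fun setT f -> (forall x, 0 <= f x) -> L1 f = L2 f.
Proof.
move=> [_ D1 M1 lim1] [_ D2 M2 lim2] L12; apply: ge0_measurable_fun_ind => //.
- by move=> f h mf mh f0 h0 Ef Eh; rewrite D1// D2// Ef Eh.
- by move=> r f r0 mf f0 Ef; rewrite M1// M2// Ef.
- move=> s f ms s0 nds sf Es.
  have [_ l1] := lim1 s f ms s0 nds sf; have [_ l2] := lim2 s f ms s0 nds sf.
  have EL : L1 \o s = L2 \o s by apply/funext => k /=; exact: Es.
  by rewrite -(cvg_lim _ l1)// -(cvg_lim _ l2)// EL.
Qed.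

Lemma pos_integral_eval x : pos_integral (fun f => f x).
Proof. by split => // s f ms s0 nds sf; split; [move=> k l kl; exact: nds|exact: sf]. Qed.

Lemma pos_integral_zero : pos_integral (fun=> 0).
Proof.
split => //; first by move=> *; rewrite adde0.
- by move=> *; rewrite mule0.
- by move=> *; split=> //; exact: cvg_cst.
Qed.

End nonnegative_measurable_functions.

Section integral_of_pos_integrals.
Local Open Scope ereal_scope.
Context {d d' : measure_display} {T : measurableType d} {U : measurableType d'}.
Context {R : realType}.

Lemma pos_integral_measurable (K : U -> (T -> \bar R) -> \bar R) :
  (forall u, pos_integral (K u)) ->
  (forall B, measurable B -> measurable_fun setT (fun u => K u (fun x => (\1_B x)%:E))) ->
  forall f, measurable_fun setT f -> (forall x, 0 <= f x) ->
    measurable_fun setT (K ^~ f).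
Proof.
move=> KP mK; apply: ge0_measurable_fun_ind => //.
- move=> f h mf mh f0 h0 Kf Kh.
  rewrite (_ : (fun _ => _) = (fun u => K u f + K u h)); last first.
    by apply/funext => u; have [_ E _ _] := KP u; exact: E.
  exact: emeasurable_funD.
- move=> r f r0 mf f0 Kf.
  rewrite (_ : (fun _ => _) = (fun u => r%:E * K u f)); last first.
    by apply/funext => u; have [_ _ E _] := KP u; exact: E.
  exact: measurable_funeM.
- move=> s f ms s0 nds sf Ks.
  apply: (emeasurable_fun_cvg (fun k u => K u (s k))) => // u _.
  by have [_ _ _ /(_ s f ms s0 nds sf)[]] := KP u.
Qed.

(** The factor c may be +oo: the products are then +oo as soon as a k > 0, and a zero limit forces
    every a k to be 0. *)
Lemma nondecreasing_cvgeM (a : nat -> \bar R) (l c : \bar R) :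
  0 <= c -> (forall k, 0 <= a k) -> nondecreasing_seq a -> a @ \oo --> l ->
  c * a k @[k --> \oo] --> c * l.
Proof.
move=> c0 a0 nda al.
have al' k : a k <= l.
  rewrite -(cvg_lim _ al)// (cvg_lim _ (ereal_nondecreasing_cvgn nda))//.
  by apply: ereal_sup_ubound; exists k.
have [l0|l0] := eqVneq l 0.
  have -> : (fun k => c * a k) = (fun=> c * l).
    by apply/funext => k; congr (_ * _); apply/eqP; rewrite eq_le al' l0 a0.
  exact: cvg_cst.
have [cfin|] := boolP (c \is a fin_num); first exact: cvgeZl.
rewrite ge0_fin_numE// -leNgt leye_eq => /eqP ->.
have l_gt0 : 0 < l by rewrite lt_neqAle eq_sym l0 (le_trans (a0 0%N)).
rewrite gt0_mulye//; apply: cvg_near_cst.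
have : \forall k \near \oo, 0 < a k.
  exact: al (open_ereal_gt' l_gt0).
by apply: filterS => k ak; rewrite gt0_mulye.
Qed.

(** Integration of a kernel against a weight; this covers expectations, transition operators and
    their pairings with [vol]. *)
Lemma pos_integral_integral (m : {measure set U -> \bar R}) (D : set U)
    (h : U -> \bar R) (K : U -> (T -> \bar R) -> \bar R) :
  measurable D -> measurable_fun setT h -> (forall u, 0 <= h u) ->
  (forall u, pos_integral (K u)) ->
  (forall f, measurable_fun setT f -> (forall x, 0 <= f x) ->
     measurable_fun setT (K ^~ f)) ->
  pos_integral (fun f => \int[m]_(u in D) (h u * K u f)).
Proof.
move=> mD mh h0 KP mK.
have mhK f : measurable_fun setT f -> (forall x, 0 <= f x) ->
    measurable_fun D (fun u => h u * K u f).
  move=> mf f0; apply: emeasurable_funM; apply: measurable_funS measurableT _ _ => //.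
  exact: mK.
have K0 u f : measurable_fun setT f -> (forall x, 0 <= f x) -> 0 <= K u f.
  by have [K0 _ _ _] := KP u; exact: K0.
split.
- by move=> f mf f0; apply: integral_ge0 => u Du; rewrite mule_ge0// K0.
- move=> f k mf mk f0 k0; rewrite -ge0_integralD//.
  + apply: eq_integral => u _; have [_ E _ _] := KP u; rewrite E//.
    by rewrite ge0_muleDr// K0.
  + by move=> u Du; rewrite mule_ge0// K0.
  + exact: mhK.
  + by move=> u Du; rewrite mule_ge0// K0.
  + exact: mhK.
- move=> r f r0 mf f0; rewrite -ge0_integralZl//.
  + by apply: eq_integral => u _; have [_ _ E _] := KP u; rewrite E// muleCA.
  + exact: mhK.
  + by move=> u Du; rewrite mule_ge0// K0.
- move=> s f ms s0 nds sf.
  have nd u : nondecreasing_seq (fun k => h u * K u (s k)).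
    move=> k l kl; have [_ _ _ /(_ s f ms s0 nds sf)[ndK _]] := KP u.
    by apply: lee_wpmul2l => //; exact: ndK.
  split; first by move=> k l kl; apply: le_integral_ge0 => u Du;
    [rewrite mule_ge0// K0|exact: nd].
  have E u : limn (fun k => h u * K u (s k)) = h u * K u f.
    apply/cvg_lim => //; have [_ _ _ /(_ s f ms s0 nds sf)[ndK cK]] := KP u.
    by apply: nondecreasing_cvgeM cK => // k; exact: K0.
  rewrite (_ : \int[m]_(u in D) _ = \int[m]_(u in D) limn (fun k => h u * K u (s k))); last first.
    by apply: eq_integral => u _; rewrite E.
  by apply: cvg_monotone_convergence => // [k|k u Du]; [exact: mhK|rewrite mule_ge0// K0].
Qed.

End integral_of_pos_integrals.

(** * Heat semigroup and its killed version *)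

Section hitting_events.
Context {R : realType} {M : ptopologicalType}.
Context {d : measure_display} {T : measurableType d}.
Variable X : R -> T -> one_point_compactification M.

Lemma hitsE t B w : hits X t B w <-> exists2 p, B p & X t w = Some p.
Proof. by split=> -[p Bp E]; exists p. Qed.

Lemma hitsI t B C : hits X t (B `&` C) = hits X t B `&` hits X t C.
Proof.
apply/seteqP; split=> w.
  by move=> /hitsE[p [Bp Cp] E]; split; apply/hitsE; exists p.
move=> [/hitsE[p Bp E] /hitsE[q Cq E']]; apply/hitsE.
by move: E'; rewrite E => -[pq]; exists p => //; split => //; rewrite pq.
Qed.

Lemma hitsD t B C : hits X t (B `\` C) = hits X t B `\` hits X t C.
Proof.
apply/seteqP; split=> w.
  move=> /hitsE[p [Bp nCp] E]; split; first by apply/hitsE; exists p.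
  by move=> /hitsE[q Cq]; rewrite E => -[pq]; apply: nCp; rewrite pq.
move=> [/hitsE[p Bp E] nC]; apply/hitsE; exists p => //; split => // Cp.
by apply: nC; apply/hitsE; exists p.
Qed.

Lemma hits_bigcup t (B : nat -> set M) :
  hits X t (\bigcup_k B k) = \bigcup_k hits X t (B k).
Proof.
apply/seteqP; split=> w.
  by move=> /hitsE[p [k _ Bp] E]; exists k => //; apply/hitsE; exists p.
by move=> [k _ /hitsE[p Bp E]]; apply/hitsE; exists p => //; exists k.
Qed.

(** The sets whose hitting event is measurable form a sigma-algebra; complements are taken inside
    [hits X t setT], since a path at the cemetery hits nothing. *)
Lemma hits_sigma_algebra (G : set (set T)) t :
  (forall U : set M, open U -> <<s G >> (hits X t U)) ->
  forall B : set (borel M), measurable B -> <<s G >> (hits X t B).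
Proof.
move=> GU B mB.
pose S : set (set M) := [set B | <<s G >> (hits X t B)].
suff : S B by [].
have sS : sigma_algebra setT S.
  split.
  - rewrite /S/= (_ : hits X t set0 = set0).
      exact: (@measurable0 _ (g_sigma_algebraType G)).
    by apply/seteqP; split=> // w /hitsE[].
  - move=> C SC; rewrite /S/= hitsD.
    apply: (@measurableD _ (g_sigma_algebraType G)) => //.
    by apply: GU; exact: openT.
  - move=> C SC; rewrite /S/= hits_bigcup.
    exact: (@bigcupT_measurable _ (g_sigma_algebraType G)).
apply: (smallest_sub sS _ mB) => U oU; exact: GU.
Qed.

Lemma measurable_extend_infty t (f : borel M -> \bar R) :
  (forall B : set (borel M), measurable B -> measurable (hits X t B)) ->
  measurable_fun setT f ->
  measurable_fun setT (fun w => extend_infty 0%E f (X t w)).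
Proof.
move=> mX mf mT B mB; rewrite setTI.
pose f' (p : borel M) := f p.
have mfB : measurable (f @^-1` B : set (borel M)) by rewrite -[X in measurable X]setTI; exact: mf.
have -> : (fun w => extend_infty 0%E f (X t w)) @^-1` B =
    hits X t (f @^-1` B) `|` (if pselect (B 0%E) then ~` hits X t setT else set0).
  apply/seteqP; split=> w /=.
    case E : (X t w) => [p|] /= Bf.
      by left; apply/hitsE; exists p.
    by right; case: pselect => // _ /hitsE[q _]; rewrite E.
  move=> [/hitsE[p Bp ->]//|].
  case: pselect => // B0 nh; case E : (X t w) => [p|] //=.
  by exfalso; apply: nh; apply/hitsE; exists p.
apply: measurableU; [exact: mX|].
by case: (pselect (B 0%E)) => [B0|nB0]; [apply: measurableC; exact: mX|exact: measurable0].
Qed.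

End hitting_events.

Section killed_semigroup.
Local Open Scope ereal_scope.
Context {R : realType} {M : ptopologicalType} {n : nat}.
Context {A : smooth_atlas R M n} {g : riemannian_metric A}.
Context {vol : {measure set (borel M) -> \bar R}}.
Context {d : measure_display} {T : measurableType d}.
Variable X : brownian_motion g vol T.

Local Notation law := (bm_law X).
Local Notation path := (bm_path X).
Local Notation hit := (hits path).

Definition at_time (t : R) (f : M -> \bar R) (w : T) : \bar R :=
  extend_infty 0 f (path t w).

Definition heat (t : R) (f : M -> \bar R) (x : M) : \bar R :=
  \int[law x]_w at_time t f w.

Lemma measurable_hit t (B : set (borel M)) : (0 <= t)%R -> measurable B ->
  measurable (hit t B).
Proof.
move=> t0 mB; have := @hits_sigma_algebra R M d T path (@measurable d T) t.
rewrite sigma_algebra_id; last exact: sigma_algebra_measurable.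
by apply => // U; exact: bm_measurable.
Qed.

Lemma past_hit s t (B : set (borel M)) : (0 <= t)%R -> (t <= s)%R ->
  measurable B -> past path s (hit t B).
Proof.
move=> t0 ts; apply: hits_sigma_algebra => U oU; apply: sub_sigma_algebra.
by exists t, U; split => //; apply/andP.
Qed.

Lemma at_time_ge0 t f w : (forall x, 0 <= f x) -> 0 <= at_time t f w.
Proof. by move=> f0; rewrite /at_time; case: (path t w) => //=. Qed.

Lemma measurable_at_time t (f : borel M -> \bar R) : (0 <= t)%R ->
  measurable_fun setT f -> measurable_fun setT (at_time t f).
Proof. by move=> t0 mf; apply: measurable_extend_infty => // B; exact: measurable_hit. Qed.

Lemma at_time_indic t (B : set M) w :
  at_time t (fun x => (\1_B x)%:E) w = (\1_(hit t B) w)%:E.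
Proof.
rewrite /at_time [in RHS]indicE; have [h|nB] := pselect (hit t B w).
  by rewrite [in RHS]mem_set//; case/hitsE : h => p Bp -> /=; rewrite indicE mem_set.
rewrite memNset//; case E : (path t w) => [p|] //=.
by rewrite indicE memNset// => Bp; apply: nB; apply/hitsE; exists p.
Qed.

Lemma pos_integral_at_time t w : pos_integral (fun f : borel M -> \bar R => at_time t f w).
Proof.
rewrite /at_time; case: (path t w) => [p|] /=; first exact: pos_integral_eval.
exact: pos_integral_zero.
Qed.

Lemma pos_integral_event (F : set T) t x : (0 <= t)%R -> measurable F ->
  pos_integral (fun f : borel M -> \bar R => \int[law x]_(w in F) at_time t f w).
Proof.
move=> t0 mF.
have := @pos_integral_integral _ _ (borel M) T R (law x) F (fun=> 1)
  (fun w f => at_time t f w) mF.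
have -> : (fun f : borel M -> \bar R => \int[law x]_(u in F) (1 * at_time t f u)) =
    (fun f => \int[law x]_(u in F) at_time t f u).
  by apply/funext => f; apply: eq_integral => u _; rewrite mul1e.
apply => //; first exact: pos_integral_at_time.
by move=> f mf _; exact: measurable_at_time.
Qed.

Lemma pos_integral_heat t x : (0 <= t)%R -> pos_integral (fun f : borel M -> \bar R => heat t f x).
Proof. by move=> t0; exact: pos_integral_event. Qed.

Lemma heat_ge0 t f x : (forall y, 0 <= f y) -> 0 <= heat t f x.
Proof. by move=> f0; apply: integral_ge0 => w _; exact: at_time_ge0. Qed.

Lemma heat_indic t (B : set (borel M)) x : (0 <= t)%R -> measurable B ->
  heat t (fun x => (\1_B x)%:E) x = law x (hit t B).
Proof.
move=> t0 mB; rewrite /heat; under eq_integral do rewrite at_time_indic.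
by rewrite integral_indic ?setIT//; exact: measurable_hit.
Qed.

Lemma measurable_heat t (f : borel M -> \bar R) : (0 <= t)%R ->
  measurable_fun setT f -> (forall x, 0 <= f x) ->
  measurable_fun setT (heat t f : borel M -> \bar R).
Proof.
move=> t0 mf f0.
apply: (@pos_integral_measurable _ _ (borel M) (borel M) R (fun x f => heat t f x)) => //.
  by move=> x; exact: pos_integral_heat.
move=> B mB; apply: eq_measurable_fun (bm_law_measurable X t0 mB) => x _.
by rewrite heat_indic.
Qed.

Lemma markov_property x s t F (f : borel M -> \bar R) : (0 <= s)%R -> (0 <= t)%R ->
  past path s F -> measurable F -> measurable_fun setT f -> (forall y, 0 <= f y) ->
  \int[law x]_(w in F) at_time (s + t) f w = \int[law x]_(w in F) at_time s (heat t f) w.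
Proof.
move=> s0 t0 pF mF.
have st0 : (0 <= s + t)%R by exact: addr_ge0.
have mat (f' : borel M -> \bar R) : measurable_fun setT f' -> (forall y, 0 <= f' y) ->
    measurable_fun setT (at_time s (heat t f')).
  by move=> mf f0; apply: measurable_at_time => //; exact: measurable_heat.
apply: (@pos_integral_ext _ (borel M) R
  (fun f => \int[law x]_(w in F) at_time (s + t) f w)
  (fun f => \int[law x]_(w in F) at_time s (heat t f) w)).
- exact: pos_integral_event.
- have := @pos_integral_integral _ _ (borel M) T R (law x) F (fun=> 1)
    (fun w f => at_time s (heat t f) w) mF.
  have -> : (fun f : borel M -> \bar R => \int[law x]_(u in F) (1 * at_time s (heat t f) u)) =
      (fun f => \int[law x]_(u in F) at_time s (heat t f) u).
    by apply/funext => f'; apply: eq_integral => u _; rewrite mul1e.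
  apply => // w; rewrite /at_time; case: (path s w) => [p|] /=.
    exact: pos_integral_heat.
  exact: pos_integral_zero.
- move=> B mB; under eq_integral do rewrite at_time_indic.
  rewrite integral_indic//; last exact: measurable_hit.
  rewrite setIC; apply: etrans (bm_markov x s0 t0 pF mB) _; apply: eq_integral => w _; rewrite /at_time.
  by case: (path s w) => //= p; rewrite heat_indic.
Qed.

Lemma heat_symmetric t (f h : borel M -> \bar R) : (0 <= t)%R ->
  measurable_fun setT f -> (forall y, 0 <= f y) ->
  measurable_fun setT h -> (forall y, 0 <= h y) ->
  \int[vol]_x (f x * heat t h x) = \int[vol]_x (h x * heat t f x).
Proof.
move=> t0 mf f0 mh h0.
have PH (u : borel M -> \bar R) : measurable_fun setT u -> (forall y, 0 <= u y) ->
    pos_integral (fun f : borel M -> \bar R => \int[vol]_x (u x * heat t f x)).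
  move=> mu u0; apply: pos_integral_integral => //.
    by move=> x; exact: pos_integral_heat.
  by move=> f' mf' f0'; exact: measurable_heat.
have PE (u : borel M -> \bar R) : measurable_fun setT u -> (forall y, 0 <= u y) ->
    pos_integral (fun f : borel M -> \bar R => \int[vol]_x (f x * heat t u x)).
  move=> mu u0.
  rewrite (_ : (fun f => _) = (fun f : borel M -> \bar R => \int[vol]_x (heat t u x * f x))).
    apply: (@pos_integral_integral _ _ (borel M) (borel M) R vol setT (heat t u) (fun x f => f x)) => //.
    - exact: measurable_heat.
    - by move=> x; exact: heat_ge0.
    - by move=> x; exact: pos_integral_eval.
  by apply/funext => f'; apply: eq_integral => x _; rewrite muleC.
have mI B : measurable B -> measurable_fun setT (fun x : borel M => (\1_B x)%:E : \bar R).
  by move=> mB; apply/measurable_EFinP; exact: measurable_indic.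
have I0 B (x : borel M) : 0 <= (\1_B x)%:E :> \bar R by rewrite lee_fin.
have IE B (u : borel M -> \bar R) : measurable B ->
    \int[vol]_x ((\1_B x)%:E * u x) = \int[vol]_(x in B) u x.
  move=> mB; rewrite [RHS]integral_mkcond; apply: eq_integral => x _.
  by rewrite patchE indicE; case: (x \in B); rewrite ?mul1e ?mul0e.
(* Both sides are positive integrals in f and in h separately: first f, then h, is reduced to an
   indicator. *)
apply: (pos_integral_ext (PE h mh h0) (PH h mh h0)) mf f0 => B mB.
apply: (pos_integral_ext (PH _ (mI B mB) (I0 B)) (PE _ (mI B mB) (I0 B))) mh h0 => C mC.
have HE (B' C' : set (borel M)) : measurable C' ->
    \int[vol]_(x in B') heat t (fun y => (\1_C' y)%:E) x =
    \int[vol]_(x in B') law x (hit t C').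
  by move=> mC'; apply: eq_integral => x _; rewrite heat_indic.
rewrite (IE B _ mB) (IE C _ mC) (HE B C mC) (HE C B mB).
exact: (bm_symmetric X t0 mB mC).
Qed.

Section killing.
Variable K : set (borel M).
Hypothesis mK : measurable K.

(** The operator 1_K P_r1 1_K P_r2 ... 1_K, where [ds] lists the time increments: the path is tested
    for K at time 0 and after each increment. With an indicator at both ends, the adjoint is the
    same operator for the reversed list. *)
Fixpoint killed (ds : seq R) (f : M -> \bar R) (x : M) : \bar R :=
  (\1_K x)%:E * match ds with
  | [::] => f x
  | r :: ds' => heat r (killed ds' f) x
  end.

Definition increments (ds : seq R) := all (fun r : R => (0 <= r)%R) ds.

Lemma killed_ge0 ds f x : (forall y, 0 <= f y) -> 0 <= killed ds f x.
Proof.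
move=> f0; elim: ds x => [|r ds IH] x /=; rewrite mule_ge0 ?lee_fin//.
exact: heat_ge0.
Qed.

Lemma measurable_killed ds (f : borel M -> \bar R) : increments ds ->
  measurable_fun setT f -> (forall y, 0 <= f y) ->
  measurable_fun setT (killed ds f : borel M -> \bar R).
Proof.
move=> + mf f0; elim: ds => [_|r ds IH /= /andP[r0 /IH mds]] /=.
  by apply: emeasurable_funM => //; apply/measurable_EFinP; exact: measurable_indic.
apply: emeasurable_funM; first by apply/measurable_EFinP; exact: measurable_indic.
by apply: measurable_heat => // y; exact: killed_ge0.
Qed.

Lemma indic_killed ds f x : (\1_K x)%:E * killed ds f x = killed ds f x.
Proof.
case: ds => [|r ds] /=; rewrite muleA -EFinM indicE -natrM mulnb andbb//.
Qed.

Lemma killed_cat ds es f : killed (ds ++ es) f = killed ds (killed es f).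
Proof.
elim: ds => [|r ds IH] /=; apply/funext => x; last by rewrite IH.
by rewrite indic_killed.
Qed.

Lemma killed_nil_idem ds f : killed ds (killed [::] f) = killed ds f.
Proof. by rewrite -killed_cat cats0. Qed.

Lemma killed_symmetric ds (f h : borel M -> \bar R) : increments ds ->
  measurable_fun setT f -> (forall y, 0 <= f y) ->
  measurable_fun setT h -> (forall y, 0 <= h y) ->
  \int[vol]_x (f x * killed ds h x) = \int[vol]_x (killed (rev ds) f x * h x).
Proof.
move=> + + + mh h0; elim: ds f => [|r ds IH] f.
  move=> _ mf f0 /=; apply: eq_integral => x _.
  by rewrite muleA [f x * _]muleC.
move=> /andP[r0 ids] mf f0.
have mKf : measurable_fun setT (killed [::] f : borel M -> \bar R) by exact: measurable_killed.
have Kf0 y : 0 <= killed [::] f y by exact: killed_ge0.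
have mkh := measurable_killed ids mh h0.
have -> : \int[vol]_x (f x * killed (r :: ds) h x) =
    \int[vol]_x (killed [::] f x * heat r (killed ds h) x).
  by apply: eq_integral => x _ /=; rewrite muleA [f x * _]muleC.
rewrite heat_symmetric//; last by move=> y; exact: killed_ge0.
under eq_integral do rewrite muleC.
rewrite IH//; last 2 first.
- exact: measurable_heat.
- by move=> y; exact: heat_ge0.
apply: eq_integral => x _; congr (_ * _).
rewrite rev_cons -cats1 killed_cat /= -(killed_nil_idem _ (heat r _)).
by congr (killed _ _ x); apply/funext => y /=.
Qed.

End killing.

End killed_semigroup.

(** * Staying in a compact set, observed on dyadic time grids *)

Section grids.
Local Open Scope ereal_scope.
Context {R : realType} {M : ptopologicalType} {n : nat}.
Context {A : smooth_atlas R M n} {g : riemannian_metric A}.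
Context {vol : {measure set (borel M) -> \bar R}}.
Context {d : measure_display} {T : measurableType d}.
Variable X : brownian_motion g vol T.

Local Notation law := (bm_law X).
Local Notation path := (bm_path X).
Local Notation hit := (hits path).

Let M_hausdorff : hausdorff_space M := atlas_hausdorff A.

Section one_set.
Variable K : set (borel M).
Hypothesis mK : measurable K.

Fixpoint grid (t0 : R) (ds : seq R) : set T :=
  hit t0 K `&` (if ds is r :: ds' then grid (t0 + r)%R ds' else setT).

Definition end_time (t0 : R) (ds : seq R) : R := foldl +%R t0 ds.

Lemma end_time_ge t0 ds : increments ds -> (t0 <= end_time t0 ds)%R.
Proof.
elim: ds t0 => [|r ds IH] t0 //= /andP[r0 /IH h].
by apply: le_trans (h (t0 + r)%R); rewrite lerDl.
Qed.

Lemma grid_rcons t0 ds r :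
  grid t0 (rcons ds r) = grid t0 ds `&` hit (end_time t0 ds + r)%R K.
Proof.
elim: ds t0 => [|r' ds IH] t0 /=; first by rewrite !setIT.
by rewrite IH setIA.
Qed.

Lemma grid_end t0 ds : grid t0 ds `<=` hit (end_time t0 ds) K.
Proof. by elim: ds t0 => [|r ds IH] t0 /=; [move=> w []|move=> w [_ /IH]]. Qed.

Lemma past_grid t0 ds s : (0 <= t0)%R -> increments ds -> (end_time t0 ds <= s)%R ->
  past path s (grid t0 ds).
Proof.
elim: ds t0 => [|r ds IH] t0 t00 /=.
  by move=> _ t0s; rewrite setIT; exact: past_hit.
move=> /andP[r0 ids] es.
apply: (@measurableI _ (g_sigma_algebraType
  [set F | exists r U, [/\ (0 <= r <= s)%R, open U & F = hits path r U]])).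
  apply: past_hit => //; apply: le_trans es.
  by apply: le_trans (end_time_ge _ ids); rewrite lerDl.
by apply: IH => //; exact: addr_ge0.
Qed.

Lemma measurable_grid t0 ds : (0 <= t0)%R -> increments ds -> measurable (grid t0 ds).
Proof.
elim: ds t0 => [|r ds IH] t0 t00 /=.
  by move=> _; rewrite setIT; exact: measurable_hit.
move=> /andP[r0 ids]; apply: measurableI; first exact: measurable_hit.
by apply: IH => //; exact: addr_ge0.
Qed.

Lemma at_time_killed_nil t f w :
  at_time X t (killed X K [::] f) w = (\1_(hit t K) w)%:E * at_time X t f w.
Proof.
rewrite -at_time_indic /at_time /=; case: (path t w) => [p|] //=.
by rewrite mule0.
Qed.

Lemma law_start x (B : set (borel M)) : measurable B ->
  law x (hit 0 B) = (\1_B x)%:E.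
Proof.
move=> mB; rewrite indicE.
have mx : measurable ([set x] : set (borel M)).
  by apply: closed_borel; apply: accessible_closed_set1; exact: hausdorff_accessible.
have h0 := bm_start X x.
have [xB|xB] := boolP (x \in B).
  apply/eqP; rewrite eq_le probability_le1 /=; last exact: measurable_hit.
  rewrite -h0; apply: le_measure; rewrite ?inE; [exact: measurable_hit|exact: measurable_hit|].
  move=> w /hitsE[p -> E]; apply/hitsE; exists x => //; exact: set_mem.
apply/eqP; rewrite eq_le measure_ge0 andbT.
have -> : 0%:E = law x (~` hit 0 [set x]).
  by rewrite probability_setC ?h0 ?subee//; exact: measurable_hit.
apply: le_measure; rewrite ?inE; [exact: measurable_hit|apply: measurableC; exact: measurable_hit|].
move=> w /hitsE[p Bp E] /hitsE[q]; rewrite E => -> -[pq].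
by move: xB; rewrite -pq (mem_set Bp).
Qed.

Lemma killed_path x ds (f : borel M -> \bar R) : increments ds ->
  measurable_fun setT f -> (forall y, 0 <= f y) ->
  killed X K ds f x = \int[law x]_(w in grid 0 ds) at_time X (end_time 0 ds) f w.
Proof.
(* Induction from the end of the list: the Markov property at the last but one time splits off the
   last increment. *)
move=> + + +; elim/last_ind: ds f => [|ds r IH] f.
  move=> _; rewrite /= setIT.
  apply: (@pos_integral_ext _ (borel M) R (fun f => (\1_K x)%:E * f x)
    (fun f => \int[law x]_(w in hit 0 K) at_time X 0 f w)).
  - split.
    + by move=> f' _ f0; rewrite mule_ge0// lee_fin.
    + by move=> f' h mf mh f0 h0; rewrite ge0_muleDr.
    + by move=> a f' a0 mf f0; rewrite muleCA.
    + move=> s f' ms s0 nds sf; split.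
        by move=> k l kl /=; rewrite lee_wpmul2l ?lee_fin//; exact: nds.
      by apply: nondecreasing_cvgeM => //; rewrite lee_fin.
  - by apply: pos_integral_event => //; exact: measurable_hit.
  - move=> B mB; under eq_integral do rewrite at_time_indic.
    rewrite integral_indic//; [|exact: measurable_hit|exact: measurable_hit].
    rewrite -hitsI; apply/esym; apply: etrans (law_start x (measurableI _ _ mB mK)) _.
    by rewrite setIC indicI /= EFinM.
rewrite /increments all_rcons => /andP[r0 ids] mf f0.
have mKf : measurable_fun setT (killed X K [::] f : borel M -> \bar R) by exact: measurable_killed.
have Kf0 y : 0 <= killed X K [::] f y by exact: killed_ge0.
have e0 : (0 <= end_time 0 ds)%R by exact: end_time_ge.
rewrite -cats1 killed_cat.
have -> : killed X K [:: r] f = killed X K [::] (heat X r (killed X K [::] f)) by [].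
rewrite killed_nil_idem IH//; last 2 first.
- exact: measurable_heat.
- by move=> y; exact: heat_ge0.
rewrite -markov_property//; last 2 first.
- exact: past_grid.
- exact: measurable_grid.
rewrite cats1 grid_rcons /end_time foldl_rcons -/(end_time 0 ds).
rewrite [RHS]integral_mkcondr; apply: eq_integral => w _.
rewrite at_time_killed_nil patchE indicE; case: (w \in _); by rewrite ?mul1e ?mul0e.
Qed.

Lemma killed_one x ds : increments ds -> killed X K ds (fun=> 1) x = law x (grid 0 ds).
Proof.
move=> ids; rewrite killed_path//.
rewrite (eq_integral (fun=> 1)).
  by rewrite integral_cst ?mul1e//; exact: measurable_grid.
move=> w /[!inE] /grid_end/hitsE[p _]; by rewrite /at_time => ->.
Qed.

Lemma grid_cat t0 ds es :
  grid t0 (ds ++ es) = grid t0 ds `&` grid (end_time t0 ds) es.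
Proof.
elim: ds t0 => [|r ds IH] t0 /=; last by rewrite IH setIA.
by rewrite setIT; case: es => [|r es] /=; rewrite setIA setIid.
Qed.

Lemma end_time_nseq t0 N a : end_time t0 (nseq N a) = (t0 + N%:R * a)%R.
Proof.
rewrite /end_time; elim: N t0 => [|N IH] t0 /=; first by rewrite mul0r addr0.
by rewrite IH -addrA -natr1; congr (_ + _)%R; ring.
Qed.

Lemma grid_nseq t0 N a w :
  grid t0 (nseq N a) w <-> forall j, (j <= N)%N -> hit (t0 + j%:R * a)%R K w.
Proof.
elim: N t0 => [|N IH] t0 /=.
  split=> [[h _] j|h]; first by rewrite leqn0 => /eqP ->; rewrite mul0r addr0.
  by split => //; have := h 0%N (leqnn _); rewrite mul0r addr0.
split=> [[h /IH hN] [|j] jN|h].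
- by rewrite mul0r addr0.
- by have := hN j jN; congr (hit _ _ _); rewrite -natr1; ring.
- split; first by have := h 0%N isT; rewrite mul0r addr0.
  apply/IH => j jN; have := h j.+1 jN; congr (hit _ _ _); rewrite -natr1; ring.
Qed.

End one_set.

Definition stays (K : set M) (t : R) : set T :=
  [set w | forall u : R, (0 <= u <= t)%R -> hit u K w].

(** Halving the step nests the grids, so the grid events decrease with i. *)
Definition dgrid (t : R) (i : nat) : seq R := nseq (2 ^ i) (t / (2 ^ i)%:R)%R.

Lemma increments_dgrid t i : (0 <= t)%R -> increments (dgrid t i).
Proof. by move=> t0; rewrite /increments all_nseq divr_ge0// orbT. Qed.

Lemma increments_cat (ds es : seq R) : increments ds -> increments es -> increments (ds ++ es).
Proof. by rewrite /increments all_cat => -> ->. Qed.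

Lemma end_time_dgrid t0 t i : end_time t0 (dgrid t i) = (t0 + t)%R.
Proof.
rewrite end_time_nseq mulrC divfK// pnatr_eq0 -lt0n expn_gt0//.
Qed.

Lemma grid_dgridS K t0 t i : grid K t0 (dgrid t i.+1) `<=` grid K t0 (dgrid t i).
Proof.
move=> w /grid_nseq h; apply/grid_nseq => j ji.
have := h (2 * j)%N; rewrite expnS leq_mul2l ji orbT => /(_ isT).
congr (hit _ _ _); congr (_ + _)%R; rewrite !natrM; field.
by rewrite pnatr_eq0 -lt0n expn_gt0.
Qed.

Lemma nearest_multiple (N : nat) (b u : R) : (0 <= b)%R -> (0 <= u)%R ->
  (u <= N%:R * b)%R -> exists2 j, (j <= N)%N & (`|u - j%:R * b| <= b)%R.
Proof.
move=> b0 u0; elim: N => [|N IH].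
  by rewrite mul0r => uN; exists 0%N => //; rewrite mul0r subr0 ger0_norm// (le_trans uN).
move=> uN; have [/IH[j jN ju]|Nu] := leP u (N%:R * b)%R; first by exists j => //; exact: leqW.
exists N => //; rewrite ger0_norm; last by rewrite subr_ge0 ltW.
by move: uN; rewrite -natr1; lra.
Qed.

Lemma path_near (U : set (one_point_compactification M)) w u : (0 <= u)%R ->
  nbhs (path u w) U ->
  exists2 e : R, (0 < e)%R & forall r, (0 <= r)%R -> (`|r - u| < e)%R -> U (path r w).
Proof.
move=> u0 nU; have /subspace_continuousP := @bm_continuous _ _ _ _ _ _ _ _ X w.
move=> /(_ u u0 U nU) /nbhs_ballP[e /= e0 eU]; exists e => // r r0 ru.
by apply: eU => //=; rewrite -ball_normE /= distrC.
Qed.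

(** As K is compact, its complement in the compactification is a neighbourhood of the cemetery as
    well as of every point of M outside K. *)
Lemma path_near_not_hit (K : set M) w u : compact K -> (0 <= u)%R -> ~ hit u K w ->
  exists2 e : R, (0 < e)%R & forall r, (0 <= r)%R -> (`|r - u| < e)%R -> ~ hit r K w.
Proof.
move=> cK u0 nh; have clK := compact_closed M_hausdorff cK.
apply: (@path_near [set y | ~ (Some @` K) y] w u u0).
case E : (path u w) => [p|].
  apply: (filterS _ (@one_point_compactification_some_nbhs M p (~` K) _)).
    by move=> _ [q nKq <-] [q' Kq [qq]]; apply: nKq; rewrite -qq.
  apply: open_nbhs_nbhs; split; first exact: closed_openC.
  by move=> Kp; apply: nh; apply/hitsE; exists p.
exists K; first by split.
by move=> _ [[q nKq <-]|->] [q' Kq] // [qq]; apply: nKq; rewrite -qq.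
Qed.

Lemma path_near_hit (U : set M) w u : open U -> (0 <= u)%R -> hit u U w ->
  exists2 e : R, (0 < e)%R & forall r, (0 <= r)%R -> (`|r - u| < e)%R -> hit r U w.
Proof.
move=> oU u0 /hitsE[p Up E]; apply: (@path_near (Some @` U) w u u0).
by rewrite E; apply: one_point_compactification_some_nbhs; exact: open_nbhs_nbhs.
Qed.

Lemma small_step (t e : R) : (0 < e)%R ->
  exists N : nat, forall i, (N <= i)%N -> (t / (2 ^ i)%:R < e)%R.
Proof.
move=> e0.
have /cvgrPdist_lt/(_ (e / (`|t| + 1))%R) : (fun i => (2^-1 : R) ^+ i)%R @ \oo --> (0 : R)%R.
  by apply: cvg_expr; rewrite ger0_norm; lra.
rewrite divr_gt0// ?ltr_wpDl// => /(_ isT)[N _ NP]; exists N => i /NP/=.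
rewrite sub0r normrN ger0_norm ?exprn_ge0 ?invr_ge0//.
rewrite ltr_pdivlMr ?ltr_wpDl// natrX -exprVn => h.
apply: le_lt_trans h; rewrite mulrC ler_wpM2l ?exprn_ge0 ?invr_ge0//.
by rewrite (le_trans (ler_norm _))// lerDl.
Qed.

(** A path outside K at time u is outside K at all nonnegative times close to u, hence at a grid
    time once the step is small. There is one grid on [0, s] and one on [s, s + t], so that the
    killed operator factors exactly at time s. *)
Lemma stays_grids K s t : compact K -> (0 <= s)%R -> (0 <= t)%R ->
  stays K (s + t) = \bigcap_i grid K 0 (dgrid s i ++ dgrid t i).
Proof.
move=> cK s0 t0; apply/seteqP; split=> w.
  move=> h i _; rewrite grid_cat end_time_dgrid add0r.
  have p0 : (0 <= (2 ^ i)%:R :> R)%R by [].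
  have p1 : (0 < (2 ^ i)%:R :> R)%R by rewrite ltr0n expn_gt0.
  have jb (a : R) j : (0 <= a)%R -> (j <= 2 ^ i)%N ->
      (0 <= j%:R * (a / (2 ^ i)%:R) <= a)%R.
    move=> a0 ji; rewrite mulr_ge0 ?divr_ge0//= mulrA ler_pdivrMr// mulrC.
    by rewrite ler_wpM2l// ler_nat.
  by split; apply/grid_nseq => j /jb jb'; apply: h;
    [have := jb' s s0|have := jb' t t0]; move=> /andP[? ?]; apply/andP; split; lra.
move=> h u /andP[u0 ust]; apply: contrapT => nh.
have [e e0 he] := path_near_not_hit cK u0 nh.
have [N1 N1P] := small_step s e0; have [N2 N2P] := small_step t e0.
pose i := maxn N1 N2; have := h i I; rewrite grid_cat end_time_dgrid add0r.
have se := N1P i (leq_maxl _ _); have te := N2P i (leq_maxr _ _).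
have p1 : (0 < (2 ^ i)%:R :> R)%R by rewrite ltr0n expn_gt0.
have pE (a : R) : ((2 ^ i)%:R * (a / (2 ^ i)%:R) = a)%R by rewrite mulrC divfK// gt_eqF.
move=> [/grid_nseq h1 /grid_nseq h2].
have [us|su] := leP u s.
  have [|||j ji ju] := @nearest_multiple (2 ^ i) (s / (2 ^ i)%:R) u => //.
  - by rewrite divr_ge0// ltW.
  - by rewrite pE.
  apply: (he _ _ _ (h1 j ji)); first by rewrite add0r mulr_ge0// divr_ge0// ltW.
  by rewrite add0r distrC; exact: le_lt_trans ju se.
have [|||j ji ju] := @nearest_multiple (2 ^ i) (t / (2 ^ i)%:R) (u - s).
- by rewrite divr_ge0// ltW.
- by rewrite subr_ge0 ltW.
- by rewrite pE; lra.
apply: (he _ _ _ (h2 j ji)).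
  by rewrite addr_ge0// mulr_ge0// divr_ge0// ltW.
rewrite distrC opprD addrA; exact: le_lt_trans ju te.
Qed.

End grids.

(** * Survival in compact and open sets *)

Section survival.
Local Open Scope ereal_scope.
Context {R : realType} {M : ptopologicalType} {n : nat}.
Context {A : smooth_atlas R M n} {g : riemannian_metric A}.
Context {vol : {measure set (borel M) -> \bar R}}.
Context {d : measure_display} {T : measurableType d}.
Variable X : brownian_motion g vol T.

Local Notation law := (bm_law X).
Local Notation path := (bm_path X).
Local Notation hit := (hits path).

Let M_hausdorff : hausdorff_space M := atlas_hausdorff A.

Lemma compact_borel (K : set (borel M)) : compact (K : set M) -> measurable K.
Proof. by move=> cK; apply: closed_borel; exact: compact_closed. Qed.

Definition survival (K : set M) (t : R) (x : M) : \bar R := law x (stays X K t).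

Section compact_set.
Variable K : set (borel M).
Hypothesis cK : compact (K : set M).

Let mK : measurable K := compact_borel cK.

Lemma stays_dgrid s : (0 <= s)%R -> stays X K s = \bigcap_i grid X K 0 (dgrid s i).
Proof.
move=> s0; rewrite -{1}(addr0 s) (stays_grids X cK s0 (lexx _)).
apply: eq_bigcapr => i _; rewrite grid_cat end_time_dgrid add0r.
apply/setIidl => w /grid_end; rewrite end_time_dgrid add0r => h.
by apply/grid_nseq => j _; rewrite mul0r mulr0 addr0.
Qed.

Lemma measurable_dgrids s t i : (0 <= s)%R -> (0 <= t)%R ->
  measurable (grid X K 0 (dgrid s i ++ dgrid t i)).
Proof. by move=> s0 t0; apply: measurable_grid => //; exact: increments_cat (increments_dgrid _ _) (increments_dgrid _ _). Qed.

Lemma measurable_stays t : (0 <= t)%R -> measurable (stays X K t).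
Proof.
move=> t0; rewrite stays_dgrid//; apply: bigcap_measurable; first by exists 0%N.
by move=> i _; apply: measurable_grid => //; exact: increments_dgrid.
Qed.

Lemma dgrids_nonincreasing s t :
  nonincreasing_seq (fun i => grid X K 0 (dgrid s i ++ dgrid t i)).
Proof.
apply/nonincreasing_seqP => i; apply/subsetPset; rewrite !grid_cat !end_time_dgrid.
by apply: setISS; exact: grid_dgridS.
Qed.

Lemma dgrid_nonincreasing s : nonincreasing_seq (fun i => grid X K 0 (dgrid s i)).
Proof. by apply/nonincreasing_seqP => i; apply/subsetPset; exact: grid_dgridS. Qed.

Lemma law_lty x B : measurable B -> law x B < +oo.
Proof. by move=> mB; rewrite (le_lt_trans (probability_le1 _ mB))// ltry. Qed.

Lemma survival_cvg2 s t x : (0 <= s)%R -> (0 <= t)%R ->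
  killed X K (dgrid s i ++ dgrid t i) (fun=> 1) x @[i --> \oo] --> survival K (s + t) x.
Proof.
move=> s0 t0; rewrite /survival (stays_grids X cK s0 t0).
rewrite (_ : (fun i => _) = law x \o (fun i => grid X K 0 (dgrid s i ++ dgrid t i))).
  apply: nonincreasing_cvg_mu.
  - by apply: law_lty; exact: measurable_dgrids.
  - by move=> i; exact: measurable_dgrids.
  - by apply: bigcapT_measurable => i; exact: measurable_dgrids.
  - exact: dgrids_nonincreasing.
apply/funext => i /=; apply: killed_one => //.
exact: increments_cat (increments_dgrid _ s0) (increments_dgrid _ t0).
Qed.

Lemma survival_cvg t x : (0 <= t)%R ->
  killed X K (dgrid t i) (fun=> 1) x @[i --> \oo] --> survival K t x.
Proof.
move=> t0; rewrite /survival stays_dgrid//.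
rewrite (_ : (fun i => _) = law x \o (fun i => grid X K 0 (dgrid t i))).
  have mg i : measurable (grid X K 0 (dgrid t i)).
    by apply: measurable_grid => //; exact: increments_dgrid.
  apply: nonincreasing_cvg_mu => //.
  - exact: law_lty.
  - exact: bigcapT_measurable.
  - exact: dgrid_nonincreasing.
by apply/funext => i /=; apply: killed_one => //; exact: increments_dgrid.
Qed.

Lemma measurable_cst1 : measurable_fun [set: borel M] (fun=> 1 : \bar R).
Proof. exact: measurable_cst. Qed.

Lemma measurable_survival t : (0 <= t)%R ->
  measurable_fun setT (survival K t : borel M -> \bar R).
Proof.
move=> t0; apply: (emeasurable_fun_cvg (fun i => killed X K (dgrid t i) (fun=> 1) : borel M -> \bar R)).
  move=> i; apply: measurable_killed => //; exact: increments_dgrid.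
by move=> x _; exact: survival_cvg.
Qed.

Lemma survival_ge0 t x : 0 <= survival K t x.
Proof. exact: measure_ge0. Qed.

Lemma survival_le_killed t i x : (0 <= t)%R ->
  survival K t x <= killed X K (dgrid t i) (fun=> 1) x.
Proof.
move=> t0; rewrite killed_one//; last exact: increments_dgrid.
apply: le_measure; rewrite ?inE.
- exact: measurable_stays.
- by apply: measurable_grid => //; exact: increments_dgrid.
- by rewrite stays_dgrid// => w; apply.
Qed.

Lemma killed_one_le ds x : increments ds -> killed X K ds (fun=> 1) x <= (\1_K x)%:E.
Proof.
move=> ids; rewrite -indic_killed -[leRHS]mule1 lee_wpmul2l ?lee_fin//.
by rewrite killed_one//; apply: probability_le1; exact: measurable_grid.
Qed.

Hypothesis volK : vol K < +oo.

Lemma integrable_indic_K : vol.-integrable setT (fun x : borel M => (\1_K x)%:E : \bar R).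
Proof.
apply/integrableP; split; first by apply/measurable_EFinP; exact: measurable_indic.
rewrite (eq_integral (fun x : borel M => (\1_K x)%:E)).
  by rewrite integral_indic// setIT.
by move=> x _; rewrite gee0_abs ?lee_fin.
Qed.

(** On a grid the killed operators for s and t are symmetric and compose, so the pairing of their
    values at 1 equals the integral of the operator for s + t at 1. The left side lies below its
    grid value, and the right side is a limit of grid values dominated by the indicator of K. *)
Lemma survival_product s t : (0 <= s)%R -> (0 <= t)%R ->
  \int[vol]_x (survival K s x * survival K t x) <= \int[vol]_x survival K (s + t) x.
Proof.
move=> s0 t0.
have st0 : (0 <= s + t)%R by exact: addr_ge0.
pose f i (x : borel M) := killed X K (dgrid s i ++ dgrid t i) (fun=> 1) x.
have icat i : increments (dgrid s i ++ dgrid t i).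
  exact: increments_cat (increments_dgrid _ s0) (increments_dgrid _ t0).
have mf i : measurable_fun setT (f i) by apply: measurable_killed => //.
have [_ _ cvg] : [/\ vol.-integrable setT (survival K (s + t) : borel M -> \bar R),
   [sequence \int[vol]_(x in setT) `|f i x - survival K (s + t) x|]_i @ \oo --> 0 &
   [sequence \int[vol]_(x in setT) f i x]_i @ \oo --> \int[vol]_x survival K (s + t) x].
  apply: (dominated_convergence measurableT mf (measurable_survival st0) _ integrable_indic_K).
  - by apply: aeW => x _; exact: survival_cvg2.
  - apply: aeW => x i _; rewrite gee0_abs; first exact: killed_one_le.
    by apply: killed_ge0 => y; rewrite lee_fin.
rewrite -(cvg_lim _ cvg)//; apply: lime_ge; first by apply/cvg_ex; eexists; exact: cvg.
apply: nearW => i.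
have one0 (y : borel M) : 0 <= (1 : \bar R) by rewrite lee_fin.
have mt : measurable_fun setT (killed X K (dgrid t i) (fun=> 1) : borel M -> \bar R).
  by apply: measurable_killed => //; exact: increments_dgrid.
have kt0 (y : borel M) : 0 <= killed X K (dgrid t i) (fun=> 1) y by exact: killed_ge0.
have E := @killed_symmetric _ _ _ _ _ _ _ _ X K mK (dgrid s i)
  (killed X K (dgrid t i) (fun=> 1)) (fun=> 1)
  (increments_dgrid i s0) mt kt0 measurable_cst1 one0.
apply: (@le_trans _ _ (\int[vol]_x
   (killed X K (dgrid t i) (fun=> 1) x * killed X K (dgrid s i) (fun=> 1) x))).
  apply: le_integral_ge0 => x _; first by rewrite mule_ge0// survival_ge0.
  by rewrite muleC; apply: lee_pmul; rewrite ?survival_ge0// survival_le_killed.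
rewrite E; apply: le_integral_ge0 => x _.
  by rewrite mule1; apply: killed_ge0.
rewrite mule1 /f killed_cat.
(* A uniform grid is its own reversal. *)
suff -> : rev (dgrid s i) = dgrid s i by [].
rewrite /dgrid; set a := (s / _)%R; move: (2 ^ i)%N; elim=> // N IH.
by rewrite -{1}addn1 nseqD rev_cat IH.
Qed.

End compact_set.

Section exit_from_open_set.
Variable W : set M.
Hypothesis oW : open W.

(** Since W is open, a path in W up to time t stays there a little longer, which makes the
    inequality strict. *)
Lemma exit_timeP t w : (0 <= t)%R -> t%:E < exit_time X W w <-> stays X W t w.
Proof.
move=> t0; split=> [tw u /andP[u0 ut]|st].
  apply: contrapT => nh; move: tw; rewrite ltNge => /negP; apply.
  apply: (@le_trans _ _ u%:E); last by rewrite lee_fin.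
  by apply: ereal_inf_lbound; exists u.
have [|e e0 he] := path_near_hit oW t0 (st t _); first by rewrite t0 lexx.
apply: (@lt_le_trans _ _ (t + e)%:E); first by rewrite lte_fin ltrDl.
apply: le_ereal_inf_tmp => _ [u [u0 nh] <-]; rewrite lee_fin leNgt; apply/negP => ute.
apply: nh; have [ut|tu] := leP u t; first by apply: st; rewrite u0.
by apply: he => //; rewrite ger0_norm ?subr_ge0 ?(ltW tu)// ltrBlDl.
Qed.

Lemma exit_time_ge0 w : 0 <= exit_time X W w.
Proof. by apply: le_ereal_inf_tmp => _ [u [u0 _] <-]; rewrite lee_fin. Qed.

(** The last clause puts each point of W in the interior of some K j; a path that stays in W over a
    compact time interval then lies in a single K j. *)
Definition exhaustion (K : nat -> set M) := [/\
  forall j, compact (K j), forall j, K j `<=` W,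
  (forall i j, (i <= j)%N -> K i `<=` K j) &
  forall p, W p -> exists j, nbhs p (K j)].

Lemma chart_compact_nbhs (U : set M) p : open U -> U p ->
  exists C, [/\ compact C, C `<=` U & nbhs p C].
Proof.
move=> oU Up; have pi := chart_atP A p; set i := chart_at A p in pi.
have [fi bfi] := fwdP pi.
have : nbhs (fwd i p) (ccod i `&` bwd i @^-1` U).
  apply: open_nbhs_nbhs; split; first exact: open_chart_preimage.
  by split => //; rewrite /preimage/= bfi.
move=> /nbhs_ballP[e /= e0 eU].
have rU : cube (fwd i p) (e / 2) `<=` ccod i `&` bwd i @^-1` U.
  move=> y ye; apply: eU; rewrite -ball_normE /= distrC (le_lt_trans ye)//; lra.
have e2 : (0 < e / 2)%R by lra.
exists (bwd i @` cube (fwd i p) (e / 2)); split.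
- by apply: chart_image_compact; [exact: ltW|move=> y /rU[]].
- by move=> _ [y /rU[_ Uy] <-].
- exact: chart_image_nbhs.
Qed.

Lemma exhaustion_exists : exists K, exhaustion K.
Proof.
have [B cB [oB basB]] := atlas_second_countable A.
have /countable_injP[f finj] := cB.
(* The basic open sets with compact closure in W, numbered by the injection f; an index that numbers
   none of them receives the empty set. *)
pose good b j := [/\ B b, f b = j, compact (closure b) & closure b `<=` W].
have /choice[b bP] : forall j, exists b, (compact (closure b) /\ closure b `<=` W) /\
    forall c, good c j -> b = c.
  move=> j; have [[c [Bc fc cc cW]]|nc] := pselect (exists c, good c j).
    exists c; split => // c' [Bc' fc' _ _]; apply: finj; rewrite ?inE//.
    by rewrite fc fc'.
  exists set0; rewrite closure0; split; first by split => //; exact: compact0.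
  by move=> c gc; exfalso; apply: nc; exists c.
exists (fun j => \big[setU/set0]_(i < j) closure (b i)); split.
- move=> j; elim: j => [|j IH]; first by rewrite big_ord0; exact: compact0.
  by rewrite big_ord_recr /=; apply: compactU => //; have [[]] := bP j.
- move=> j; elim: j => [|j IH]; first by rewrite big_ord0.
  by rewrite big_ord_recr /= => p [/IH//|]; have [[_ h] _] := bP j; exact: h.
- move=> i j ij; rewrite -(subnKC ij); elim: (j - i)%N => [|k IH]; first by rewrite addn0.
  by rewrite addnS big_ord_recr /=; apply: (subset_trans IH); exact: subsetUl.
- move=> p Wp; have [C [cC CW nC]] := chart_compact_nbhs oW Wp.
  have [c [Bc cp] cC'] := basB p _ nC.
  have clC := compact_closed M_hausdorff cC.
  have ccC : closure c `<=` C.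
    by apply: (subset_trans (closure_subset cC')); rewrite -(closure_id C).1.
  have gc : good c (f c).
    split => //; last exact: subset_trans CW.
    by apply: subclosed_compact cC ccC; exact: closed_closure.
  exists (f c).+1; rewrite big_ord_recr /= ((bP (f c)).2 c gc).
  apply: (filterS _ (_ : nbhs p c)).
    by move=> q cq; right; exact: subset_closure.
  by apply: open_nbhs_nbhs; split => //; exact: oB.
Qed.

End exit_from_open_set.
End survival.

(** * Tail of the exit time *)

Section exit_tail.
Local Open Scope ereal_scope.
Context {R : realType} {M : ptopologicalType} {n : nat}.
Context {A : smooth_atlas R M n} {g : riemannian_metric A}.
Context {vol : {measure set (borel M) -> \bar R}}.
Context {d : measure_display} {T : measurableType d}.
Variable X : brownian_motion g vol T.

Local Notation law := (bm_law X).
Local Notation path := (bm_path X).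
Local Notation hit := (hits path).

Variable W : set (borel M).
Hypothesis oW : open (W : set M).
Let mW : measurable W := open_borel oW.

Local Notation tau := (exit_time X W).

Definition exit_tail (x : M) (t : R) : \bar R := law x [set w | t%:E < tau w].

Lemma exit_tail_survival t x : (0 <= t)%R -> exit_tail x t = survival X W t x.
Proof.
move=> t0; congr (law x _); apply/seteqP; split=> w; exact: (exit_timeP X oW w t0).1 || exact: (exit_timeP X oW w t0).2.
Qed.

Lemma stays_subset K t : K `<=` W -> stays X K t `<=` stays X W t.
Proof. by move=> KW w st u /st /hitsE[p Kp E]; apply/hitsE; exists p => //; exact: KW. Qed.

(** Around each time of the compact interval [0, t] the path stays in some K j; since the K j
    increase, one index serves for the whole interval. *)
Lemma stays_exhaustion K t : (0 <= t)%R -> exhaustion W K ->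
  stays X W t = \bigcup_j stays X (K j) t.
Proof.
move=> t0 [cK KW ndK intK]; apply/seteqP; split=> w; last first.
  by move=> [j _]; exact: stays_subset.
move=> st; pose P (B : set R) := exists j, forall u : R, B u -> (0 <= u <= t)%R -> hit u (K j) w.
have [j jP] : P `[0%R, t]%classic.
  apply: (compact_local_property (@segment_compact R 0%R t) (P := P)).
  - by exists 0%N.
  - move=> B C [i iP] [j jP]; exists (maxn i j) => u [Bu|Cu] ut.
      have /hitsE[p Kp E] := iP u Bu ut; apply/hitsE; exists p => //.
      by apply: (ndK i) Kp; exact: leq_maxl.
    have /hitsE[p Kp E] := jP u Cu ut; apply/hitsE; exists p => //.
    by apply: (ndK j) Kp; exact: leq_maxr.
  - by move=> B C BC [j jP]; exists j => u /BC; exact: jP.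
  move=> u; rewrite /= in_itv/= => /andP[u0 ut].
  have /hitsE[p Wp E] : hit u W w by apply: st; rewrite u0.
  have [j Kp] := intK p Wp.
  have := @one_point_compactification_some_nbhs M p (K j) Kp; rewrite -E => nU.
  have [e e0 he] := path_near u0 nU.
  exists (ball u e); first exact: nbhsx_ballx.
  exists j => r ur /andP[r0 rt].
  have := he r r0; rewrite -ball_normE /= distrC in ur => /(_ ur)[q Kq Eq].
  by apply/hitsE; exists q.
by exists j => // u /andP[u0 ut]; apply: jP; rewrite /= ?in_itv/= u0.
Qed.

Lemma measurable_exit_event t : measurable [set w | t%:E < tau w].
Proof.
have [t0|t0] := ltP t 0%R.
  rewrite (_ : mkset _ = setT)//; apply/seteqP; split => // w _ /=.
  by apply: lt_le_trans (exit_time_ge0 X W w); rewrite lte_fin.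
have -> : [set w | t%:E < tau w] = stays X W t.
  by apply/seteqP; split=> w; [move/(exit_timeP X oW w t0)|move=> h; apply/(exit_timeP X oW w t0)].
have [K KP] := exhaustion_exists (A := A) oW.
rewrite (stays_exhaustion t0 KP); apply: bigcupT_measurable => j.
by have [cK _ _ _] := KP; exact: measurable_stays.
Qed.

Lemma measurable_exit_time : measurable_fun setT tau.
Proof.
apply: (measurability _ (ErealGenOInfty.measurableE R)) => //.
move=> /= _ [_ [t ->] <-]; rewrite setTI.
rewrite (_ : _ @^-1` _ = [set w | t%:E < tau w]); first exact: measurable_exit_event.
by apply/seteqP; split=> w /=; rewrite in_itv/= andbT.
Qed.

Lemma exit_tail_ge0 x t : 0 <= exit_tail x t.
Proof. exact: measure_ge0. Qed.

Lemma exit_tail_le1 x t : exit_tail x t <= 1.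
Proof. apply: probability_le1; exact: measurable_exit_event. Qed.

Lemma exit_tail_antitone x s t : (s <= t)%R -> exit_tail x t <= exit_tail x s.
Proof.
move=> st; apply: le_measure; rewrite ?inE; [exact: measurable_exit_event|exact: measurable_exit_event|].
by move=> w /=; apply: le_lt_trans; rewrite lee_fin.
Qed.

Lemma exit_tail_out x t : (0 <= t)%R -> exit_tail x t <= (\1_W x)%:E.
Proof.
move=> t0; rewrite -(law_start X x mW).
apply: le_measure; rewrite ?inE; [exact: measurable_exit_event|exact: measurable_hit|].
by move=> w /(exit_timeP X oW w t0); apply; rewrite lexx.
Qed.

Lemma survival_exhaustion_cvg K t x : (0 <= t)%R -> exhaustion W K ->
  survival X (K j) t x @[j --> \oo] --> exit_tail x t.
Proof.
move=> t0 KP; have [cK KW ndK _] := KP.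
rewrite exit_tail_survival// /survival (stays_exhaustion t0 KP).
apply: nondecreasing_cvg_mu.
- by move=> j; exact: measurable_stays.
- by apply: bigcupT_measurable => j; exact: measurable_stays.
- move=> i j ij; apply/subsetPset => w st u /st /hitsE[p Kp E].
  by apply/hitsE; exists p => //; exact: ndK Kp.
Qed.

Lemma measurable_exit_tail t : measurable_fun setT (exit_tail ^~ t : borel M -> \bar R).
Proof.
have [t0|t0] := ltP t 0%R.
  rewrite (_ : (fun _ => _) = fun=> 1); first exact: measurable_cst.
  apply/funext => x; rewrite /exit_tail (_ : mkset _ = setT) ?probability_setT//.
  apply/seteqP; split => // w _ /=.
  by apply: lt_le_trans (exit_time_ge0 X W w); rewrite lte_fin.
have [K KP] := exhaustion_exists (A := A) oW; have [cK _ _ _] := KP.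
apply: (emeasurable_fun_cvg (fun j => survival X (K j) t : borel M -> \bar R)).
  by move=> j; exact: measurable_survival.
by move=> x _; exact: survival_exhaustion_cvg.
Qed.

Lemma survival_le_exit_tail (K : set M) t x : compact K -> K `<=` W -> (0 <= t)%R ->
  survival X K t x <= exit_tail x t.
Proof.
move=> cK KW t0; rewrite exit_tail_survival//.
apply: le_measure; rewrite ?inE.
- exact: measurable_stays.
- rewrite (_ : stays X W t = [set w | t%:E < tau w]); first exact: measurable_exit_event.
  by apply/seteqP; split=> w; [move=> h; apply/(exit_timeP X oW w t0)|move/(exit_timeP X oW w t0)].
- exact: stays_subset.
Qed.

Hypothesis volW : vol W < +oo.

Lemma exit_tail_product s t : (0 <= s)%R -> (0 <= t)%R ->
  \int[vol]_x (exit_tail x s * exit_tail x t) <= \int[vol]_x exit_tail x (s + t).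
Proof.
move=> s0 t0; have [K KP] := exhaustion_exists (A := A) oW; have [cK KW ndK _] := KP.
pose f j (x : borel M) := survival X (K j) s x * survival X (K j) t x.
have nds u x : (0 <= u)%R -> nondecreasing_seq (fun j => survival X (K j) u x).
  move=> u0 i j ij; apply: le_measure; rewrite ?inE; [exact: measurable_stays|exact: measurable_stays|].
  move=> w st r /st /hitsE[p Kp E].
  by apply/hitsE; exists p => //; exact: ndK Kp.
have E (x : borel M) : limn (f ^~ x) = exit_tail x s * exit_tail x t.
  apply/cvg_lim => //; apply: cvgeM.
  - apply: mule_def_fin; rewrite ge0_fin_numE ?exit_tail_ge0 // (le_lt_trans (exit_tail_le1 _ _)) ?ltry//.
  - exact: survival_exhaustion_cvg.
  - exact: survival_exhaustion_cvg.
rewrite (eq_integral (fun x : borel M => limn (f ^~ x))); last by move=> x _; rewrite E.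
have mf j : measurable_fun setT (f j).
  by apply: emeasurable_funM; exact: measurable_survival.
have f0 j x : 0 <= f j x by rewrite mule_ge0// survival_ge0.
have ndf x : nondecreasing_seq (f ^~ x).
  by move=> i j ij; apply: lee_pmul; rewrite ?survival_ge0// nds.
have cvg : \int[vol]_x f j x @[j --> \oo] --> \int[vol]_x limn (f ^~ x).
  by apply: cvg_monotone_convergence.
rewrite -(cvg_lim _ cvg)//; apply: lime_le; first by apply/cvg_ex; eexists; exact: cvg.
apply: nearW => j.
have volKj : vol (K j) < +oo.
  apply: le_lt_trans volW; apply: le_measure; rewrite ?inE//.
  exact: (compact_borel (A := A)).
apply: le_trans (survival_product X (cK j) volKj s0 t0) _.
apply: le_integral_ge0 => x _; first exact: survival_ge0.
by apply: survival_le_exit_tail => //; exact: addr_ge0.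
Qed.

End exit_tail.

(** * Joint measurability of monotone functions of time *)

Section joint_measurability.
Local Open Scope ereal_scope.
Context {R : realType} {d : measure_display} {S : measurableType d}.

(* the superlevel set [a < f] is a countable union of rectangles
   [{x | a < f x q} * ]-oo, q[] with [q] rational *)
Lemma measurable_antitone_right_cts (f : S -> R -> \bar R) :
  (forall t, measurable_fun setT (f ^~ t)) ->
  (forall x s t, (s <= t)%R -> f x t <= f x s) ->
  (forall x t a, a < f x t -> exists2 r, (t < r)%R & a < f x r) ->
  measurable_fun setT (fun p : S * measurableTypeR R => f p.1 p.2).
Proof.
move=> mf antif rcf; apply: (measurability _ (ErealGenOInfty.measurableE R)) => //.
move=> /= _ [_ [a ->] <-]; rewrite setTI.
have -> : (fun p : S * R => f p.1 p.2) @^-1` `]a%:E, +oo[ =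
    \bigcup_(q : rat) ((f ^~ (ratr q)) @^-1` `]a%:E, +oo[ `*` `]-oo, ratr q[%classic).
  apply/seteqP; split=> -[x t] /=.
    rewrite in_itv/= andbT => /rcf[r tr ar].
    have [q] := rat_in_itvoo tr; rewrite in_itv/= => /andP[tq qr].
    exists q => //; split => /=; rewrite in_itv/= ?andbT//.
    by apply: lt_le_trans ar _; apply: antif; exact: ltW.
  move=> [q _ [/=]]; rewrite !in_itv/= !andbT => aq tq.
  by apply: lt_le_trans aq _; apply: antif; exact: ltW.
apply: bigcupT_measurable_rat => q; apply: measurableX; last exact: measurable_itv.
by rewrite -[X in measurable X]setTI; apply: mf => //; exact: emeasurable_itv.
Qed.

End joint_measurability.

(** * Laplacian of a function of a solution *)

Section Ck_calculus.
Context {R : realType} {n : nat}.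
Implicit Types (V : set 'rV[R]_n) (f h : 'rV[R]_n -> R).

Lemma CkW k V f : Ck k.+1 V f -> Ck k V f.
Proof.
elim: k f => [|k IH] f; first by move=> [].
by move=> [cf df]; split => // a; have [d Ca] := df a; split => //; exact: IH.
Qed.

Lemma Ck_continuous k V f x : Ck k V f -> V x -> {for x, continuous f}.
Proof. by case: k => [|k] [cf _]; exact: cf. Qed.

Lemma CkU k V W f : Ck k V f -> Ck k W f -> Ck k (V `|` W) f.
Proof.
elim: k f => [|k IH] f [cf df] [cf' df']; split => //.
- by move=> x [/cf|/cf'].
- by move=> x [/cf|/cf'].
- move=> a; have [d Ca] := df a; have [d' Ca'] := df' a; split; last exact: IH.
  by move=> x [/d|/d'].
Qed.

Lemma near_open V x : open V -> V x -> \forall y \near x, V y.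
Proof. by move=> oV Vx; exact: open_nbhs_nbhs. Qed.

Lemma Ck_eq k V f h : open V -> (forall x, V x -> f x = h x) -> Ck k V f -> Ck k V h.
Proof.
move=> oV; elim: k f h => [|k IH] f h fh [cf df].
  split => // x Vx; have nfh : \forall y \near x, f y = h y.
    by apply: filterS (near_open oV Vx) => y; exact: fh.
  rewrite /prop_for/continuous_at -(fh x Vx).
  exact: cvg_trans (near_eq_cvg nfh) (cf x Vx).
have nfh x : V x -> \forall y \near x, f y = h y.
  by move=> Vx; apply: filterS (near_open oV Vx) => y; exact: fh.
split.
  move=> x Vx; rewrite /prop_for/continuous_at -(fh x Vx).
  exact: cvg_trans (near_eq_cvg (nfh x Vx)) (cf x Vx).
move=> a; have [d Ca] := df a; split.
  by move=> x Vx; apply: near_eq_derivable (d x Vx); exact: nfh.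
apply: IH Ca => x Vx; rewrite /partial; apply: near_eq_derive; exact: nfh.
Qed.

Lemma Ck_cst k V (c : R) : Ck k V (fun=> c).
Proof.
have cc (c' : R) x : {for x, continuous (fun _ : 'rV[R]_n => c')}.
  exact: (@cst_continuous _ _ c').
elim: k c => [|k IH] c; first by split.
split => [x _|a]; first exact: cc.
split=> [x _|]; first by have [] := is_derive_cst c x (delta_mx 0 a).
rewrite (_ : partial a _ = fun=> 0); first exact: IH.
by apply/funext => x; rewrite /partial derive_cst.
Qed.

Lemma is_derive_lineP f x v (l : R) :
  is_derive x v f l <-> is_derive (0 : R) 1 (fun t => f (x + t *: v)) l.
Proof.
have E : (fun r : R => r^-1 *: ((fun t : R => f (x + t *: v)) (r *: 1 + 0) - f (x + (0 : R) *: v)))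
   = (fun r => r^-1 *: (f (r *: v + x) - f x)).
  apply/funext => r; rewrite -[r *: 1]/(r * 1) mulr1 addr0 scale0r addr0.
  by rewrite [x + _]addrC.
by split=> -[d e]; split; move: d e; rewrite /derivable /derive E.
Qed.

Lemma is_derive_comp_real (u : 'rV[R]_n -> R) (h : R -> R) x v (du dh : R) :
  is_derive x v u du -> is_derive (u x) 1 h dh ->
  is_derive x v (h \o u) (dh * du).
Proof.
move=> /is_derive_lineP d1 d2; apply/is_derive_lineP.
apply: (@is_derive1_comp _ h (fun t => u (x + t *: v)) 0 dh du) => //.
by rewrite scale0r addr0.
Qed.

Lemma derivable_is_derive f x v : derivable f x v -> is_derive x v f ('D_v f x).
Proof. by move=> d; exact: DeriveDef. Qed.

Lemma Ck1M V f h : open V -> Ck 1 V f -> Ck 1 V h -> Ck 1 V (fun x => f x * h x).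
Proof.
move=> oV Cf Ch; split.
  by move=> x Vx; apply: (@cvgM _ _ (nbhs x)); [exact: (Ck_continuous Cf Vx)|exact: (Ck_continuous Ch Vx)].
move=> a; have [df Cdf] := Cf.2 a; have [dh Cdh] := Ch.2 a.
have D x : V x -> is_derive x (delta_mx 0 a) (fun x => f x * h x)
    (f x * partial a h x + h x * partial a f x).
  move=> Vx; exact: (is_deriveM (derivable_is_derive (df x Vx)) (derivable_is_derive (dh x Vx))).
split; first by move=> x /D[].
apply: (@Ck_eq 0 V (fun x => f x * partial a h x + h x * partial a f x)) => //.
  by move=> x /D[_]; rewrite /partial => ->.
split => // x Vx; apply: (@cvgD _ _ _ (nbhs x)); apply: (@cvgM _ _ (nbhs x)).
- exact: (Ck_continuous Cf Vx).
- exact: (Cdh.1 x Vx).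
- exact: (Ck_continuous Ch Vx).
- exact: (Cdf.1 x Vx).
Qed.

Section composition.
Variables (V : set 'rV[R]_n) (u : 'rV[R]_n -> R) (h h1 h2 : R -> R).
Hypothesis oV : open V.
Hypothesis dh : forall s : R, is_derive s 1 h (h1 s).
Hypothesis dh1 : forall s : R, is_derive s 1 h1 (h2 s).
Hypothesis ch2 : continuous h2.

Lemma partial_comp a x : derivable u x (delta_mx 0 a) ->
  is_derive x (delta_mx 0 a) (h \o u) (h1 (u x) * partial a u x).
Proof. by move=> du; apply: is_derive_comp_real => //; exact: derivable_is_derive. Qed.

Lemma real_derivable_continuous (k k1 : R -> R) :
  (forall s : R, is_derive s 1 k (k1 s)) -> continuous k.
Proof. by move=> dk s; have [d _] := dk s; exact/differentiable_continuous/derivable1_diffP. Qed.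

Lemma Ck1_comp : Ck 1 V u -> Ck 1 V (h1 \o u).
Proof.
move=> Cu; have D a x : V x ->
    is_derive x (delta_mx 0 a) (h1 \o u) (h2 (u x) * partial a u x).
  move=> Vx; apply: is_derive_comp_real => //.
  by apply: derivable_is_derive; have [d _] := Cu.2 a; exact: d.
split.
  move=> x Vx; have cu := Ck_continuous Cu Vx.
  have ch1 : continuous h1 := real_derivable_continuous dh1.
  exact: (@cvg_comp _ _ _ u h1 (nbhs x) (nbhs (u x)) _ cu (ch1 (u x))).
move=> a; split; first by move=> x /(D a)[].
apply: (@Ck_eq 0 V (fun x => h2 (u x) * partial a u x)) => //.
  by move=> x /(D a)[_]; rewrite /partial => ->.
split => // x Vx; have cu := Ck_continuous Cu Vx.
have c2 := @cvg_comp _ _ _ u h2 (nbhs x) (nbhs (u x)) _ cu (@ch2 (u x)).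
exact: cvgM c2 ((Cu.2 a).2.1 x Vx).
Qed.

Lemma Ck2_comp : Ck 2 V u -> Ck 2 V (h \o u).
Proof.
move=> Cu; split.
  move=> x Vx; have cu := Ck_continuous Cu Vx.
  have ch : continuous h := real_derivable_continuous dh.
  exact: (@cvg_comp _ _ _ u h (nbhs x) (nbhs (u x)) _ cu (ch (u x))).
move=> a; have [du Cdu] := Cu.2 a.
split; first by move=> x Vx; have [] := partial_comp (du x Vx).
apply: (@Ck_eq 1 V (fun x => (h1 \o u) x * partial a u x)); first exact: oV.
  by move=> x Vx; have [_] := partial_comp (du x Vx); rewrite /partial => ->.
by apply: Ck1M; [exact: oV|apply: Ck1_comp; exact: CkW|exact: Cdu].
Qed.

End composition.

Lemma derivable_sum_seq (I : Type) (s : seq I) (F : I -> 'rV[R]_n -> R) x v :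
  (forall i, derivable (F i) x v) -> derivable (fun y => \sum_(i <- s) F i y) x v.
Proof.
move=> dF; elim: s => [|i s IH].
  rewrite (_ : (fun _ => _) = fun=> 0); first exact: derivable_cst.
  by apply/funext => y; rewrite big_nil.
rewrite (_ : (fun _ => _) = (F i : _ -> R) + (fun y => \sum_(i <- s) F i y)).
  exact: derivableD (dF i) IH.
by apply/funext => y; rewrite big_cons.
Qed.

Lemma derivable_prod_seq (I : Type) (s : seq I) (F : I -> 'rV[R]_n -> R) x v :
  (forall i, derivable (F i) x v) -> derivable (fun y => \prod_(i <- s) F i y) x v.
Proof.
move=> dF; elim: s => [|i s IH].
  rewrite (_ : (fun _ => _) = fun=> 1); first exact: derivable_cst.
  by apply/funext => y; rewrite big_nil.
rewrite (_ : (fun _ => _) = (F i : _ -> R) * (fun y => \prod_(i <- s) F i y)).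
  exact: derivableM (dF i) IH.
by apply/funext => y; rewrite big_cons.
Qed.

Lemma derivable_det m (B : 'rV[R]_n -> 'M[R]_m) x v :
  (forall a b, derivable (fun y => B y a b) x v) ->
  derivable (fun y => \det (B y)) x v.
Proof.
move=> dB; rewrite /determinant; apply: derivable_sum_seq => s.
rewrite (_ : (fun _ => _) = (fun=> (-1) ^+ perm.odd_perm s) * (fun y => \prod_i B y i (perm.fun_of_perm s i))).
  by apply: derivableM; [exact: derivable_cst|apply: derivable_prod_seq].
by apply/funext.
Qed.

Lemma derivable_cofactor m (B : 'rV[R]_n -> 'M[R]_m) x v a b :
  (forall a b, derivable (fun y => B y a b) x v) ->
  derivable (fun y => cofactor (B y) a b) x v.
Proof.
move=> dB; rewrite (_ : (fun _ => _) = (fun=> (-1) ^+ (a + b)) *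
    (fun y => \det (row' a (col' b (B y))))); last by apply/funext.
apply: derivableM; first exact: derivable_cst.
apply: derivable_det => c e.
by rewrite (_ : (fun _ => _) = (fun y => B y (lift a c) (lift b e))) //; apply/funext => y; rewrite !mxE.
Qed.

End Ck_calculus.

Section laplacian_of_composition.
Context {R : realType} {M : ptopologicalType} {n : nat}.
Context {A : smooth_atlas R M n} (g : riemannian_metric A).

Lemma metric_unit (i : chart A) x : ccod i x -> g i x \in unitmx.
Proof.
move=> xi; rewrite -row_free_unit -kermx_eq0; apply/eqP/row_matrixP => j.
rewrite row0; apply/eqP; apply: contraT => v0.
have := gmx_pos g xi v0.
have /sub_kermxP -> : (row j (kermx (g i x)) <= kermx (g i x))%MS by exact: row_sub.
by rewrite mul0mx mxE ltxx.
Qed.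

Lemma inverse_metric_ge0 (i : chart A) x (w : 'rV[R]_n) : ccod i x ->
  0 <= (w *m invmx (g i x) *m w^T) 0 0.
Proof.
move=> xi; have gu := metric_unit xi.
pose v := w *m invmx (g i x).
have -> : w *m invmx (g i x) *m w^T = v *m g i x *m v^T.
  rewrite /v trmx_mul trmx_inv (gmx_sym g xi) mulmxA.
  by rewrite -[w *m _ *m g i x]mulmxA mulVmx// mulmx1.
have [->|v0] := eqVneq v 0; first by rewrite !mul0mx mxE.
exact: ltW (gmx_pos g xi v0).
Qed.

Lemma derivable_metric (i : chart A) x a b c : ccod i x ->
  derivable (fun y => g i y a b) x (delta_mx 0 c).
Proof. by move=> xi; have [_ /(_ c)[d _]] := gmx_smooth g i a b 1; exact: d. Qed.

Lemma derivable_sqrt_det (i : chart A) x c : ccod i x ->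
  derivable (sqrt_det g i) x (delta_mx 0 c).
Proof.
move=> xi; have dd : derivable (fun y => \det (g i y)) x (delta_mx 0 c).
  by apply: derivable_det => a b; exact: derivable_metric.
(* At this point the determinant is only known to be nonzero; where it is negative, its square root
   is 0 in a neighbourhood. *)
have : \det (g i x) != 0 by rewrite -unitfE -unitmxE; exact: metric_unit.
rewrite neq_lt => /orP[neg|pos].
  apply: (near_eq_derivable _ (derivable_cst 0 x (delta_mx 0 c))).
  have cd := det_continuous (g := g) xi.
  have : \forall y \near x, \det (g i y) < 0.
    have N : nbhs (\det (g i x)) [set r | r < 0] by apply: open_nbhs_nbhs; split => //; exact: open_lt.
    exact: cd _ N.
  by apply: filterS => y /ltW ny; rewrite /sqrt_det ler0_sqrtr.
have [] // := is_derive_comp_real (derivable_is_derive dd) (is_derive1_sqrt pos).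
Qed.

Lemma derivable_inverse_metric (i : chart A) x a b c : ccod i x ->
  derivable (fun y => invmx (g i y) a b) x (delta_mx 0 c).
Proof.
move=> xi; have near_xi : \forall y \near x, ccod i y.
  by apply: open_nbhs_nbhs; split => //; exact: ccod_open.
apply: (@near_eq_derivable _ _ _ (fun y => (\det (g i y))^-1 * cofactor (g i y) b a)).
  apply: filterS near_xi => y yi.
  by rewrite /invmx metric_unit// !mxE.
have dd : derivable (fun y => \det (g i y)) x (delta_mx 0 c).
  by apply: derivable_det => a' b'; exact: derivable_metric.
have d0 : \det (g i x) != 0 by rewrite -unitfE -unitmxE; exact: metric_unit.
have dc : derivable (fun y => cofactor (g i y) b a) x (delta_mx 0 c).
  by apply: derivable_cofactor => a' b'; exact: derivable_metric.
have -> : (fun y => (\det (g i y))^-1 * cofactor (g i y) b a) =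
    (fun y => (\det (g i y))^-1) * (fun y => cofactor (g i y) b a) by [].
have di : derivable (fun y => (\det (g i y))^-1) x (delta_mx 0 c).
  exact: (@derivableV _ _ (fun y => \det (g i y)) x (delta_mx 0 c) d0 dd).
exact: (derivableM di dc).
Qed.

(** Delta h(phi) = h'(phi) Delta phi + h''(phi) |grad phi|^2, and the last term is nonnegative. In
    coordinates, the term with h'' is the quadratic form of the inverse metric applied to the
    partial derivatives. *)
Lemma laplacian_convex_comp (V : set M) (phi f : M -> R) (h h1 h2 : R -> R) p :
  open V -> V p -> Ck_on A 2 V phi -> (forall q, V q -> f q = h (phi q)) ->
  (forall s : R, is_derive s 1 h (h1 s)) -> (forall s : R, is_derive s 1 h1 (h2 s)) ->
  0 <= h2 (phi p) ->
  h1 (phi p) * laplacian g phi p <= laplacian g f p.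
Proof.
move=> oV Vp Cphi fh dh dh1 h2p.
have pi := chart_atP A p; rewrite /laplacian; set i := chart_at A p in pi *.
have [fi bfi] := fwdP pi; set x := fwd i p in fi bfi *.
pose u := phi \o bwd i; pose D := ccod i `&` bwd i @^-1` V.
have oD : open D by exact: open_chart_preimage.
have Dx : D x by split => //; rewrite /preimage/= bfi.
have Cu : Ck 2 D u by exact: Cphi.
have ux : u x = phi p by rewrite /u/= bfi.
have near_D y : D y -> \forall z \near y, D z by exact: near_open.
have du y a : D y -> derivable u y (delta_mx 0 a) by have [d _] := Cu.2 a; exact: d.
have ddu y a b : D y -> derivable (partial b u) y (delta_mx 0 a).
  by have [_ [_ Cb]] := Cu.2 b; have [d _] := Cb a; exact: d.
have pf y b : D y -> partial b (f \o bwd i) y = h1 (u y) * partial b u y.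
  move=> Dy; have [_ <-] := partial_comp (h := h) (h1 := h1) dh (du y b Dy).
  rewrite /partial; apply: near_eq_derive.
  by apply: filterS (near_D y Dy) => z [_ Vz] /=; rewrite fh.
pose Y a y := sqrt_det g i y * gradient_in g i u a y.
have dY a : derivable (Y a) x (delta_mx 0 a).
  have dG : derivable (gradient_in g i u a) x (delta_mx 0 a).
    apply: derivable_sum_seq => b.
    have di : derivable (fun y => invmx (g i y) a b) x (delta_mx 0 a).
      exact: derivable_inverse_metric.
    exact: (derivableM di (ddu x a b Dx)).
  have ds : derivable (sqrt_det g i) x (delta_mx 0 a) by exact: derivable_sqrt_det.
  exact: (derivableM ds dG).
have dh1u a : is_derive x (delta_mx 0 a) (h1 \o u) (h2 (u x) * partial a u x).
  by apply: is_derive_comp_real => //; apply: derivable_is_derive; exact: du.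
have pY a : partial a (fun y => sqrt_det g i y * gradient_in g i (f \o bwd i) a y) x =
    h1 (u x) * partial a (Y a) x + Y a x * (h2 (u x) * partial a u x).
  have [_ <-] := is_deriveM (dh1u a) (derivable_is_derive (dY a)).
  rewrite /partial; apply: near_eq_derive.
  apply: filterS (near_D x Dx) => y Dy.
  have -> : gradient_in g i (f \o bwd i) a y = h1 (u y) * gradient_in g i u a y.
    by rewrite /gradient_in mulr_sumr; apply: eq_bigr => b _; rewrite pf// mulrCA.
  by rewrite -[RHS]/(h1 (u y) * (sqrt_det g i y * gradient_in g i u a y)) mulrCA.
pose Su := \sum_a partial a (Y a) x.
pose Sf := \sum_a partial a (fun y => sqrt_det g i y * gradient_in g i (f \o bwd i) a y) x.
pose Sr := \sum_a Y a x * (h2 (u x) * partial a u x).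
have SfE : Sf = h1 (u x) * Su + Sr.
  by rewrite /Su mulr_sumr -big_split /=; apply: eq_bigr => a _; exact: pY.
rewrite -[divergence_in _ _ _ _]/((sqrt_det g i x)^-1 * Su).
rewrite -[X in _ <= X]/((sqrt_det g i x)^-1 * Sf) SfE -ux mulrDr mulrCA lerDl.
pose w : 'rV[R]_n := \row_a partial a u x.
have -> : Sr =
    h2 (u x) * (sqrt_det g i x * (w *m invmx (g i x) *m w^T) 0 0).
  have gE a : (invmx (g i x) *m w^T) a 0 = gradient_in g i u a x.
    rewrite mxE /gradient_in; apply: eq_bigr => b _; congr (_ * _).
    by rewrite mxE mxE.
  rewrite /Sr -mulmxA mxE !mulr_sumr; apply: eq_bigr => a _.
  rewrite gE [w 0 a]mxE /Y; ring.
rewrite mulrCA mulr_ge0 ?ux// mulrA mulr_ge0 ?inverse_metric_ge0//.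
by rewrite mulr_ge0 ?invr_ge0 ?sqrtr_ge0.
Qed.

End laplacian_of_composition.

(** * Convex truncation of the positive part *)

Section truncation.
Context {R : realType}.

Lemma nondecreasing_of_derive (h h1 : R -> R) :
  (forall s : R, is_derive s 1 h (h1 s)) -> (forall s, 0 <= h1 s) ->
  {homo h : s t / s <= t}.
Proof.
move=> dh h10 s t st; apply: (@ger0_derive1_le_cc _ h s t) => //.
- by move=> u _; rewrite derive1E; have [_ ->] := dh u.
- apply: continuous_subspaceT => u; have [d _] := dh u.
  exact/differentiable_continuous/derivable1_diffP.
- by rewrite in_itv/= lexx.
- by rewrite in_itv/= lexx st.
Qed.

(** Both F and F1 vanish at 0, so the one-sided derivatives agree at the junction s = e. *)
Lemma is_derive_truncation (F F1 : R -> R) (e s : R) :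
  (forall r : R, is_derive r 1 F (F1 r)) -> F 0 = 0 -> F1 0 = 0 ->
  is_derive s 1 (fun s => F (Num.max (s - e) 0)) (F1 (Num.max (s - e) 0)).
Proof.
move=> dF F0 F10; have [se|es|->] := ltgtP s e.
- rewrite (@max_r _ _ (s - e)) ?subr_le0 ?ltW// F10.
  have H := is_derive_cst (0 : R) s 1.
  apply: near_eq_is_derive H.
  have : \forall r \near s, r < e by exact: lt_nbhsl.
  by apply: filterS => r re; rewrite max_r ?subr_le0 ?ltW.
- rewrite (@max_l _ _ (s - e)) ?subr_ge0 ?ltW//.
  have : is_derive s 1 (fun s => F (- e + 1 * s)) (1 * F1 (s - e)).
    by apply: is_derive_affine_comp; rewrite mul1r addrC.
  rewrite mul1r; apply: near_eq_is_derive.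
  have : \forall r \near s, e < r by exact: lt_nbhsr.
  by apply: filterS => r re; rewrite max_l ?subr_ge0 ?ltW// mul1r addrC.
- rewrite subrr maxxx F10.
  have [d E] := dF 0; rewrite F10 in E.
  have cF : (fun h : R => h^-1 *: (F (h *: 1 + 0) - F 0)) @ 0^' --> (0 : R).
    by rewrite -[X in _ --> X]E; exact: d.
  have cG : (fun h : R => h^-1 *: (F (Num.max (h *: 1 + e - e) 0) - F (Num.max (e - e) 0)))
      @ 0^' --> (0 : R).
    apply/cvgr0Pnorm_lt => a a0; have /cvgr0Pnorm_lt/(_ a a0) := cF.
    apply: filterS => h; rewrite addrK addr0 subrr maxxx -[h *: 1]/(h * 1) mulr1.
    have [h0|h0] := leP h 0; last by [].
    by rewrite subrr scaler0 normr0.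
  by split; [apply/cvg_ex; exists 0; exact: cG|exact/cvg_lim].
Qed.

Variable e : R.
Hypothesis e0 : 0 < e.

(** Primitive of r^2 / (e^2 + r^2): it vanishes at 0 together with its first two derivatives, is
    convex on r >= 0 with slope in [0, 1[, and stays within e pi / 2 of r. *)
Definition softplus (r : R) : R := r - e * atan (e^-1 * r).
Definition softplus1 (r : R) : R := 1 - (1 + (e^-1 * r) ^+ 2)^-1.
Definition softplus2 (r : R) : R := 2 * e^-1 ^+ 2 * r * ((1 + (e^-1 * r) ^+ 2)^-1) ^+ 2.

Lemma softplus_denom (r : R) : 0 < 1 + (e^-1 * r) ^+ 2.
Proof. by rewrite ltr_wpDr// sqr_ge0. Qed.

Lemma is_derive_softplus (r : R) : is_derive r 1 softplus (softplus1 r).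
Proof.
have da : is_derive r 1 (fun r => atan (0 + e^-1 * r)) (e^-1 * (1 + (e^-1 * r) ^+ 2)^-1).
  by apply: is_derive_affine_comp; rewrite add0r; exact: is_derive1_atan.
have -> : softplus = (fun r => r - e * atan (0 + e^-1 * r)).
  by apply/funext => t; rewrite /softplus add0r.
have := is_deriveB (is_derive_id r 1) (is_deriveZ e da).
rewrite /softplus1 -[e *: _]/(e * _) mulrA divff ?gt_eqF// mul1r; exact.
Qed.

Lemma is_derive_softplus1 (r : R) : is_derive r 1 softplus1 (softplus2 r).
Proof.
pose q (r : R) := 1 + (e^-1 * r) ^+ 2.
have dq : is_derive r 1 q (2 * e^-1 ^+ 2 * r).
  have d1 : is_derive r 1 (fun r => (0 + e^-1 * r) ^+ 2) (e^-1 * (2 * (e^-1 * r))).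
    apply: (is_derive_affine_comp (f := fun x => x ^+ 2)).
    by apply: is_derive_eq; rewrite add0r -[(e^-1 * r)%:A]/((e^-1 * r) * 1) mulr1; ring.
  have -> : q = (fun=> 1) + (fun r => (0 + e^-1 * r) ^+ 2).
    by apply/funext => t; rewrite /q fctE add0r.
  by apply: is_derive_eq; rewrite add0r; ring.
have q0 : q r != 0 by rewrite gt_eqF// softplus_denom.
have dV : is_derive r 1 (fun r => (q r)^-1) (- (q r) ^- 2 *: (2 * e^-1 ^+ 2 * r)).
  exact: is_deriveV.
have := is_deriveB (is_derive_cst (1 : R) r 1) dV.
rewrite sub0r -[_ *: _]/(- (q r) ^- 2 * (2 * e^-1 ^+ 2 * r)) mulNr opprK /softplus2.
by rewrite -exprVn mulrC; exact.
Qed.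

Lemma softplus0 : softplus 0 = 0.
Proof. by rewrite /softplus mulr0 atan0 mulr0 subr0. Qed.

Lemma softplus10 : softplus1 0 = 0.
Proof. by rewrite /softplus1 mulr0 expr0n addr0 invr1 subrr. Qed.

Lemma softplus1_ge0 r : 0 <= softplus1 r.
Proof.
by rewrite subr_ge0 invf_le1 ?softplus_denom// lerDl sqr_ge0.
Qed.

Lemma softplus1_le1 r : softplus1 r <= 1.
Proof. by rewrite gerBl invr_ge0 ltW// softplus_denom. Qed.

Lemma softplus1_gt0 r : 0 < r -> 0 < softplus1 r.
Proof.
move=> r0; rewrite subr_gt0 invf_lt1 ?softplus_denom// ltrDl exprn_gt0//.
by rewrite mulr_gt0// invr_gt0.
Qed.

Lemma continuous_softplus2 : continuous softplus2.
Proof.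
move=> r.
have cq : (fun r => (1 + (e^-1 * r) ^+ 2)^-1) @ r --> (1 + (e^-1 * r) ^+ 2)^-1.
  apply: cvgV; first by rewrite gt_eqF// softplus_denom.
  apply: cvgD; first exact: cvg_cst.
  have ci : (fun r => e^-1 * r) @ r --> e^-1 * r.
    by apply: cvgM; [exact: cvg_cst|exact: cvg_id].
  exact: (cvgM ci ci).
apply: cvgM; first by apply: cvgM; [exact: cvg_cst|exact: cvg_id].
exact: (cvgM cq cq).
Qed.

(* a convex C^2 approximation of the positive part, vanishing on [s <= e] *)
Definition trunc (s : R) : R := softplus (Num.max (s - e) 0).
Definition trunc1 (s : R) : R := softplus1 (Num.max (s - e) 0).
Definition trunc2 (s : R) : R := softplus2 (Num.max (s - e) 0).

Lemma is_derive_trunc (s : R) : is_derive s 1 trunc (trunc1 s).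
Proof. exact: is_derive_truncation is_derive_softplus softplus0 softplus10. Qed.

Lemma is_derive_trunc1 (s : R) : is_derive s 1 trunc1 (trunc2 s).
Proof.
apply: is_derive_truncation is_derive_softplus1 softplus10 _.
by rewrite /softplus2 mulr0 mul0r.
Qed.

Lemma continuous_trunc2 : continuous trunc2.
Proof.
move=> s; have cm : (fun s => Num.max (s - e) 0) @ s --> Num.max (s - e) 0.
  apply: (@continuous_max _ _ (fun s : R => s - e) (fun=> 0) s); last exact: cvg_cst.
  by apply: cvgB; [exact: cvg_id|exact: cvg_cst].
exact: cvg_comp cm (@continuous_softplus2 _).
Qed.

Lemma trunc2_ge0 s : 0 <= trunc2 s.
Proof.
rewrite /trunc2 /softplus2 mulr_ge0 ?sqr_ge0// mulr_ge0 ?le_max ?lexx ?orbT//.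
by rewrite mulr_ge0 ?sqr_ge0.
Qed.

Lemma trunc1_ge0 s : 0 <= trunc1 s. Proof. exact: softplus1_ge0. Qed.

Lemma trunc1_le1 s : trunc1 s <= 1. Proof. exact: softplus1_le1. Qed.

Lemma trunc1_gt0 s : e < s -> 0 < trunc1 s.
Proof. by move=> es; apply: softplus1_gt0; rewrite lt_max subr_gt0 es. Qed.

Lemma trunc_eq0 s : s <= e -> trunc s = 0.
Proof. by move=> se; rewrite /trunc max_r ?softplus0// subr_le0. Qed.

Lemma trunc_homo : {homo trunc : s t / s <= t}.
Proof. exact: nondecreasing_of_derive is_derive_trunc trunc1_ge0. Qed.

Lemma trunc_ge0 s : 0 <= trunc s.
Proof.
have [se|es] := leP s e; first by rewrite trunc_eq0.
by rewrite -(trunc_eq0 (lexx e)); apply: trunc_homo; exact: ltW.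
Qed.

Lemma trunc_gt0 s : e < s -> 0 < trunc s.
Proof.
move=> es; rewrite lt_neqAle trunc_ge0 andbT eq_sym; apply/eqP => ts0.
pose m := (e + s) / 2; have em : e < m by rewrite /m; lra.
have ms : m < s by rewrite /m; lra.
have t0 u : u <= s -> trunc u = 0.
  by move=> us; apply/eqP; rewrite eq_le trunc_ge0 andbT -ts0 trunc_homo.
have : 'D_1 trunc m = 0.
  rewrite (@near_eq_derive _ _ _ trunc (fun=> 0) m 1); first exact: derive_cst.
  have : \forall u \near m, u < s by exact: lt_nbhsl.
  by apply: filterS => u us; rewrite t0// ltW.
by have [_ ->] := is_derive_trunc m; apply/eqP; rewrite gt_eqF// trunc1_gt0.
Qed.

Lemma trunc_le s : 0 <= s -> trunc s <= s.
Proof.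
move=> s0; have [se|es] := leP s e; first by rewrite trunc_eq0.
rewrite /trunc max_l ?subr_ge0 ?(ltW es)// /softplus.
have : 0 <= e * atan (e^-1 * (s - e)).
  rewrite mulr_ge0 ?(ltW e0)// -atan0.
  apply: (nondecreasing_of_derive (h1 := fun x : R => (1 + x ^+ 2)^-1)).
  - by move=> x; rewrite invr_ge0 addr_ge0// sqr_ge0.
  - by rewrite mulr_ge0 ?invr_ge0 ?(ltW e0)// subr_ge0 ltW.
by have := e0; set x := e * _; lra.
Qed.

Lemma trunc_ge s : s - 3 * e <= trunc s.
Proof.
have [se|es] := leP s e; first by rewrite trunc_eq0//; have := e0; lra.
rewrite /trunc max_l ?subr_ge0 ?(ltW es)// /softplus.
(* The gap 3 e is made of e from the shift and e (pi / 2) < 2 e from the arctangent. *)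
have : e * atan (e^-1 * (s - e)) <= e * 2.
  by rewrite ler_pM2l// ltW// (lt_trans (atan_ltpi2 _))// pihalf_lt2.
by have := e0; set x := e * atan _; lra.
Qed.

End truncation.

(** * Kato's inequality *)

Section kato.
Context {R : realType} {M : ptopologicalType} {n : nat}.
Context {A : smooth_atlas R M n} {g : riemannian_metric A}.
Context {vol : {measure set (borel M) -> \bar R}}.
Context {d : measure_display} {T : measurableType d}.
Variable X : brownian_motion g vol T.

Local Notation law := (bm_law X).
Local Notation path := (bm_path X).

Lemma Ck_on_continuous k (f : M -> R) : Ck_on A k setT f -> continuous f.
Proof.
move=> Cf p; have pi := chart_atP A p; set i := chart_at A p in pi.
have [fi bfi] := fwdP pi.
have cfb : {for fwd i p, continuous (f \o bwd i)} by exact: Ck_continuous (Cf i) _.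
have cc := cvg_comp _ _ (fwd_continuous pi) cfb.
rewrite /continuous_at -[f p]/(f p) -{2}bfi.
apply: cvg_trans cc; apply: near_eq_cvg.
apply: filterS (near_cdom pi) => q qi /=.
by have [_ ->] := fwdP qi.
Qed.

(** [bm_generator] is phrased with real integrals and the semigroup with extended ones; boundedness
    of f makes them agree. *)
Lemma heat_real t (f : M -> R) (B : R) x : 0 <= t -> continuous f ->
  (forall p, 0 <= f p) -> (forall p, f p <= B) ->
  heat X t (EFin \o f) x = (\int[law x]_w extend_infty 0 f (path t w))%:E.
Proof.
move=> t0 cf f0 fB.
have B0 : 0 <= B by exact: le_trans (f0 point) (fB point).
have mf : measurable_fun setT (EFin \o f : borel M -> \bar R).
  apply/measurable_EFinP; apply: continuous_borel_measurable => //.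
  exact: continuous_subspaceT.
have E w : at_time X t (EFin \o f) w = (extend_infty 0 f (path t w))%:E.
  by rewrite /at_time; case: (path t w).
rewrite /heat /Rintegral.
have -> : (\int[law x]_w at_time X t (EFin \o f) w =
    \int[law x]_w (extend_infty 0 f (path t w))%:E)%E.
  by apply: eq_integral => w _; exact: E.
rewrite fineK// ge0_fin_numE; last first.
  by apply: integral_ge0 => w _; rewrite lee_fin; case: (path t w).
apply: (@le_lt_trans _ _ (\int[law x]_w B%:E)%E).
  apply: le_integral_ge0 => w _; rewrite lee_fin; case: (path t w) => //=.
by rewrite integral_cst//= probability_setT mule1 ltry.
Qed.

Variables (W : set (borel M)) (lam : R) (phi : M -> R).
Hypothesis oW : open (W : set M).
Hypothesis cW : compact (closure (W : set M)).
Hypothesis phiP : dirichlet_solution g W lam phi.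

Let mW : measurable W := open_borel oW.

Lemma boundary_open p : closure (W : set M) p -> ~ W p -> boundary W p.
Proof. by move=> cWp nWp; split => // iW; apply: nWp; exact: interior_subset iW. Qed.

Lemma solution_bounded : exists2 B : R, 0 <= B & forall p, closure (W : set M) p -> `|phi p| <= B.
Proof.
have [_ cphi _ _] := phiP.
have /ex_strict_bound_gt0[B B0 /= BP] : bounded_set (phi @` closure (W : set M)).
  by apply: compact_bounded; exact: continuous_compact.
exists B; first exact: ltW.
by move=> p Wp; apply: ltW; apply: BP; exists p.
Qed.

Section truncated_solution.
Variable e : R.
Hypothesis e0 : 0 < e.

(** A solution is unconstrained off the closure of W, so the value 0 is imposed outside W. *)
Definition truncated (p : M) : R := if p \in (W : set M) then trunc e (phi p) else 0.
Definition superlevel : set (borel M) := closure (W : set M) `&` [set p | e <= phi p].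

Lemma superlevel_compact : compact (superlevel : set M).
Proof.
have [_ cphi _ _] := phiP.
have /closed_subspaceP[V cV VE] :
    closed ((phi : subspace (closure (W : set M)) -> R) @^-1` `[e, +oo[%classic).
  by move/continuous_closedP : cphi; apply; exact: interval_closed.
have -> : superlevel = V `&` closure (W : set M).
  rewrite VE /superlevel setIC; congr (_ `&` _); apply/seteqP.
  by split=> p /=; rewrite in_itv/= andbT.
apply: subclosed_compact cW _; last by move=> p [].
by apply: closedI => //; exact: closed_closure.
Qed.

Lemma superlevel_sub : superlevel `<=` W.
Proof.
move=> p [cp ep]; apply: contrapT => nWp.
have [_ _ _ /(_ p (boundary_open cp nWp)) phi0] := phiP.
by move: ep; rewrite /= phi0 leNgt e0.
Qed.

Lemma truncated_in p : W p -> truncated p = trunc e (phi p).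
Proof. by move=> Wp; rewrite /truncated mem_set. Qed.

Lemma truncated_out p : ~ superlevel p -> truncated p = 0.
Proof.
move=> np; rewrite /truncated; case: ifPn => // /set_mem Wp.
apply: trunc_eq0; rewrite leNgt; apply/negP => ep; apply: np.
by split; [exact: subset_closure|exact: ltW].
Qed.

Lemma truncated_ge0 p : 0 <= truncated p.
Proof. by rewrite /truncated; case: ifPn => // _; exact: trunc_ge0. Qed.

(** Two open sets cover M: W, where the truncation is a C^2 function of phi, and the complement of
    the compact superlevel set, where it is 0. *)
Lemma truncated_C2c : C2c A truncated.
Proof.
split; last by exists superlevel; [exact: superlevel_compact|exact: truncated_out].
have oK : open (~` (superlevel : set M)).
  apply: closed_openC; apply: compact_closed; first exact: atlas_hausdorff A.
  exact: superlevel_compact.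
move=> i; pose D1 := ccod i `&` bwd i @^-1` (W : set M).
pose D2 := ccod i `&` bwd i @^-1` (~` (superlevel : set M)).
have -> : ccod i `&` bwd i @^-1` setT = D1 `|` D2.
  apply/seteqP; split=> [x [xi _]|x [[]|[]]//].
  have [Wx|nWx] := pselect ((W : set M) (bwd i x)); [left|right]; split => //.
  by move=> /superlevel_sub.
have oD1 : open D1 by exact: open_chart_preimage.
have oD2 : open D2 by exact: open_chart_preimage.
apply: CkU.
  apply: (@Ck_eq _ _ 2 D1 (trunc e \o (phi \o bwd i))); first exact: oD1.
    by move=> x [_ Wx] /=; rewrite truncated_in.
  apply: (@Ck2_comp _ _ D1 (phi \o bwd i) (trunc e) (trunc1 e) (trunc2 e)); first exact: oD1.
  - exact: is_derive_trunc.
  - exact: is_derive_trunc1.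
  - exact: continuous_trunc2.
  - by have [h _ _ _] := phiP; exact: h.
apply: (@Ck_eq _ _ 2 D2 (fun=> 0)); [exact: oD2| |exact: Ck_cst].
by move=> x [_ nKx] /=; rewrite truncated_out.
Qed.

Lemma truncated_continuous : continuous truncated.
Proof. by have [C _] := truncated_C2c; exact: Ck_on_continuous C. Qed.

Lemma laplacian_truncated p : superlevel p ->
  - (lam * (trunc1 e (phi p) * phi p)) <= laplacian g truncated p.
Proof.
move=> Kp; have Wp := superlevel_sub Kp; have [Cphi _ lapphi _] := phiP.
have -> : - (lam * (trunc1 e (phi p) * phi p)) = trunc1 e (phi p) * laplacian g phi p.
  by rewrite -[laplacian _ _ _]opprK lapphi// mulrN mulrCA.
apply: (@laplacian_convex_comp _ _ _ _ _ W phi truncated (trunc e) (trunc1 e) (trunc2 e)) => //.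
- exact: truncated_in.
- exact: is_derive_trunc.
- exact: is_derive_trunc1.
- exact: trunc2_ge0.
Qed.

Lemma generator_right (f : M -> R) (a : R) : C2c A f -> 0 < a ->
  exists2 r : R, 0 < r & forall t x, 0 < t -> t < r ->
    `| t^-1 * (\int[law x]_w extend_infty 0 f (path t w) - f x) - laplacian g f x | < a.
Proof.
move=> Cf a0; have := bm_generator X Cf a0.
move=> /nbhs_ballP[r /= r0 rP]; exists r => // t x t0 tr.
apply: rP => //; rewrite -ball_normE /= sub0r normrN ger0_norm//; exact: ltW.
Qed.

End truncated_solution.

Lemma truncated_le_norm e p (B : R) : 0 < e ->
  (forall p, closure (W : set M) p -> `|phi p| <= B) -> 0 <= B -> truncated e p <= B.
Proof.
move=> e0 BP B0; rewrite /truncated; case: ifPn => // /set_mem Wp.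
have [phi0|phi0] := leP 0 (phi p).
  apply: le_trans (trunc_le e0 phi0) _; apply: le_trans (ler_norm _) _.
  by apply: BP; exact: subset_closure.
by rewrite trunc_eq0// ltW// (lt_trans phi0).
Qed.

(** Maximum principle through the semigroup: at a maximum point q of the truncation f, P_t f does
    not exceed f at q, so Delta f <= 0 there. A negative lam would make the lower bound of
    [laplacian_truncated] positive at q. *)
Lemma eigenvalue_ge0 p : W p -> 0 < phi p -> 0 <= lam.
Proof.
move=> Wp phip; rewrite leNgt; apply/negP => lam0.
pose e := phi p / 2; have e0 : 0 < e by rewrite divr_gt0.
have ep : e < phi p by rewrite /e; lra.
have Kp : superlevel e p by split; [exact: subset_closure|exact: ltW].
have cf := truncated_continuous e0.
have [] := @compact_EVT_max _ R (truncated e) (superlevel e) _ (superlevel_compact (e := e)) _.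
- by exists p.
- by apply: continuous_subspaceT => q; exact: cf.
move=> q /set_mem Kq maxq.
have fmax x : truncated e x <= truncated e q.
  have [Kx|nKx] := pselect (superlevel e x); first by apply: maxq; rewrite inE.
  by rewrite truncated_out// truncated_ge0.
have lap_le0 : laplacian g (truncated e) q <= 0.
  apply/ler_addgt0Pr => a a0; rewrite add0r.
  have [r r0 rP] := generator_right (truncated_C2c e0) a0.
  have := rP (r / 2) q; rewrite divr_gt0// => /(_ isT).
  have -> : r / 2 < r by lra.
  move=> /(_ isT); rewrite ltr_norml => /andP[+ _].
  set P := (\int[_]__ _); have Pf : P <= truncated e q.
    rewrite -lee_fin -(@heat_real _ _ (truncated e q))//; last 2 first.
    - by rewrite divr_ge0// ltW.
    - by move=> y; exact: truncated_ge0.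
    apply: (@le_trans _ _ (\int[law q]_w (truncated e q)%:E)%E).
      apply: le_integral_ge0 => w _; rewrite /at_time; case: (path _ w) => [y|] //=.
      + by rewrite lee_fin truncated_ge0.
      + by rewrite lee_fin.
      + by rewrite lee_fin truncated_ge0.
    by rewrite integral_cst//= probability_setT mule1.
  have : (r / 2)^-1 * (P - truncated e q) <= 0.
    by rewrite mulr_ge0_le0 ?invr_ge0 ?divr_ge0 ?(ltW r0)// subr_le0.
  lra.
have phiq : e < phi q.
  rewrite ltNge; apply/negP => qe.
  have : truncated e p <= truncated e q by exact: fmax.
  rewrite !truncated_in//; last exact: superlevel_sub e0 _ Kq.
  by rewrite (trunc_eq0 qe) leNgt trunc_gt0.
have := laplacian_truncated e0 Kq.
rewrite leNgt => /negP; apply; apply: le_lt_trans lap_le0 _.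
by rewrite oppr_gt0 nmulr_rlt0// mulr_gt0 ?trunc1_gt0// (lt_trans e0).
Qed.

End kato.

(** * Exponential lower bound for the killed semigroup *)

Section kato_inequality.
Context {R : realType} {M : ptopologicalType} {n : nat}.
Context {A : smooth_atlas R M n} {g : riemannian_metric A}.
Context {vol : {measure set (borel M) -> \bar R}}.
Context {d : measure_display} {T : measurableType d}.
Variable X : brownian_motion g vol T.

(** As e^x >= 1 + x, the left side is at most 1 / (1 + l' r), and (1 + l' r) (1 - l r) >= 1 follows
    from l l' r <= l' - l. The strict gap between l and l' leaves room for all small steps r. *)
Lemma expRN_le (l l' r : R) : 0 <= l -> l < l' -> 0 <= r -> l * l' * r <= l' - l ->
  expR (- (l' * r)) <= 1 - r * l.
Proof.
move=> l0 ll' r0 h; rewrite expRN.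
have p1 : 0 < 1 + l' * r by rewrite ltr_wpDr// mulr_ge0// (le_trans l0) ?ltW.
apply: (@le_trans _ _ (1 + l' * r)^-1).
  by rewrite lef_pV2 ?posrE ?expR_gt0// expR_ge1Dx.
rewrite -[leLHS]mul1r ler_pdivrMr//.
have := mulr_ge0 r0 (_ : 0 <= l' - l - l * l' * r); rewrite subr_ge0 => /(_ h); lra.
Qed.

Lemma le_heat t (u v : M -> \bar R) x : (forall y, 0 <= u y)%E ->
  (forall y, u y <= v y)%E -> (heat X t u x <= heat X t v x)%E.
Proof.
move=> u0 uv; apply: le_integral_ge0 => w _; first exact: at_time_ge0.
by rewrite /at_time; case: (bm_path X t w) => [p|] //=; exact: uv.
Qed.

Lemma heat_cst_le t (c : R) x : 0 <= t -> 0 <= c -> (heat X t (fun=> c%:E) x <= c%:E)%E.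
Proof.
move=> t0 c0; apply: (@le_trans _ _ (\int[bm_law X x]_w c%:E)%E).
  apply: le_integral_ge0 => w _; rewrite /at_time; case: (bm_path X t w) => [p|] //=;
  by rewrite lee_fin.
by rewrite integral_cst//= probability_setT mule1.
Qed.

Variables (W : set (borel M)) (lam lam' : R) (phi : M -> R).
Hypothesis oW : open (W : set M).
Hypothesis cW : compact (closure (W : set M)).
Hypothesis phiP : dirichlet_solution g W lam phi.
Hypothesis volW : (vol W < +oo)%E.
Hypotheses (lam0 : 0 <= lam) (lamlam' : lam < lam').

Let mW : measurable W := open_borel oW.

Section fixed_level.
Variable e : R.
Hypothesis e0 : 0 < e.

Let f : M -> R := truncated W phi e.
Let K : set (borel M) := superlevel W phi e.
(** Error per unit of time: 3 lam e because phi <= f + 3 e on K, and e for the uniform convergence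
    of the generator. *)
Let c : R := 3 * lam * e + e.

Let c0 : 0 <= c.
Proof. by rewrite /c addr_ge0 ?(ltW e0)// !mulr_ge0// ltW. Qed.

Let f0 p : 0 <= f p. Proof. exact: truncated_ge0. Qed.

Let cf : continuous f. Proof. exact: (truncated_continuous oW cW phiP e0). Qed.

Let cK : compact (K : set M). Proof. exact: (superlevel_compact cW phiP). Qed.

Let mK : measurable K. Proof. exact: (compact_borel (A := A)). Qed.

Let KW : K `<=` W. Proof. exact: (superlevel_sub phiP e0). Qed.

Let volK : (vol K < +oo)%E.
Proof. by apply: le_lt_trans volW; apply: le_measure; rewrite ?inE. Qed.

Let mf : measurable_fun setT (EFin \o f : borel M -> \bar R).
Proof.
apply/measurable_EFinP; apply: continuous_borel_measurable => //.
exact: continuous_subspaceT.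
Qed.

Let Ef0 (p : borel M) : (0 <= (EFin \o f) p)%E. Proof. by rewrite lee_fin. Qed.

Lemma heat_truncated_ge : exists2 r : R, 0 < r & forall t x, 0 < t -> t < r -> K x ->
  ((expR (- (lam' * t)) * f x)%:E <= heat X t (EFin \o f) x + (t * c)%:E)%E.
Proof.
have [B B0 BP] := solution_bounded cW phiP.
have [r1 r10 r1P] := generator_right X (truncated_C2c oW cW phiP e0) e0.
(* For t < r2 one has lam lam' t <= lam' - lam, as [expRN_le] asks; the summand 1 keeps the
   denominator positive. *)
pose r2 := (lam' - lam) / (lam * lam' + 1).
have lam'0 : 0 <= lam' by rewrite (le_trans lam0) ?ltW.
have p1 : 0 < lam * lam' + 1 by rewrite ltr_wpDl// mulr_ge0.
have r20 : 0 < r2 by rewrite divr_gt0// subr_gt0.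
exists (Num.min r1 r2); first by rewrite lt_min r10.
move=> t x t0; rewrite lt_min => /andP[tr1 tr2] Kx.
have fB p : f p <= B by exact: truncated_le_norm.
rewrite (heat_real X x (ltW t0) cf f0 fB) -EFinD lee_fin.
set P := (\int[_]__ _).
have := r1P t x t0 tr1; rewrite -/f -/P ltr_norml => /andP[+ _].
have := laplacian_truncated oW phiP e0 Kx; rewrite -/f.
set D := laplacian g f x => HD HP.
have phix : e <= phi x by exact: Kx.2.
have H1 : lam * (trunc1 e (phi x) * phi x) <= lam * (f x + 3 * e).
  apply: ler_wpM2l => //; apply: (@le_trans _ _ (phi x)).
    by rewrite ler_piMl ?trunc1_le1// (le_trans (ltW e0)).
  rewrite /f truncated_in//; last exact: KW.
  have := trunc_ge e0 (phi x); lra.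
have H2 : expR (- (lam' * t)) <= 1 - t * lam.
  apply: expRN_le => //; first exact: ltW.
  move: (ltW tr2); rewrite ler_pdivlMr// => h.
  apply: le_trans h; rewrite mulrDr mulr1 mulrC lerDl; exact: ltW.
have H3 : t * (D - e) <= P - f x.
  have h : D - e <= t^-1 * (P - f x) by lra.
  have := ler_wpM2l (ltW t0) h; rewrite mulrA divff ?gt_eqF// mul1r; exact.
have H4 : t * (- (lam * (f x + 3 * e)) - e) <= t * (D - e).
  by apply: ler_wpM2l; [exact: ltW|lra].
have H5 := ler_wpM2r (f0 x) H2.
rewrite /c; apply: le_trans H5 _; lra.
Qed.

(** Off K the truncation vanishes, so killing there loses nothing. On K each step contributes one
    exponential factor and an error t * c, and the semigroup does not increase the errors already
    made, which are constants. *)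
Lemma killed_truncated_ge t j : 0 <= t ->
  (forall x, K x ->
    ((expR (- (lam' * t)) * f x)%:E <= heat X t (EFin \o f) x + (t * c)%:E)%E) ->
  forall x, ((expR (- (lam' * t)) ^+ j * f x)%:E <=
    killed X K (nseq j t) (EFin \o f) x + (j%:R * (t * c))%:E)%E.
Proof.
move=> t0 step; set q := expR _ in step *.
have q0 : 0 <= q by exact: expR_ge0.
have q1 : q <= 1.
  rewrite -expR0 ler_expR oppr_le0 mulr_ge0// (le_trans lam0)// ltW//.
have tc0 : 0 <= t * c by exact: mulr_ge0.
have inc k : increments (nseq k t) by rewrite /increments all_nseq t0 orbT.
elim: j => [|j IH] x.
  rewrite expr0 mul1r mul0r adde0 /= indicE.
  have [xK|nxK] := boolP (x \in K); first by rewrite mul1e.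
  by rewrite mul0e /f truncated_out// => Kx; move: nxK; rewrite (mem_set Kx).
have jtc0 : 0 <= j%:R * (t * c) by rewrite mulr_ge0.
have [Kx|nKx] := pselect (K x); last first.
  rewrite /f truncated_out// mulr0 adde_ge0 ?lee_fin ?mulr_ge0//.
  by apply: killed_ge0 => y; exact: Ef0.
rewrite /= indicE (mem_set Kx) mul1e.
have mk := measurable_killed X mK (inc j) mf Ef0.
have k0 (y : borel M) : (0 <= killed X K (nseq j t) (EFin \o f) y)%E by exact: killed_ge0.
have [_ addH mulH _] := pos_integral_heat X x t0.
have E1 : heat X t (fun y => (q ^+ j)%:E * (EFin \o f) y)%E x = ((q ^+ j)%:E * heat X t (EFin \o f) x)%E.
  by apply: mulH => //; exact: exprn_ge0.
have E2 : heat X t (fun y => killed X K (nseq j t) (EFin \o f) y + (j%:R * (t * c))%:E)%E x =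
  (heat X t (killed X K (nseq j t) (EFin \o f)) x + heat X t (fun=> (j%:R * (t * c))%:E) x)%E.
  apply: addH => //; by move=> y; rewrite lee_fin.
have L1 : (heat X t (fun y => (q ^+ j)%:E * (EFin \o f) y)%E x <=
    heat X t (fun y => killed X K (nseq j t) (EFin \o f) y + (j%:R * (t * c))%:E)%E x)%E.
  apply: le_heat => y; first by rewrite mule_ge0// lee_fin exprn_ge0.
  by rewrite -EFinM; exact: IH.
have L2 := heat_cst_le x t0 jtc0.
rewrite exprSr -mulrA EFinM.
apply: (@le_trans _ _ ((q ^+ j)%:E * (heat X t (EFin \o f) x + (t * c)%:E))%E).
  by rewrite lee_wpmul2l ?lee_fin ?exprn_ge0//; exact: step.
have h0 : (0 <= heat X t (EFin \o f) x)%E by exact: heat_ge0.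
rewrite ge0_muleDr// ?lee_fin// -E1.
apply: (@le_trans _ _ (heat X t (killed X K (nseq j t) (EFin \o f)) x +
    (j%:R * (t * c))%:E + (t * c)%:E)%E).
  apply: leeD.
    by apply: le_trans L1 _; rewrite E2; exact: leeD2l.
  by rewrite -EFinM lee_fin ler_piMl// exprn_ile1.
by rewrite -addeA -EFinD -natr1 [in leRHS]mulrDl mul1r.
Qed.

Let kone t i (x : borel M) := killed X K (dgrid t i) (fun=> 1%E) x.

Lemma truncated_survival_cvg t : 0 <= t ->
  ((\int[vol]_x ((f x)%:E * kone t i x)) @[i --> \oo] -->
   \int[vol]_x ((f x)%:E * survival X K t x))%E.
Proof.
move=> t0; have [B B0 BP] := solution_bounded cW phiP.
have fB p : f p <= B by exact: truncated_le_norm.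
pose F i (x : borel M) := ((f x)%:E * kone t i x)%E.
pose F' (x : borel M) := ((f x)%:E * survival X K t x)%E.
have mkone i : measurable_fun setT (kone t i).
  by apply: measurable_killed => //; exact: increments_dgrid.
have mF i : measurable_fun setT (F i) by exact: emeasurable_funM.
have mF' : measurable_fun setT F'.
  by apply: emeasurable_funM => //; exact: (measurable_survival X cK t0).
have intB : vol.-integrable setT (fun x : borel M => B%:E * (\1_K x)%:E)%E.
  by apply: integrableZl => //; exact: (integrable_indic_K (A := A) cK volK).
have k0 i (x : borel M) : (0 <= kone t i x)%E by apply: killed_ge0 => y; rewrite lee_fin.
have [_ _ +] : [/\ vol.-integrable setT F',
   [sequence \int[vol]_(x in setT) `|F i x - F' x|]_i @ \oo --> 0 &
   [sequence \int[vol]_(x in setT) F i x]_i @ \oo --> \int[vol]_x F' x]%E.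
  apply: (dominated_convergence measurableT mF mF' _ intB).
  - apply: aeW => x _; apply: cvgeZl => //; exact: (survival_cvg cK).
  - apply: aeW => x i _; rewrite gee0_abs ?mule_ge0 ?lee_fin//.
    apply: lee_pmul => //; rewrite ?lee_fin//.
    by apply: (killed_one_le X cK); exact: increments_dgrid.
by [].
Qed.

(** The time t is divided into 2^i steps, short enough for [heat_truncated_ge]; symmetry moves the
    killed operator from f to the constant 1, and i tends to infinity. *)
Lemma truncated_survival_ge t : 0 < t ->
  ((expR (- (lam' * t)))%:E * \int[vol]_x (f x)%:E <=
   \int[vol]_x ((f x)%:E * survival X K t x) + (t * c)%:E * vol K)%E.
Proof.
move=> t_gt0; have t0 := ltW t_gt0; have cvg := truncated_survival_cvg t0.
have tc0 : 0 <= t * c by exact: mulr_ge0.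
have k0 i (x : borel M) : (0 <= kone t i x)%E by apply: killed_ge0 => y; rewrite lee_fin.
have s0 : (0 <= \int[vol]_x ((f x)%:E * survival X K t x))%E.
  by apply: integral_ge0 => x _; rewrite mule_ge0// ?lee_fin//; exact: survival_ge0.
have b0 : (0 <= (t * c)%:E * vol K)%E by rewrite mule_ge0// lee_fin.
have cvgD : ((\int[vol]_x ((f x)%:E * kone t i x) + (t * c)%:E * vol K)%E @[i --> \oo] -->
    (\int[vol]_x ((f x)%:E * survival X K t x) + (t * c)%:E * vol K)%E).
  apply: cvgeD; [exact: ge0_adde_def|exact: cvg|exact: cvg_cst].
rewrite -(cvg_lim _ cvgD)//; apply: lime_ge; first by apply/cvg_ex; eexists; exact: cvgD.
have [r r0 rP] := heat_truncated_ge.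
have [N NP] := small_step t r0.
exists N => // i /= Ni.
pose dl := t / (2 ^ i)%:R; have dl0 : 0 < dl by rewrite divr_gt0// ltr0n expn_gt0.
have mdl : (2 ^ i)%:R * dl = t.
  by rewrite /dl mulrC divfK// pnatr_eq0 -lt0n expn_gt0.
have step x : K x -> ((expR (- (lam' * dl)) * f x)%:E <=
    heat X dl (EFin \o f) x + (dl * c)%:E)%E by apply: rP => //; exact: NP.
have := killed_truncated_ge (2 ^ i) (ltW dl0) step.
rewrite -expRM_natl mulrN mulrCA mdl mulrA mdl -/(dgrid t i) => H.
have mkf : measurable_fun setT (killed X K (dgrid t i) (EFin \o f) : borel M -> \bar R).
  by apply: measurable_killed => //; exact: increments_dgrid.
have kf0 (x : borel M) : (0 <= killed X K (dgrid t i) (EFin \o f) x)%E by exact: killed_ge0.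
have E1 : ((expR (- (lam' * t)))%:E * \int[vol]_x (f x)%:E =
    \int[vol]_x ((expR (- (lam' * t)))%:E * (f x)%:E))%E.
  have q0 := expR_ge0 (- (lam' * t)).
  have f0' (x : borel M) : setT x -> (0 <= (EFin \o f) x)%E by move=> _; exact: Ef0.
  exact/esym/(ge0_integralZl_EFin vol measurableT f0' mf q0).
have revE : rev (dgrid t i) = dgrid t i.
  rewrite /dgrid; set a := t / _; move: (2 ^ i)%N; elim=> // m IH.
  by rewrite -{1}addn1 nseqD rev_cat IH.
have one0 (y : borel M) : (0 <= (1 : \bar R))%E by rewrite lee_fin.
have E2 := @killed_symmetric _ _ _ _ _ _ _ _ X K mK (dgrid t i)
  (EFin \o f) (fun=> 1%E) (increments_dgrid i t0) mf Ef0 measurable_cst1 one0.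
rewrite E1 E2 revE.
have mI : measurable_fun setT (fun x : borel M => (t * c)%:E * (\1_K x)%:E : \bar R)%E.
  by apply: measurable_funeM; apply/measurable_EFinP; exact: measurable_indic.
have I0 (x : borel M) : (0 <= (t * c)%:E * (\1_K x)%:E)%E by rewrite mule_ge0// lee_fin.
have E3 : ((t * c)%:E * vol K = \int[vol]_(x in setT) ((t * c)%:E * (\1_K x)%:E))%E.
  rewrite ge0_integralZl_EFin//; first by rewrite integral_indic// setIT.
  by apply/measurable_EFinP; exact: measurable_indic.
rewrite E3 -ge0_integralD//; last 2 first.
- by move=> x _; rewrite mule_ge0.
- by apply: emeasurable_funM => //; exact: measurable_cst.
apply: le_integral_ge0 => x _; first by apply: mule_ge0; rewrite lee_fin ?expR_ge0.
rewrite mule1; have [Kx|nKx] := pselect (K x); last first.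
  by rewrite /f truncated_out// mule0 adde_ge0.
by rewrite indicE (mem_set Kx) mule1 -EFinM; exact: H.
Qed.

End fixed_level.

Lemma positive_part_tail_ge t : 0 < t ->
  ((expR (- (lam' * t)))%:E * \int[vol]_(x in W) (Num.max (phi x) 0)%:E <=
   \int[vol]_(x in W) ((Num.max (phi x) 0)%:E * exit_tail X W x t))%E.
Proof.
move=> t_gt0; have t0 := ltW t_gt0; pose q := expR (- (lam' * t)).
have q0 : 0 <= q by exact: expR_ge0.
pose v := fine (vol W).
have vE : vol W = v%:E by rewrite fineK// ge0_fin_numE.
have v0 : 0 <= v by exact: fine_ge0.
(* The total error is e * m: the part q 3 e v comes from u <= f + 3 e, the part t (3 lam e + e) v
   from [truncated_survival_ge]. *)
pose m := q * 3 * v + t * (3 * lam + 1) * v.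
have m0 : 0 <= m by rewrite addr_ge0// !mulr_ge0// ?addr_ge0 ?mulr_ge0.
set u := fun x : M => (Num.max (phi x) 0)%:E.
have u0 x : (0 <= u x)%E by rewrite lee_fin le_max lexx orbT.
apply/lee_addgt0Pr => a a0.
pose e := a / (m + 1); have e0 : 0 < e by rewrite divr_gt0// ltr_wpDl.
have em : e * m <= a.
  by rewrite /e mulrAC ler_pdivrMr ?ltr_wpDl// ler_pM2l// lerDl.
pose f := truncated W phi e; pose K := superlevel W phi e.
have mf : measurable_fun setT (EFin \o f : borel M -> \bar R).
  apply/measurable_EFinP; apply: continuous_borel_measurable => //.
  apply: continuous_subspaceT; exact: (truncated_continuous oW cW phiP e0).
have f0 p : 0 <= f p by exact: truncated_ge0.
have fout (x : M) : ~ W x -> f x = 0.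
  by move=> nW; apply: truncated_out => /(superlevel_sub phiP e0).
have fu x : W x -> ((f x)%:E <= u x)%E.
  move=> Wx; rewrite /f truncated_in// lee_fin le_max.
  have [h|h] := leP 0 (phi x); first by rewrite trunc_le.
  by rewrite (trunc_eq0 (ltW (lt_trans h e0))) lexx orbT.
have uf x : W x -> (u x <= (f x)%:E + (3 * e)%:E)%E.
  move=> Wx; rewrite -EFinD lee_fin ge_max; apply/andP; split.
    by rewrite /f truncated_in//; have := trunc_ge e0 (phi x); lra.
  by rewrite addr_ge0// mulr_ge0// ltW.
have IW (h : M -> \bar R) : (forall x, ~ W x -> h x = 0)%E ->
    (\int[vol]_x h x = \int[vol]_(x in W) h x)%E.
  move=> hout; rewrite [RHS]integral_mkcond; apply: eq_integral => x _.
  by rewrite patchE; case: ifPn => // /negP nW; apply: hout => Wx; apply: nW; rewrite inE.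
have If : (\int[vol]_(x in W) u x <= \int[vol]_x (f x)%:E + (3 * e * v)%:E)%E.
  rewrite IW; last by move=> x nW; rewrite fout.
  have -> : ((3 * e * v)%:E = \int[vol]_(x in W) (3 * e)%:E)%E.
    by rewrite integral_cst//= vE.
  have f0' (x : borel M) : W x -> (0 <= (EFin \o f) x)%E by rewrite lee_fin.
  have mfW : measurable_fun W (EFin \o f : borel M -> \bar R).
    exact: measurable_funS mf.
  have e3 (x : borel M) : W x -> (0 <= (3 * e)%:E)%E.
    by move=> _; rewrite lee_fin mulr_ge0// ltW.
  rewrite -(ge0_integralD vol mW f0' mfW e3 (measurable_cst _)).
  exact: le_integral_ge0.
have Is : (\int[vol]_x ((f x)%:E * survival X K t x) <=
    \int[vol]_(x in W) (u x * exit_tail X W x t))%E.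
  rewrite IW; last by move=> x nW; rewrite fout// mul0e.
  apply: le_integral_ge0 => x Wx; first by rewrite mule_ge0 ?lee_fin ?survival_ge0.
  apply: lee_pmul; rewrite ?lee_fin ?survival_ge0//; first exact: fu.
  apply: survival_le_exit_tail => //; first exact: (superlevel_compact cW phiP).
  exact: (superlevel_sub phiP e0).
have Ik : ((t * (3 * lam * e + e))%:E * vol K <= (t * (3 * lam * e + e) * v)%:E)%E.
  rewrite [leRHS]EFinM -vE lee_wpmul2l//.
    rewrite lee_fin; apply: mulr_ge0 => //; apply: addr_ge0; last exact: ltW.
    exact: mulr_ge0 (mulr_ge0 (ler0n _ 3) lam0) (ltW e0).
  apply: le_measure; rewrite ?inE//; last exact: (superlevel_sub phiP e0).
  apply: (compact_borel (A := A)); exact: (superlevel_compact cW phiP).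
have H := truncated_survival_ge e0 t_gt0.
apply: (@le_trans _ _ (q%:E * (\int[vol]_x (f x)%:E + (3 * e * v)%:E))%E).
  by apply: lee_wpmul2l => //; rewrite lee_fin.
have If0 : (0 <= \int[vol]_x (f x)%:E)%E by apply: integral_ge0 => x _; rewrite lee_fin.
rewrite ge0_muleDr//; last by rewrite lee_fin; exact: mulr_ge0 (mulr_ge0 (ler0n _ 3) (ltW e0)) v0.
apply: (@le_trans _ _ (\int[vol]_(x in W) (u x * exit_tail X W x t) +
   (t * (3 * lam * e + e) * v)%:E + (q * (3 * e * v))%:E)%E).
  by rewrite -EFinM; apply: leeD2r; apply: le_trans H _; apply: leeD.
rewrite -addeA -EFinD leeD2l// lee_fin; apply: le_trans em.
by rewrite /m; lra.
Qed.

End kato_inequality.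

(** * Integrals over time *)

Section time_integrals.
Local Open Scope ereal_scope.
Context {R : realType}.
Local Notation mu := (@lebesgue_measure R).

Lemma FTC2_is_derive (F f : R -> R) (a b : R) : (a <= b)%R ->
  (forall x, is_derive x (1 : R)%R F (f x)) -> continuous f ->
  \int[mu]_(x in `[a, b]) (f x)%:E = (F b - F a)%:E.
Proof.
move=> ab dF cf; have cF : continuous F.
  by move=> x; apply/differentiable_continuous/derivable1_diffP; exact: (@ex_derive _ _ _ _ _ _ _ (dF x)).
move: ab; rewrite le_eqVlt => /predU1P[->|ab].
  by rewrite set_itv1 integral_set1 subrr.
rewrite (@continuous_FTC2 _ f F a b)//.
- exact: continuous_subspaceT.
- split; first by move=> x _; exact: (@ex_derive _ _ _ _ _ _ _ (dF x)).
  + exact/cvg_at_right_filter/cF.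
  + exact/cvg_at_left_filter/cF.
- by move=> x _; rewrite derive1E (@derive_val _ _ _ _ _ _ _ (dF x)).
Qed.

(** Primitive of s^a (T - s)^b by repeated integration by parts; it vanishes at s = T, so the
    integral is minus its value at 0. *)
Fixpoint beta_primitive (T : R) (a b : nat) (s : R) : R :=
  if a is a'.+1 then
    (b.+1%:R^-1 * (a%:R * beta_primitive T a' b.+1 s - s ^+ a * (T - s) ^+ b.+1))%R
  else (- b.+1%:R^-1 * (T - s) ^+ b.+1)%R.

Lemma is_derive_power m (s : R) : is_derive s (1 : R)%R (fun s => s ^+ m : R)%R (m%:R * s ^+ m.-1)%R.
Proof.
apply: DeriveDef; first exact: exprn_derivable.
by rewrite exp_derive /GRing.scale /= mulr1.
Qed.

Lemma is_derive_power_sub m (T s : R) :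
  is_derive s (1 : R)%R (fun s => (T - s) ^+ m.+1 : R)%R (- (m.+1%:R * (T - s) ^+ m))%R.
Proof.
have -> : (- (m.+1%:R * (T - s) ^+ m) = -1 * (m.+1%:R * (T + -1 * s) ^+ m))%R by rewrite !mulN1r.
rewrite (_ : (fun s => _) = (fun s => (T + -1 * s) ^+ m.+1)%R); last first.
  by apply/funext => x; rewrite mulN1r.
exact: is_derive_affine_comp (is_derive_power m.+1 _).
Qed.

Lemma is_derive_beta_primitive T a b s :
  is_derive s (1 : R)%R (beta_primitive T a b) (s ^+ a * (T - s) ^+ b)%R.
Proof.
have b0 m : (m.+1%:R != 0 :> R)%R by rewrite pnatr_eq0.
elim: a b => [|a IH] b.
  have H := is_deriveZ (- b.+1%:R^-1)%R (is_derive_power_sub b T s).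
  apply: (is_derive_eq H); rewrite /GRing.scale /= expr0 mul1r.
  by rewrite mulrNN mulrA mulVf// mul1r.
have H := is_deriveZ (b.+1%:R^-1)%R (is_deriveB (is_deriveZ a.+1%:R%R (IH b.+1))
  (is_deriveM (is_derive_power a.+1 s) (is_derive_power_sub b T s))).
apply: (is_derive_eq H); rewrite /GRing.scale /=.
by field; rewrite nat1r b0.
Qed.

Lemma continuous_beta_integrand T a b : continuous (fun s : R => s ^+ a * (T - s) ^+ b)%R.
Proof.
move=> s; apply: (@cvgM _ _ (nbhs s)); first exact: exprn_continuous.
apply: (@cvg_comp _ _ _ (fun s : R => T - s)%R (fun x : R => x ^+ b)%R (nbhs s) (nbhs (T - s)%R)).
  by apply: (@cvgB _ _ _ (nbhs s)); [exact: cvg_cst|exact: cvg_id].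
exact: exprn_continuous.
Qed.

Lemma beta_integral T a b : (0 <= T)%R ->
  \int[mu]_(s in `[0%R, T]) (s ^+ a * (T - s) ^+ b)%:E =
  (a`!%:R * b`!%:R / (a + b).+1`!%:R * T ^+ (a + b).+1)%:E.
Proof.
move=> T0; rewrite (FTC2_is_derive T0 (is_derive_beta_primitive T a b)); last first.
  exact: continuous_beta_integrand.
congr (_%:E).
have -> : beta_primitive T a b T = 0%R.
  elim: a b => [|a IH] b /=; first by rewrite subrr expr0n mulr0.
  by rewrite IH subrr expr0n !mulr0 subrr mulr0.
have f0 m : (m`!%:R != 0 :> R)%R by rewrite pnatr_eq0 -lt0n fact_gt0.
have b0 m : (m.+1%:R != 0 :> R)%R by rewrite pnatr_eq0.
rewrite sub0r; elim: a b => [|a IH] b /=.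
  rewrite subr0 add0n fact0 mul1r factS natrM mulNr opprK.
  by field; rewrite f0 nat1r b0.
rewrite expr0n /= mul0r subr0 -!mulrN IH addnS addSn.
move: (f0 (a + b).+2); move: ((a + b).+2`!%:R : R)%R => c c0.
rewrite (factS a) (factS b) !natrM.
by field; rewrite c0 nat1r b0.
Qed.

Definition weight (k : nat) (s : R) : R := (k%:R * s ^+ k.-1)%R.

Definition time_integral (k : nat) (N : R) (u : R -> \bar R) : \bar R :=
  \int[mu]_(s in `[0%R, N]) ((weight k s)%:E * u s).

Lemma weight_ge0 k s : (0 <= s)%R -> (0 <= weight k s)%R.
Proof. by move=> s0; rewrite mulr_ge0 ?exprn_ge0. Qed.

Lemma continuous_weight k : continuous (weight k).
Proof. by move=> s; apply: (@cvgZr _ _ _ (nbhs s)); exact: exprn_continuous. Qed.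

Lemma measurable_weight k (D : set (measurableTypeR R)) : measurable_fun D (weight k).
Proof.
apply: (@measurable_funS _ _ _ _ setT) => //.
apply: continuous_measurable_fun; exact: continuous_weight.
Qed.

Lemma weight_integral k a : (0 < k)%N -> (0 <= a)%R ->
  \int[mu]_(s in `[0%R, a]) (weight k s)%:E = (a ^+ k)%:E.
Proof.
move=> k0 a0; rewrite (FTC2_is_derive a0 (is_derive_power k)); last exact: continuous_weight.
by rewrite expr0n gtn_eqF// subr0.
Qed.

Definition before (t : R) (z : \bar R) : \bar R := ((t%:E < z)%E%:R : R)%R%:E.

Definition stop (N : R) (z : \bar R) : R := fine (mine z N%:E).

Lemma before_ge0 t z : 0 <= before t z.
Proof. by rewrite lee_fin. Qed.

Lemma before_le1 t z : before t z <= 1.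
Proof. by rewrite lee_fin; case: (_ < _). Qed.

Lemma stop_lt N z : N%:E < z -> stop N z = N.
Proof. by move=> Nz; rewrite /stop min_r// ltW. Qed.

Lemma stop_ge N (r : R) : (r <= N)%R -> stop N r%:E = r.
Proof. by move=> rN; rewrite /stop min_l. Qed.

Lemma stop_le N z : 0 <= z -> (0 <= N)%R -> (0 <= stop N z <= N)%R.
Proof.
move=> z0 N0; have [Nz|] := ltP N%:E z; first by rewrite (stop_lt Nz) lexx andbT.
by case: z z0 => // r; rewrite !lee_fin => r0 rN; rewrite stop_ge// r0.
Qed.

Lemma stop_homo z N N' : 0 <= z -> (N <= N')%R -> (stop N z <= stop N' z)%R.
Proof.
move=> + NN'; case: z => // r _.
have [h|h] := leP r N; first by rewrite !stop_ge// (le_trans h).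
rewrite stop_lt ?lte_fin//; have [h'|h'] := leP r N'; first by rewrite (stop_ge h') ltW.
by rewrite stop_lt ?lte_fin.
Qed.

Lemma time_integral_le k N u v : (forall s, (0 <= s <= N)%R -> 0 <= u s) ->
  (forall s, (0 <= s <= N)%R -> u s <= v s) ->
  time_integral k N u <= time_integral k N v.
Proof.
move=> u0 uv; apply: le_integral_ge0 => s; rewrite /= in_itv/= => sN.
- by rewrite mule_ge0 ?u0// lee_fin weight_ge0//; case/andP: sN.
- by rewrite lee_wpmul2l ?uv// lee_fin weight_ge0//; case/andP: sN.
Qed.

Lemma eq_time_integral k N u v : (forall s, (0 <= s <= N)%R -> u s = v s) ->
  time_integral k N u = time_integral k N v.
Proof.
move=> uv; apply: eq_integral => s; rewrite inE /= in_itv/= => sN.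
by rewrite uv.
Qed.

Lemma time_integral_cut k N (r : R) (u : R -> R) : (0 <= r <= N)%R -> continuous u ->
  time_integral k N (fun s => before s r%:E * (u s)%:E) =
  \int[mu]_(s in `[0%R, r]) (weight k s * u s)%:E.
Proof.
move=> /andP[r0 rN] cu.
(* [before s r] is a strict inequality, so the right end point is removed first. *)
rewrite -integral_itv_bndo_bndc; last first.
  apply/measurable_EFinP/measurable_funM; first exact: measurable_weight.
  apply: (@measurable_funS _ _ _ _ setT) => //.
  exact: continuous_measurable_fun.
rewrite /time_integral integral_mkcond [RHS]integral_mkcond.
apply: eq_integral => s _; rewrite !patchE !mem_setE !in_itv /= /before lte_fin.
have [s0|] := leP 0%R s => //=; have [sr|rs] := ltP s r.
  by rewrite (le_trans (ltW sr) rN) mul1e -EFinM.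
by rewrite mul0e mule0 if_same.
Qed.

Lemma time_integral_before k N z : (0 < k)%N -> 0 <= z -> (0 <= N)%R ->
  time_integral k N (before^~ z) = (stop N z ^+ k)%:E.
Proof.
move=> k0 z0 N0; have [Nz|] := ltP N%:E z.
  rewrite (stop_lt Nz) -(weight_integral k0 N0); apply: eq_integral => s.
  rewrite inE /= in_itv/= => /andP[_ sN]; rewrite /before.
  by rewrite (le_lt_trans _ Nz) ?mule1// lee_fin.
case: z z0 => // r; rewrite !lee_fin => r0 rN; rewrite stop_ge//.
rewrite -(weight_integral k0 r0).
have -> : time_integral k N (before^~ r%:E) =
    time_integral k N (fun s => before s r%:E * (1%R)%:E).
  by apply: eq_time_integral => s _; rewrite mule1.
rewrite time_integral_cut ?r0//; last exact: cst_continuous.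
by apply: eq_integral => s _; rewrite mulr1.
Qed.

Definition beta_ratio (k : nat) : R := (k`!%:R ^+ 2 / (2 * k)`!%:R)%R.

(** For z <= N the triangle s + t < z lies in the square [0, N]^2, and the beta integral gives
    exactly the ratio times z^(2k). For z > N the whole square bounds the integral by N^(2k), which
    is the value of the right side. *)
Lemma time_integral_convolution k N z : (0 < k)%N -> 0 <= z -> (0 <= N)%R ->
  time_integral k N (fun s => time_integral k N (fun t => before (s + t) z)) <=
  (beta_ratio k * stop N z ^+ (2 * k))%:E +
  ((1 - beta_ratio k) * N ^+ (2 * k))%:E * before N z.
Proof.
move=> k0 z0 N0; have [Nz|zN] := ltP N%:E z.
  rewrite (stop_lt Nz) /before Nz mule1 -EFinD -mulrDl subrKC mul1r.
  apply: (@le_trans _ _ (time_integral k N (fun=> (N ^+ k)%:E))).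
    apply: time_integral_le => s sN.
      by apply: integral_ge0 => t; rewrite /= in_itv/= => /andP[t0 _]; rewrite mule_ge0 ?lee_fin ?weight_ge0.
    rewrite -(weight_integral k0 N0); apply: le_integral_ge0 => t; rewrite /= in_itv/= => /andP[t0 _].
      by rewrite mule_ge0 ?before_ge0// lee_fin weight_ge0.
    by rewrite -[leRHS]mule1 lee_wpmul2l ?before_le1// lee_fin weight_ge0.
  rewrite /time_integral; under eq_integral do rewrite muleC.
  rewrite ge0_integralZl//.
  + by rewrite weight_integral// -EFinM -exprD mul2n addnn.
  + by apply/measurable_EFinP; exact: measurable_weight.
  + by move=> s; rewrite /= in_itv/= => /andP[s0 _]; rewrite lee_fin weight_ge0.
  + by rewrite lee_fin exprn_ge0.
have -> : before N z = 0 by rewrite /before ltNge zN.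
rewrite mule0 adde0.
case: z z0 zN => // r; rewrite !lee_fin => r0 rN; rewrite stop_ge//.
have -> : time_integral k N (fun s => time_integral k N (fun t => before (s + t) r%:E)) =
    time_integral k N (fun s => before s r%:E * ((r - s) ^+ k)%:E).
  apply: eq_time_integral => s /andP[s0 sN].
  have [sr|rs] := ltP s r.
    rewrite /before lte_fin sr mul1e.
    have -> : time_integral k N (fun t => before (s + t) r%:E) = time_integral k N (before^~ (r - s)%:E).
      by apply: eq_time_integral => t _; rewrite /before !lte_fin ltrBrDl.
    rewrite time_integral_before//; last by rewrite lee_fin subr_ge0 ltW.
    by rewrite stop_ge// lerBlDl (le_trans rN)// lerDr.
  rewrite /before lte_fin ltNge rs mul0e.
  apply: integral0_eq => t; rewrite /= in_itv/= => /andP[t0 _].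
  by rewrite lte_fin ltNge (le_trans rs) ?lerDl// mule0.
rewrite time_integral_cut ?r0//; last first.
  have <- : (fun s : R => s ^+ 0 * (r - s) ^+ k)%R = (fun s => (r - s) ^+ k)%R.
    by apply/funext => s; rewrite expr0 mul1r.
  exact: continuous_beta_integrand.
have E : \int[mu]_(s in `[0%R, r]) (weight k s * (r - s) ^+ k)%:E =
  \int[mu]_(s in `[0%R, r]) (k%:R%:E * (s ^+ k.-1 * (r - s) ^+ k)%:E).
  by apply: eq_integral => s _; rewrite -EFinM mulrA.
rewrite E ge0_integralZl//.
- rewrite beta_integral// -EFinM lee_fin /beta_ratio.
  have -> : (k.-1 + k).+1 = (2 * k)%N by rewrite -addSn prednK// mul2n addnn.
  have fE : (k%:R * k.-1`!%:R = k`!%:R :> R)%R by rewrite -natrM -{1 3}(prednK k0) factS.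
  by rewrite !mulrA fE expr2.
- apply/measurable_EFinP; apply: (@measurable_funS _ _ _ _ setT) => //.
  by apply: continuous_measurable_fun; exact: continuous_beta_integrand.
- by move=> s; rewrite /= in_itv/= => /andP[s0 sr]; rewrite lee_fin mulr_ge0 ?exprn_ge0 ?subr_ge0.
Qed.

End time_integrals.

(** * Tonelli's theorem for time integrals *)

Section tonelli.
Local Open Scope ereal_scope.
Context {R : realType} {d : measure_display} {S : measurableType d}.
Local Notation mu := (@lebesgue_measure R).
Local Notation T := (S * measurableTypeR R)%type.

Let density k (N : R) (s : R) : R := (weight k s * \1_(`[0%R, N]%classic) s)%R.

Let density_ge0 k N s : (0 <= density k N s)%R.
Proof.
rewrite /density indicE mem_setE in_itv /=; have [s0|] := leP 0%R s; last by rewrite mulr0.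
by rewrite mulr_ge0// weight_ge0.
Qed.

Let time_integralE k N (u : R -> \bar R) :
  time_integral k N u = \int[mu]_s ((density k N s)%:E * u s).
Proof.
rewrite /time_integral integral_mkcond; apply: eq_integral => s _.
rewrite patchE /density indicE; case: ifPn => _; first by rewrite mulr1.
by rewrite mulr0 mul0e.
Qed.

Let measurable_density k N (f : S -> R -> \bar R) :
  measurable_fun setT (fun p : T => f p.1 p.2) ->
  measurable_fun setT (fun p : T => (density k N p.2)%:E * f p.1 p.2).
Proof.
move=> mf; apply: emeasurable_funM => //.
have md : measurable_fun setT (density k N : measurableTypeR R -> R).
  by apply: measurable_funM; [exact: measurable_weight|exact: measurable_indic].
by apply/measurable_EFinP; exact: (measurableT_comp md measurable_snd).
Qed.

Lemma measurable_time_integral k N (f : S -> R -> \bar R) :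
  measurable_fun setT (fun p : T => f p.1 p.2) -> (forall x s, 0 <= f x s) ->
  measurable_fun setT (fun x => time_integral k N (f x)).
Proof.
move=> mf f0; have := @measurable_fun_fubini_tonelli_F _ _ S (measurableTypeR R) R mu _
  (measurable_density k N mf).
have -> : fubini_F mu (fun p : T => (density k N p.2)%:E * f p.1 p.2) =
    (fun x => time_integral k N (f x)) by apply/funext => x; rewrite time_integralE.
by apply => p; rewrite mule_ge0 ?lee_fin.
Qed.

Lemma time_integral_tonelli (m : {sigma_finite_measure set S -> \bar R}) k N
    (f : S -> R -> \bar R) :
  measurable_fun setT (fun p : T => f p.1 p.2) -> (forall x s, 0 <= f x s) ->
  \int[m]_x time_integral k N (f x) = time_integral k N (fun s => \int[m]_x f x s).
Proof.
move=> mf f0; rewrite time_integralE.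
under eq_integral do rewrite time_integralE.
have f0' (p : T) : 0 <= (density k N p.2)%:E * f p.1 p.2 by rewrite mule_ge0 ?lee_fin.
rewrite (@fubini_tonelli _ _ S (measurableTypeR R) R m mu _ (measurable_density k N mf) f0').
apply: eq_integral => s _ /=; rewrite ge0_integralZl_EFin//.
have ms : measurable_fun setT (fun x : S => (x, s) : T) by exact: measurable_pair2.
exact: (measurableT_comp mf ms).
Qed.

End tonelli.

(** * Moments of a stopped random time *)

Section stopped_moments.
Local Open Scope ereal_scope.
Context {R : realType} {d : measure_display} {T : measurableType d}.
Variables (P : probability T R) (tau : T -> \bar R).
Hypotheses (mtau : measurable_fun setT tau) (tau0 : forall w, 0 <= tau w).

Local Notation tail t := (P [set w | t%:E < tau w]).

Definition stopped_moment (N : R) (k : nat) : \bar R :=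
  \int[P]_w (stop N (tau w) ^+ k)%:E.

Let measurable_event t : measurable [set w | t%:E < tau w].
Proof.
have -> : [set w | t%:E < tau w] = tau @^-1` `]t%:E, +oo[%classic.
  by apply/seteqP; split=> w /=; rewrite in_itv/= andbT.
by rewrite -[X in measurable X]setTI; apply: mtau => //; exact: emeasurable_itv.
Qed.

Let before_indic t :
  (fun w => before t (tau w)) = (fun w => (\1_[set w | (t%:E < tau w)%E] w)%:E).
Proof.
apply/funext => w; rewrite indicE; congr (nat_of_bool _)%:R%R%:E.
by apply/idP/idP => [h|/set_mem//]; rewrite inE.
Qed.

Lemma tailE t : tail t = \int[P]_w before t (tau w).
Proof.
by rewrite before_indic integral_indic// setIT.
Qed.

Let measurable_before :
  measurable_fun setT (fun p : T * measurableTypeR R => before p.2 (tau p.1)).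
Proof.
apply: (@measurable_antitone_right_cts _ _ _ (fun w s => before s (tau w))).
- by move=> t; rewrite before_indic; apply/measurable_EFinP; exact: measurable_indic.
- move=> w s t st; rewrite lee_fin ler_nat.
  have [h|//] := boolP (t%:E < tau w).
  by rewrite (le_lt_trans _ h)// lee_fin.
- move=> w t a; rewrite /before; have [tw|_] := ltP t%:E (tau w) => a1.
    have [r tr rw] : exists2 r, (t < r)%R & r%:E < tau w.
      case: (tau w) tw => [z| |]//; last by exists (t + 1)%R; rewrite ?ltrDl// ltry.
      by rewrite lte_fin => tz; exists ((t + z) / 2)%R; rewrite ?lte_fin; lra.
    by exists r => //; rewrite rw.
  by exists (t + 1)%R; rewrite ?ltrDl//; apply: lt_le_trans a1 _; rewrite lee_fin.
Qed.

Let measurable_before_add :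
  measurable_fun setT (fun p : (T * measurableTypeR R) * measurableTypeR R =>
    before (p.1.2 + p.2)%R (tau p.1.1)).
Proof.
have m : measurable_fun setT (fun p : (T * measurableTypeR R) * measurableTypeR R =>
    (p.1.1, p.1.2 + p.2)%R : T * measurableTypeR R).
  apply/measurable_fun_pairP; split => /=.
    exact: measurableT_comp measurable_fst measurable_fst.
  apply: measurable_funD; last exact: measurable_snd.
  exact: measurableT_comp measurable_snd measurable_fst.
exact: (measurableT_comp measurable_before m).
Qed.

Section exponent.
Variable k : nat.
Hypothesis k0 : (0 < k)%N.

Lemma measurable_stopped_power N : (0 <= N)%R ->
  measurable_fun setT (fun w => (stop N (tau w) ^+ k)%:E).
Proof.
move=> N0; have -> : (fun w => (stop N (tau w) ^+ k)%:E) =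
    (fun w => time_integral k N (before^~ (tau w))).
  by apply/funext => w; rewrite time_integral_before.
apply: (@measurable_time_integral _ _ _ k N (fun w s => before s (tau w))); first exact: measurable_before.
by move=> w s; exact: before_ge0.
Qed.

Lemma stopped_momentE N : (0 <= N)%R ->
  stopped_moment N k = time_integral k N (fun t => tail t).
Proof.
move=> N0; have -> : stopped_moment N k = \int[P]_w time_integral k N (before^~ (tau w)).
  by apply: eq_integral => w _; rewrite time_integral_before.
rewrite (@time_integral_tonelli _ _ _ P k N (fun w s => before s (tau w)) measurable_before).
  by apply: eq_time_integral => s _; rewrite tailE.
by move=> w s; exact: before_ge0.
Qed.

Lemma stopped_moment_le N : (0 <= N)%R -> 0 <= stopped_moment N k <= (N ^+ k)%:E.
Proof.
move=> N0; have sN w := stop_le (tau0 w) N0; apply/andP; split.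
  by apply: integral_ge0 => w _; rewrite lee_fin exprn_ge0//; case/andP: (sN w).
apply: (@le_trans _ _ (\int[P]_w (N ^+ k)%:E)).
  apply: le_integral_ge0 => w _; rewrite lee_fin; case/andP: (sN w) => h0 hN.
    exact: exprn_ge0.
  exact: lerXn2r.
by rewrite integral_cst//= probability_setT mule1.
Qed.

End exponent.

Lemma beta_ratio_ge0 k : (0 <= beta_ratio k :> R)%R.
Proof. by rewrite divr_ge0// exprn_ge0. Qed.

Lemma beta_ratio_le1 k : (beta_ratio k <= 1 :> R)%R.
Proof.
rewrite ler_pdivrMr ?ltr0n ?fact_gt0// mul1r -natrX ler_nat.
have k2 : (k <= 2 * k)%N by rewrite leq_pmull.
rewrite -(bin_fact k2) mul2n -addnn addnK mulnn.
by rewrite leq_pmull// bin_gt0 leq_addr.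
Qed.

Lemma tail_convolution_le k N : (0 < k)%N -> (0 <= N)%R ->
  time_integral k N (fun s => time_integral k N (fun t => tail (s + t)%R)) <=
  (beta_ratio k)%:E * stopped_moment N (2 * k) +
  ((1 - beta_ratio k) * N ^+ (2 * k))%:E * tail N.
Proof.
move=> k0 N0.
pose conv w s := time_integral k N (fun t => before (s + t)%R (tau w)).
have mconv : measurable_fun setT (fun p : T * measurableTypeR R => conv p.1 p.2).
  apply: (@measurable_time_integral _ _ _ k N
    (fun (p : T * measurableTypeR R) t => before (p.2 + t)%R (tau p.1))) => //.
  by move=> p t; exact: before_ge0.
have conv0 w s : 0 <= conv w s.
  apply: integral_ge0 => t; rewrite /= in_itv/= => /andP[t0 _].
  by rewrite mule_ge0 ?before_ge0// lee_fin weight_ge0.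
have E1 s : time_integral k N (fun t => tail (s + t)%R) = \int[P]_w conv w s.
  rewrite (@time_integral_tonelli _ _ _ P k N (fun w t => before (s + t)%R (tau w))).
  - by apply: eq_time_integral => t _; rewrite tailE.
  - have ms : measurable_fun setT (fun p : T * measurableTypeR R =>
        ((p.1, s), p.2) : (T * measurableTypeR R) * measurableTypeR R).
      apply/measurable_fun_pairP; split => /=; last exact: measurable_snd.
      by apply/measurable_fun_pairP; split; [exact: measurable_fst|exact: measurable_cst].
    exact: (measurableT_comp measurable_before_add ms).
  - by move=> w t; exact: before_ge0.
have -> : time_integral k N (fun s => time_integral k N (fun t => tail (s + t)%R)) =
    \int[P]_w time_integral k N (conv w).
  rewrite (@time_integral_tonelli _ _ _ P k N conv mconv conv0).
  by apply: eq_time_integral => s _; exact: E1.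
pose u w := (beta_ratio k)%:E * (stop N (tau w) ^+ (2 * k))%:E.
pose v w := ((1 - beta_ratio k) * N ^+ (2 * k))%:E * before N (tau w).
have c0 : (0 <= (1 - beta_ratio k) * N ^+ (2 * k) :> R)%R.
  by rewrite mulr_ge0 ?exprn_ge0// subr_ge0 beta_ratio_le1.
have k20 : (0 < 2 * k)%N by rewrite muln_gt0.
have ms := measurable_stopped_power k20 N0.
have s0 w : 0 <= (stop N (tau w) ^+ (2 * k))%:E.
  by rewrite lee_fin exprn_ge0//; case/andP: (stop_le (tau0 w) N0).
have mb : measurable_fun setT (fun w => before N (tau w)).
  by rewrite before_indic; apply/measurable_EFinP; exact: measurable_indic.
apply: (@le_trans _ _ (\int[P]_w (u w + v w))).
  apply: le_integral_ge0 => w _.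
    apply: integral_ge0 => s; rewrite /= in_itv/= => /andP[t0 _].
    by rewrite mule_ge0// lee_fin weight_ge0.
  by rewrite /u -EFinM; exact: time_integral_convolution.
have u0 w : setT w -> 0 <= u w by rewrite mule_ge0// lee_fin beta_ratio_ge0.
have v0 w : setT w -> 0 <= v w by rewrite mule_ge0 ?before_ge0.
have mu : measurable_fun setT u by exact: measurable_funeM.
have mv : measurable_fun setT v by exact: measurable_funeM.
rewrite (ge0_integralD P measurableT u0 mu v0 mv).
rewrite (ge0_integralZl_EFin P measurableT (fun w _ => s0 w) ms (beta_ratio_ge0 k)).
by rewrite (ge0_integralZl_EFin P measurableT (fun w _ => before_ge0 N (tau w)) mb c0) -tailE.
Qed.

Lemma measurable_power m : measurable_fun setT (fun w => tau w ^+ m).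
Proof.
elim: m => [|m IH]; first exact: measurable_cst.
have -> : (fun w => tau w ^+ m.+1) = (fun w => tau w * tau w ^+ m).
  by apply/funext => w; rewrite expeS.
exact: emeasurable_funM.
Qed.

Section variance.
Variables (k : nat) (N : R).
Hypotheses (k0 : (0 < k)%N) (N0 : (0 <= N)%R).

Local Notation E m := (\int[P]_w tau w ^+ m).
Local Notation EN m := (stopped_moment N m).

Let stop_ge0 w : (0 <= stop N (tau w))%R.
Proof. by case/andP: (stop_le (tau0 w) N0). Qed.

Let k20 : (0 < 2 * k)%N. Proof. by rewrite muln_gt0. Qed.

Lemma stopped_moment_fin m : EN m = (fine (EN m))%:E.
Proof.
have /andP[h0 h] := stopped_moment_le m N0.
by rewrite fineK// ge0_fin_numE// (le_lt_trans h)// ltry.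
Qed.

Let stopped_moment_ge0 m : 0 <= EN m.
Proof. by have /andP[] := stopped_moment_le m N0. Qed.

Let spow0 m w : setT w -> 0 <= (stop N (tau w) ^+ m)%:E.
Proof. by rewrite lee_fin exprn_ge0. Qed.

Let ms : measurable_fun setT (fun w => (stop N (tau w) ^+ k)%:E).
Proof. exact: measurable_stopped_power. Qed.

Let ms2 : measurable_fun setT (fun w => (stop N (tau w) ^+ (2 * k))%:E).
Proof. exact: measurable_stopped_power. Qed.

Let integral_const (c : R) : \int[P]_w c%:E = c%:E.
Proof. by rewrite integral_cst//= probability_setT mule1. Qed.

(** Integrate 2 b Y <= Y^2 + b^2, where Y is the stopped power and b its mean. *)
Lemma sqr_stopped_moment_le : (EN k) ^+ 2 <= EN (2 * k).
Proof.
rewrite stopped_moment_fin; set b := fine _.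
have b0 : (0 <= b)%R by exact: fine_ge0.
have b20 : (0 <= 2 * b)%R by rewrite mulr_ge0.
have bb0 (w : T) : setT w -> 0 <= (b ^+ 2)%:E by rewrite lee_fin exprn_ge0.
have H : \int[P]_w ((2 * b)%:E * (stop N (tau w) ^+ k)%:E) <=
    \int[P]_w ((stop N (tau w) ^+ (2 * k))%:E + (b ^+ 2)%:E).
  apply: le_integral_ge0 => w _; first by rewrite mule_ge0 ?spow0// lee_fin.
  rewrite -EFinM -EFinD lee_fin mulnC exprM.
  by have := sqr_ge0 (stop N (tau w) ^+ k - b)%R; rewrite sqrrB; lra.
move: H; rewrite (ge0_integralZl_EFin P measurableT (spow0 k) ms b20).
rewrite (ge0_integralD P measurableT (spow0 (2 * k)) ms2 bb0 (measurable_cst _)).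
rewrite integral_const -/(EN k) -/(EN (2 * k)) stopped_moment_fin -/b (stopped_moment_fin (2 * k)).
by rewrite -EFin_expe -EFinM -EFinD !lee_fin; lra.
Qed.

Hypothesis mE : E k < +oo.

Let mpow m := measurable_power m.

(** The map min(., N^k) is a contraction, so the mean square deviation of the stopped power from b =
    min(a, N^k) is at most that of tau^k from its mean a; the mean of the stopped power then does at
    least as well as b. The squares are expanded with each term on the side where it is nonnegative,
    so that the integrals split. *)
Lemma variance_stopped_le : EN (2 * k) - (EN k) ^+ 2 <= E (2 * k) - (E k) ^+ 2.
Proof.
have pow0 m w : setT w -> 0 <= tau w ^+ m by move=> _; exact: expe_ge0.
have Ek0 : 0 <= E k by apply: integral_ge0 => w; exact: pow0.
have E2k0 : 0 <= E (2 * k) by apply: integral_ge0 => w; exact: pow0.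
have Efin : E k = (fine (E k))%:E by rewrite fineK// ge0_fin_numE.
pose a : R := fine (E k); pose b : R := Num.min a (N ^+ k)%R.
have a0 : (0 <= a)%R by exact: fine_ge0.
have Nk0 : (0 <= N ^+ k)%R by exact: exprn_ge0.
have b0 : (0 <= b)%R by rewrite le_min a0.
have a20 : (0 <= 2 * a)%R by rewrite mulr_ge0.
have b20 : (0 <= 2 * b)%R by rewrite mulr_ge0.
have aa0 (w : T) : setT w -> 0 <= (a ^+ 2)%:E by rewrite lee_fin exprn_ge0.
have bb0 (w : T) : setT w -> 0 <= (b ^+ 2)%:E by rewrite lee_fin exprn_ge0.
(* [(min X (N ^ k) - b) ^ 2 <= (X - a) ^ 2] with [X = tau ^ k] *)
have H : \int[P]_w ((stop N (tau w) ^+ (2 * k))%:E + (2 * a)%:E * tau w ^+ k + (b ^+ 2)%:E) <=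
    \int[P]_w (tau w ^+ (2 * k) + (2 * b)%:E * (stop N (tau w) ^+ k)%:E + (a ^+ 2)%:E).
  apply: le_integral_ge0 => w _.
    apply: adde_ge0; last exact: (bb0 w).
    by apply: adde_ge0; [exact: spow0|rewrite mule_ge0 ?lee_fin// pow0].
  have := tau0 w; case: (tau w) => [r| |] //; rewrite ?lee_fin => r0.
    rewrite -!EFin_expe -!EFinM -!EFinD lee_fin !(mulnC 2%N) !exprM.
    have [rN|Nr] := leP r N.
      rewrite stop_ge//; have : (r ^+ k <= N ^+ k)%R by exact: lerXn2r.
      rewrite /b; set x := (r ^+ k)%R; set c := (N ^+ k)%R => xc.
      case: (leP a c) => ac; first lra.
      have := mulr_ge0 (_ : 0 <= a - c)%R (_ : 0 <= c - x)%R.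
      by rewrite !subr_ge0 (ltW ac) xc => /(_ isT isT); have := sqr_ge0 (a - c)%R; rewrite sqrrB; lra.
    rewrite stop_lt ?lte_fin//; have : (N ^+ k <= r ^+ k)%R by rewrite lerXn2r// ?nnegrE// ltW.
    rewrite /b; set x := (r ^+ k)%R; set c := (N ^+ k)%R => cx.
    case: (leP a c) => ac; last by have := sqr_ge0 (x - a)%R; rewrite sqrrB; lra.
    have := mulr_ge0 (_ : 0 <= x - c)%R (_ : 0 <= c - a)%R.
    by rewrite !subr_ge0 cx ac => /(_ isT isT); have := sqr_ge0 (x - c)%R; rewrite sqrrB; lra.
  (* Where tau is infinite, so is the right side. *)
  have expy m : (0 < m)%N -> (+oo : \bar R) ^+ m = +oo.
    by case: m => // m _; rewrite expeS gt0_mulye// expe_gt0.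
  by rewrite (expy (2 * k)%N)// -addeA addye ?leey// -EFinM -EFinD.
have mk := mpow k; have mk2 := mpow (2 * k).
have u0 (w : T) : setT w -> 0 <= (2 * a)%:E * tau w ^+ k.
  by move=> _; apply: mule_ge0; [rewrite lee_fin|exact: pow0].
have v0 (w : T) : setT w -> 0 <= (2 * b)%:E * (stop N (tau w) ^+ k)%:E.
  by move=> _; apply: mule_ge0; [rewrite lee_fin|exact: spow0].
have mu : measurable_fun setT (fun w => (2 * a)%:E * tau w ^+ k) by exact: measurable_funeM.
have mv : measurable_fun setT (fun w => (2 * b)%:E * (stop N (tau w) ^+ k)%:E).
  exact: measurable_funeM.
have s1 (w : T) : setT w -> 0 <= (stop N (tau w) ^+ (2 * k))%:E + (2 * a)%:E * tau w ^+ k.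
  by move=> wT; apply: adde_ge0; [exact: spow0|exact: u0].
have s2 (w : T) : setT w -> 0 <= tau w ^+ (2 * k) + (2 * b)%:E * (stop N (tau w) ^+ k)%:E.
  by move=> wT; apply: adde_ge0; [exact: pow0|exact: v0].
move: H.
rewrite (ge0_integralD P measurableT s1 (emeasurable_funD ms2 mu) bb0 (measurable_cst _)).
rewrite (ge0_integralD P measurableT s2 (emeasurable_funD mk2 mv) aa0 (measurable_cst _)).
rewrite (ge0_integralD P measurableT (spow0 (2 * k)) ms2 u0 mu).
rewrite (ge0_integralD P measurableT (pow0 (2 * k)%N) mk2 v0 mv).
rewrite (ge0_integralZl_EFin P measurableT (spow0 k) ms b20).
rewrite (ge0_integralZl_EFin P measurableT (pow0 k) mk a20).
rewrite !integral_const -/(EN k) -/(EN (2 * k)) (stopped_moment_fin k) (stopped_moment_fin (2 * k)).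
rewrite Efin -/a; move: E2k0; set e := fine (EN k); set e2 := fine _.
case: (E (2 * k)) => [r _| _|//]; last by rewrite -EFin_expe addye ?leey.
rewrite -!EFin_expe -!EFinM -!EFinB -!EFinD !lee_fin => H.
by have := sqr_ge0 (e - b)%R; rewrite sqrrB; lra.
Qed.

End variance.

Lemma markov_tail k N : (0 < k)%N -> (0 <= N)%R ->
  (N ^+ k)%:E * tail N <= \int[P]_w tau w ^+ k.
Proof.
move=> k0 N0; have Nk0 : (0 <= N ^+ k)%R by exact: exprn_ge0.
have mb : measurable_fun setT (fun w => before N (tau w)).
  by rewrite before_indic; apply/measurable_EFinP; exact: measurable_indic.
rewrite tailE -(ge0_integralZl_EFin P measurableT (fun w _ => before_ge0 N (tau w)) mb Nk0).
apply: le_integral_ge0 => w _; first by rewrite mule_ge0 ?before_ge0// lee_fin.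
rewrite /before; have [Nw|_] := ltP N%:E (tau w); last by rewrite mule0 expe_ge0.
rewrite mule1; move: Nw; case: (tau w) => [r| |] //; first last.
  by move=> _; case: k k0 {Nk0} => // m _; rewrite expeS gt0_mulye ?leey// expe_gt0.
by rewrite lte_fin => Nr; rewrite -EFin_expe lee_fin lerXn2r ?nnegrE// ?ltW// (le_lt_trans N0).
Qed.

Lemma stopped_moment_cvg k : (0 < k)%N ->
  stopped_moment i%:R k @[i --> \oo] --> \int[P]_w tau w ^+ k.
Proof.
move=> k0; pose f (i : nat) w := (stop i%:R (tau w) ^+ k)%:E.
have stop0 i w : (0 <= stop i%:R (tau w))%R by case/andP: (stop_le (tau0 w) (ler0n R i)).
have f_cvg w : f ^~ w @ \oo --> tau w ^+ k.
  rewrite /f; have := tau0 w; case: (tau w) => [r| |] //; rewrite ?lee_fin => r0.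
    rewrite -EFin_expe; apply: cvg_near_cst.
    exists (Num.truncn r).+1 => // i /= ri; rewrite stop_ge//.
    by rewrite (le_trans (ltW (truncnS_gt r)))// ler_nat.
  have -> : (+oo : \bar R) ^+ k = +oo.
    by case: k k0 {f} => // m _; rewrite expeS gt0_mulye// expe_gt0.
  rewrite (_ : (fun i : nat => _) = (fun i : nat => (i%:R ^+ k)%:E)); last first.
    by apply/funext => i; rewrite stop_lt// ltry.
  apply/cvgeryP/cvgryPge => a.
  exists (Num.truncn `|a|).+1 => // i /= ai.
  apply: (le_trans (ler_norm _)); apply: (le_trans (ltW (truncnS_gt _))).
  apply: (@le_trans _ _ i%:R%R); first by rewrite ler_nat.
  by rewrite -natrX ler_nat -{1}(expn1 i) leq_pexp2l// (leq_trans _ ai).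
have ndf w : nondecreasing_seq (f ^~ w).
  move=> i j ij; rewrite lee_fin lerXn2r ?nnegrE//.
  by rewrite stop_homo// ler_nat.
rewrite (eq_integral (fun w => limn (f ^~ w))); last first.
  by move=> w _; rewrite (cvg_lim _ (f_cvg w)).
apply: cvg_monotone_convergence => //.
- by move=> i; exact: measurable_stopped_power.
- by move=> i w _; rewrite lee_fin exprn_ge0.
- by move=> w _; exact: ndf.
Qed.

(** The integrands agree on {tau > N}, and elsewhere [stop] is monotone in its level. In this way
    the mass N^m of the stopped moment pays for the boundary term of [tail_convolution_le]. *)
Lemma stopped_moment_tail_le m N0 N : (0 < m)%N -> (0 <= N0)%R -> (N0 <= N)%R ->
  stopped_moment N0 m + (N ^+ m)%:E * tail N <=
  stopped_moment N m + (N0 ^+ m)%:E * tail N.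
Proof.
move=> m0 N00 N0N; have N_0 := le_trans N00 N0N.
have sm0 := measurable_stopped_power m0 N00.
have sm := measurable_stopped_power m0 N_0.
have mb : measurable_fun setT (fun w => before N (tau w)).
  by rewrite before_indic; apply/measurable_EFinP; exact: measurable_indic.
have b0 (w : T) : setT w -> 0 <= before N (tau w) by move=> _; exact: before_ge0.
have s0 r (w : T) : (0 <= r)%R -> 0 <= (stop r (tau w) ^+ m)%:E.
  by move=> r0; rewrite lee_fin exprn_ge0//; case/andP: (stop_le (tau0 w) r0).
have e0 r : (0 <= r -> 0 <= r ^+ m)%R by move=> ?; exact: exprn_ge0.
rewrite tailE -!(ge0_integralZl_EFin P measurableT b0 mb); [|exact: e0|exact: e0].
have c0 r (w : T) : (0 <= r)%R -> setT w -> 0 <= (r ^+ m)%:E * before N (tau w).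
  by move=> r0 _; apply: mule_ge0; [rewrite lee_fin e0|exact: before_ge0].
have mc r : measurable_fun setT (fun w => (r ^+ m)%:E * before N (tau w)).
  exact: measurable_funeM.
rewrite -(ge0_integralD P measurableT (fun w _ => s0 N0 w N00) sm0 (fun w => c0 N w N_0) (mc N)).
rewrite -(ge0_integralD P measurableT (fun w _ => s0 N w N_0) sm (fun w => c0 N0 w N00) (mc N0)).
apply: le_integral_ge0 => w _; first by apply: adde_ge0; [exact: s0|exact: c0].
rewrite /before; have [Nw|wN] := ltP N%:E (tau w).
  by rewrite !mule1 !stop_lt// ?(le_lt_trans _ Nw)// addeC.
rewrite !mule0 !adde0 lee_fin lerXn2r ?nnegrE ?stop_homo//.
- by case/andP: (stop_le (tau0 w) N00).
- by case/andP: (stop_le (tau0 w) N_0).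
Qed.

End stopped_moments.

(** * Variance of the exit time *)

Section restricted_measure.
Local Open Scope ereal_scope.
Context {R : realType} {d : measure_display} {S : measurableType d}.
Variables (m : {measure set S -> \bar R}) (D : set S).
Hypotheses (mD : measurable D) (mDoo : m D < +oo).

(** Restricting the measure to a set D of finite measure provides the sigma-finite measure that
    Tonelli's theorem asks for. *)
Lemma integral_mfrestr (f : S -> \bar R) : measurable_fun setT f -> (forall x, 0 <= f x) ->
  \int[mfrestr mD mDoo]_x f x = \int[m]_(x in D) f x.
Proof.
have PI (nu : {measure set S -> \bar R}) (E : set S) : measurable E ->
    pos_integral (fun f : S -> \bar R => \int[nu]_(x in E) f x).
  move=> mE; have := @pos_integral_integral _ _ S S R nu E (fun=> 1) (fun x f => f x) mE.
  have -> : (fun f : S -> \bar R => \int[nu]_(x in E) (1 * f x)) =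
      (fun f => \int[nu]_(x in E) f x).
    by apply/funext => f'; apply: eq_integral => x _; rewrite mul1e.
  by apply => // x; exact: pos_integral_eval.
apply: (pos_integral_ext (PI _ setT measurableT) (PI m D mD)) => B mB.
by rewrite !integral_indic// setIT.
Qed.

Lemma time_integral_tonelli_on k N (f : S -> R -> \bar R) :
  measurable_fun setT (fun p : S * measurableTypeR R => f p.1 p.2) ->
  (forall x s, 0 <= f x s) ->
  \int[m]_(x in D) time_integral k N (f x) =
  time_integral k N (fun s => \int[m]_(x in D) f x s).
Proof.
move=> mf f0; rewrite -integral_mfrestr; last 2 first.
- exact: measurable_time_integral.
- move=> x; apply: integral_ge0 => s; rewrite /= in_itv/= => /andP[s0 _].
  by rewrite mule_ge0// lee_fin weight_ge0.
rewrite (@time_integral_tonelli _ _ _ (mfrestr mD mDoo) k N f mf f0).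
apply: eq_time_integral => s _; rewrite integral_mfrestr//.
have ms : measurable_fun setT (fun x : S => (x, s) : S * measurableTypeR R).
  exact: measurable_pair2.
exact: (measurableT_comp mf ms).
Qed.

End restricted_measure.

(** * Variance bounded below by the heat content *)

Section variance_lower_bound.
Local Open Scope ereal_scope.
Context {R : realType} {M : ptopologicalType} {n : nat}.
Context {A : smooth_atlas R M n} {g : riemannian_metric A}.
Context {vol : {measure set (borel M) -> \bar R}}.
Context {d : measure_display} {T : measurableType d}.
Variables (X : brownian_motion g vol T) (W : set (borel M)).
Hypotheses (oW : open (W : set M)) (volW : vol W < +oo).

Let mW : measurable W := open_borel oW.

Local Notation law := (bm_law X).
Local Notation tau := (exit_time X W).
Local Notation F x t := (exit_tail X W x t).
Local Notation E x N m := (stopped_moment (law x) tau N m).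

Definition heat_content (t : R) : \bar R := \int[vol]_(x in W) F x t.

Let mtau : measurable_fun setT tau := measurable_exit_time X oW.
Let tau0 w : 0 <= tau w := exit_time_ge0 X W w.

(** Used with a = N^(2k), b = N0^(2k), H the heat content at N, V the integral of the stopped
    variance, IQ that of the squared stopped k-th moment, and IN, I0 those of the moments of order
    2k stopped at N and N0. All but V are known to be finite, and V = IN - IQ >= (1 - beta) (IN - a
    H) >= (1 - beta) (I0 - b H). *)
Lemma variance_balance (beta a b : R) (V IQ IN I0 H : \bar R) :
  (0 <= 1 - beta)%R -> 0 <= V -> IQ \is a fin_num -> IN \is a fin_num ->
  I0 \is a fin_num -> H \is a fin_num -> V + IQ = IN ->
  I0 + a%:E * H <= IN + b%:E * H ->
  IQ <= beta%:E * IN + ((1 - beta) * a)%:E * H ->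
  (1 - beta)%:E * I0 <= V + ((1 - beta) * b)%:E * H.
Proof.
move=> b1; case: V => [v _| _|//]; case: IQ => // q _; case: IN => // p _;
case: I0 => // p0 _; case: H => // h _ //.
rewrite -?EFinM -?EFinD ?lee_fin => -[vq] P Q.
by have := ler_wpM2l b1 P; lra.
Qed.

(** Continuity from below along the events tau > t + 1 / (i + 1). *)
Lemma exit_tail_right_cts x t a : a < F x t -> exists2 r, (t < r)%R & a < F x r.
Proof.
move=> aF; pose B (i : nat) := [set w | (t + i.+1%:R^-1)%:E < tau w].
have mB i : measurable (B i) by exact: measurable_exit_event.
have BE : \bigcup_i B i = [set w | t%:E < tau w].
  apply/seteqP; split=> w.
    by move=> [i _]; apply: lt_trans; rewrite lte_fin ltrDl.
  move=> /= tw; have [r tr rw] : exists2 r, (t < r)%R & r%:E < tau w.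
    case: (tau w) tw => [z| |]//; last by exists (t + 1)%R; rewrite ?ltrDl// ltry.
    by rewrite lte_fin => tz; exists ((t + z) / 2)%R; rewrite ?lte_fin; lra.
  have rt : (0 < r - t)%R by rewrite subr_gt0.
  exists (Num.truncn (r - t)^-1) => //=; apply: le_lt_trans rw; rewrite lee_fin.
  rewrite -lerBrDl -[leRHS]invrK lef_pV2 ?posrE ?invr_gt0//.
  exact: ltW (truncnS_gt _).
have cvg : law x (B i) @[i --> \oo] --> F x t.
  rewrite /exit_tail -BE; apply: nondecreasing_cvg_mu => //.
    by apply: bigcupT_measurable.
  move=> i j ij; apply/subsetPset => w; apply: le_lt_trans.
  by rewrite lee_fin lerD2l lef_pV2 ?posrE// ler_nat.
have [N _ NP] := cvg _ (open_ereal_gt' aF).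
by exists (t + N.+1%:R^-1)%R; rewrite ?ltrDl//; exact: NP (leqnn N).
Qed.

Lemma measurable_exit_tail2 :
  measurable_fun setT (fun p : borel M * measurableTypeR R => F p.1 p.2).
Proof.
apply: (@measurable_antitone_right_cts _ _ (borel M) (fun x t => F x t)).
- by move=> t; exact: measurable_exit_tail.
- by move=> x s t; exact: exit_tail_antitone.
- by move=> x t a; exact: exit_tail_right_cts.
Qed.

Lemma heat_content_ge0 t : 0 <= heat_content t.
Proof. by apply: integral_ge0 => x _; exact: exit_tail_ge0. Qed.

Lemma heat_content_le t : heat_content t <= vol W.
Proof.
apply: (@le_trans _ _ (\int[vol]_(x in W) 1)); last by rewrite integral_cst//= mul1e.
by apply: le_integral_ge0 => x _; [exact: exit_tail_ge0|exact: exit_tail_le1].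
Qed.

Lemma heat_contentE t : (0 <= t)%R -> heat_content t = \int[vol]_x F x t.
Proof.
move=> t0; rewrite /heat_content integral_mkcond; apply: eq_integral => x _.
rewrite patchE; case: ifPn => // xW; apply/esym/eqP.
rewrite eq_le exit_tail_ge0 andbT (le_trans (exit_tail_out X oW x t0))//.
by rewrite indicE (negbTE xW).
Qed.

Section fixed_exponent.
Variable k : nat.
Hypothesis k0 : (0 < k)%N.
Let k20 : (0 < 2 * k)%N. Proof. by rewrite muln_gt0. Qed.

Lemma measurable_stopped_moment N m : (0 < m)%N -> (0 <= N)%R ->
  measurable_fun setT (fun x : borel M => E x N m).
Proof.
move=> m0 N0; have -> : (fun x : borel M => E x N m) = (fun x => time_integral m N (fun t => F x t)).
  by apply/funext => x; rewrite (@stopped_momentE _ _ _ (law x) _ mtau tau0 _ m0 _ N0).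
apply: (@measurable_time_integral _ _ (borel M) m N (fun x t => F x t)); first exact: measurable_exit_tail2.
by move=> x t; exact: exit_tail_ge0.
Qed.

Lemma measurable_moment m : (0 < m)%N -> measurable_fun setT (moment X W m : borel M -> \bar R).
Proof.
move=> m0; apply: (emeasurable_fun_cvg (fun i (x : borel M) => E x i%:R m)).
  by move=> i; exact: measurable_stopped_moment.
by move=> x _; have := @stopped_moment_cvg _ _ _ (law x) _ mtau tau0 _ m0; exact.
Qed.

Lemma integral_stopped_moment N : (0 <= N)%R ->
  \int[vol]_(x in W) E x N (2 * k) = time_integral (2 * k) N heat_content.
Proof.
move=> N0.
have -> : \int[vol]_(x in W) E x N (2 * k) =
    \int[vol]_(x in W) time_integral (2 * k) N (fun t => F x t).
  by apply: eq_integral => x _; rewrite (@stopped_momentE _ _ _ (law x) _ mtau tau0 _ k20 _ N0).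
rewrite (@time_integral_tonelli_on _ _ (borel M) vol W mW volW (2 * k) N (fun x t => F x t)) //.
exact: measurable_exit_tail2.
Qed.

(** The square is a double time integral of F_s F_t; after exchanging integrals, [exit_tail_product]
    replaces this product by F_(s+t), and exchanging back lets [tail_convolution_le] act at each
    point. *)
Lemma integral_sqr_stopped_moment N : (0 <= N)%R ->
  \int[vol]_(x in W) (E x N k) ^+ 2 <=
  (beta_ratio k)%:E * time_integral (2 * k) N heat_content +
  ((1 - beta_ratio k) * N ^+ (2 * k))%:E * heat_content N.
Proof.
move=> N0.
have mF2 := measurable_exit_tail2.
have mF x : measurable_fun setT (fun s : measurableTypeR R => F x s).
  have mx : measurable_fun setT (fun s => (x, s) : borel M * measurableTypeR R).
    exact: measurable_pair1.
  exact: (measurableT_comp mF2 mx).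
have F0 x t : 0 <= F x t by exact: exit_tail_ge0.
have mF3 : measurable_fun setT (fun p : (borel M * measurableTypeR R) * measurableTypeR R =>
    F p.1.1 p.1.2 * F p.1.1 p.2).
  apply: emeasurable_funM; first exact: (measurableT_comp mF2 measurable_fst).
  have m13 : measurable_fun setT (fun p : (borel M * measurableTypeR R) * measurableTypeR R =>
      (p.1.1, p.2) : borel M * measurableTypeR R).
    apply/measurable_fun_pairP; split; last exact: measurable_snd.
    exact: measurableT_comp measurable_fst measurable_fst.
  exact: (measurableT_comp mF2 m13).
have mF4 : measurable_fun setT (fun p : (borel M * measurableTypeR R) * measurableTypeR R =>
    F p.1.1 (p.1.2 + p.2)%R).
  have m13 : measurable_fun setT (fun p : (borel M * measurableTypeR R) * measurableTypeR R =>
      (p.1.1, p.1.2 + p.2)%R : borel M * measurableTypeR R).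
    apply/measurable_fun_pairP; split => /=.
      exact: measurableT_comp measurable_fst measurable_fst.
    apply: measurable_funD; last exact: measurable_snd.
    exact: measurableT_comp measurable_snd measurable_fst.
  exact: (measurableT_comp mF2 m13).
have slice (h : borel M -> R -> R -> \bar R) s :
    measurable_fun setT (fun p : (borel M * measurableTypeR R) * measurableTypeR R =>
      h p.1.1 p.1.2 p.2) ->
    measurable_fun setT (fun p : borel M * measurableTypeR R => h p.1 s p.2).
  move=> mh; have ms : measurable_fun setT (fun p : borel M * measurableTypeR R =>
      ((p.1, s), p.2) : (borel M * measurableTypeR R) * measurableTypeR R).
    apply/measurable_fun_pairP; split => /=; last exact: measurable_snd.
    by apply/measurable_fun_pairP; split; [exact: measurable_fst|exact: measurable_cst].
  exact: (measurableT_comp mh ms).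
have swap (h : borel M -> R -> R -> \bar R) :
    measurable_fun setT (fun p : (borel M * measurableTypeR R) * measurableTypeR R =>
      h p.1.1 p.1.2 p.2) -> (forall x s t, 0 <= h x s t) ->
    \int[vol]_(x in W) time_integral k N (fun s => time_integral k N (h x s)) =
    time_integral k N (fun s => time_integral k N (fun t => \int[vol]_(x in W) h x s t)).
  move=> mh h0.
  rewrite (@time_integral_tonelli_on _ _ (borel M) vol W mW volW k N
    (fun x s => time_integral k N (h x s))).
  - apply: eq_time_integral => s _.
    by rewrite (@time_integral_tonelli_on _ _ (borel M) vol W mW volW k N (fun x t => h x s t) (slice h s mh)).
  - apply: (@measurable_time_integral _ _ _ k N
      (fun (p : borel M * measurableTypeR R) t => h p.1 p.2 t)) => //.
  - move=> x s; apply: integral_ge0 => t; rewrite /= in_itv/= => /andP[t0 _].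
    by rewrite mule_ge0// lee_fin weight_ge0.
have sqrE x : (E x N k) ^+ 2 =
    time_integral k N (fun s => time_integral k N (fun t => F x s * F x t)).
  have mw (f : measurableTypeR R -> \bar R) : measurable_fun setT f ->
      measurable_fun `[0%R, N]%classic (fun s => (weight k s)%:E * f s).
    move=> mf; apply: emeasurable_funM; last exact: measurable_funS mf.
    by apply/measurable_EFinP; exact: measurable_weight.
  have w0 (f : R -> \bar R) : (forall s, 0 <= f s) ->
      forall s : measurableTypeR R, `[0%R, N]%classic s -> 0 <= (weight k s)%:E * f s.
    by move=> f0 s; rewrite /= in_itv/= => /andP[s0 _]; rewrite mule_ge0// lee_fin weight_ge0.
  rewrite (@stopped_momentE _ _ _ (law x) _ mtau tau0 _ k0 _ N0) expe2.
  set c := time_integral k N (fun t => law x _).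
  have c0 : 0 <= c by apply: integral_ge0; exact: w0.
  transitivity (time_integral k N (fun s => c * F x s)).
    rewrite /time_integral -ge0_integralZl//; first by apply: eq_integral => s _; rewrite muleCA.
      exact: mw (mF x).
    exact: w0.
  apply: eq_time_integral => s _; rewrite muleC.
  rewrite /c /time_integral -ge0_integralZl//; first by apply: eq_integral => t _; rewrite muleCA.
    exact: mw (mF x).
  exact: w0.
have -> : \int[vol]_(x in W) (E x N k) ^+ 2 =
    \int[vol]_(x in W) time_integral k N (fun s => time_integral k N (fun t => F x s * F x t)).
  by apply: eq_integral => x _; exact: sqrE.
rewrite (swap (fun x s t => F x s * F x t) mF3); last by move=> x s t; rewrite mule_ge0.
apply: (@le_trans _ _ (time_integral k N (fun s => time_integral k N
    (fun t => \int[vol]_(x in W) F x (s + t)%R)))).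
  apply: time_integral_le => s /andP[s0 sN].
    apply: integral_ge0 => t; rewrite /= in_itv/= => /andP[t0 _].
    rewrite mule_ge0 ?lee_fin ?weight_ge0//.
    by apply: integral_ge0 => x _; rewrite mule_ge0.
  apply: time_integral_le => t /andP[t0 tN].
    by apply: integral_ge0 => x _; rewrite mule_ge0.
  rewrite -/(heat_content (s + t)) heat_contentE ?addr_ge0//.
  apply: le_trans (exit_tail_product X oW volW s0 t0).
  rewrite integral_mkcond; apply: le_integral_ge0 => x _.
    by rewrite patchE; case: ifPn => // _; rewrite mule_ge0.
  by rewrite patchE; case: ifPn => // _; rewrite mule_ge0.
rewrite -(swap (fun x s t => F x (s + t)%R) mF4)//.
have b0 : (0 <= beta_ratio k :> R)%R by exact: beta_ratio_ge0.
have c0 : (0 <= (1 - beta_ratio k) * N ^+ (2 * k) :> R)%R.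
  by rewrite mulr_ge0 ?exprn_ge0// subr_ge0 beta_ratio_le1.
have E0 x : 0 <= E x N (2 * k).
  by have /andP[] := @stopped_moment_le _ _ _ (law x) _ tau0 (2 * k) _ N0.
have mE : measurable_fun W (fun x : borel M => E x N (2 * k)).
  by apply: measurable_funS (measurable_stopped_moment k20 N0).
have mFN : measurable_fun W (fun x : borel M => F x N).
  by apply: measurable_funS (measurable_exit_tail X oW N).
rewrite -(integral_stopped_moment N0) /heat_content.
rewrite -(ge0_integralZl_EFin vol mW (fun x _ => E0 x) mE b0).
rewrite -(ge0_integralZl_EFin vol mW (fun x _ => F0 x N) mFN c0).
have u0 (x : borel M) : W x -> 0 <= (beta_ratio k)%:E * E x N (2 * k).
  by move=> _; rewrite mule_ge0// lee_fin.
have v0 (x : borel M) : W x -> 0 <= ((1 - beta_ratio k) * N ^+ (2 * k))%:E * F x N.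
  by move=> _; rewrite mule_ge0// lee_fin.
rewrite -(ge0_integralD vol mW u0 (measurable_funeM _ mE) v0 (measurable_funeM _ mFN)).
apply: le_integral_ge0 => x _.
  apply: integral_ge0 => s; rewrite /= in_itv/= => /andP[s0 _].
  rewrite mule_ge0 ?lee_fin ?weight_ge0//.
  apply: integral_ge0 => t; rewrite /= in_itv/= => /andP[t0 _].
  by rewrite mule_ge0 ?lee_fin ?weight_ge0.
exact: (@tail_convolution_le _ _ _ (law x) _ mtau tau0 k N k0 N0).
Qed.

Let stopped_bounds x m N : (0 <= N)%R -> 0 <= E x N m <= (N ^+ m)%:E.
Proof. by move=> N0; exact: (@stopped_moment_le _ _ _ (law x) _ tau0 m _ N0). Qed.

Let W_bounded_integral (f : borel M -> \bar R) (c : R) :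
  (forall x, 0 <= f x <= c%:E) -> \int[vol]_(x in W) f x \is a fin_num.
Proof.
move=> fc; rewrite ge0_fin_numE; last by apply: integral_ge0 => x _; case/andP: (fc x).
apply: (@le_lt_trans _ _ (\int[vol]_(x in W) c%:E)).
  by apply: le_integral_ge0 => x _; case/andP: (fc x).
have vE : vol W = (fine (vol W))%:E by rewrite fineK// ge0_fin_numE.
by rewrite integral_cst//= vE -EFinM ltry.
Qed.

Let heat_content_fin t : heat_content t \is a fin_num.
Proof. by rewrite ge0_fin_numE ?heat_content_ge0// (le_lt_trans (heat_content_le t)). Qed.

Let stopped_variance_ge0 x N : (0 <= N)%R -> 0 <= E x N (2 * k) - (E x N k) ^+ 2.
Proof.
move=> N0; rewrite sube_ge0; first exact: (@sqr_stopped_moment_le _ _ _ (law x) _ mtau tau0 k N k0 N0).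
by rewrite (@stopped_moment_fin _ _ _ (law x) _ tau0 N N0 k) -EFin_expe.
Qed.

Let measurable_stopped_variance N : (0 <= N)%R ->
  measurable_fun setT (fun x : borel M => E x N (2 * k) - (E x N k) ^+ 2).
Proof.
move=> N0; apply: emeasurable_funB; first exact: measurable_stopped_moment.
by apply: emeasurable_funM; exact: measurable_stopped_moment.
Qed.

(** The level N0 is kept fixed while N grows: the error then carries the constant N0^(2k) instead of
    N^(2k), and only the decay of the heat content is needed. *)
Lemma integral_stopped_variance_ge N0 N : (0 <= N0)%R -> (N0 <= N)%R ->
  (1 - beta_ratio k)%:E * time_integral (2 * k) N0 heat_content <=
  \int[vol]_(x in W) (E x N (2 * k) - (E x N k) ^+ 2) +
  ((1 - beta_ratio k) * N0 ^+ (2 * k))%:E * heat_content N.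
Proof.
move=> N00 N0N; have N_0 := le_trans N00 N0N.
have b1 : (0 <= 1 - beta_ratio k :> R)%R by rewrite subr_ge0 beta_ratio_le1.
have E0 x m r : (0 <= r)%R -> 0 <= E x r m by move=> r0; case/andP: (stopped_bounds x m r0).
have mE m r : (0 < m)%N -> (0 <= r)%R -> measurable_fun W (fun x : borel M => E x r m).
  by move=> m0 r0; apply: measurable_funS (measurable_stopped_moment m0 r0).
have Q := integral_sqr_stopped_moment N_0.
have VQ : \int[vol]_(x in W) (E x N (2 * k) - (E x N k) ^+ 2) +
    \int[vol]_(x in W) (E x N k) ^+ 2 = \int[vol]_(x in W) E x N (2 * k).
  have v0 (x : borel M) : W x -> 0 <= E x N (2 * k) - (E x N k) ^+ 2.
    by move=> _; exact: stopped_variance_ge0.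
  have q0 (x : borel M) : W x -> 0 <= (E x N k) ^+ 2 by move=> _; exact/expe_ge0/E0.
  have mv : measurable_fun W (fun x : borel M => E x N (2 * k) - (E x N k) ^+ 2).
    by apply: measurable_funS (measurable_stopped_variance N_0).
  have mq : measurable_fun W (fun x : borel M => (E x N k) ^+ 2).
    by apply: emeasurable_funM; exact: mE.
  rewrite -(ge0_integralD vol mW v0 mv q0 mq); apply: eq_integral => x _.
  by rewrite subeK// (@stopped_moment_fin _ _ _ (law x) _ tau0 N N_0 k) -EFin_expe.
have c0 r : (0 <= r)%R -> (0 <= r ^+ (2 * k) :> R)%R by move=> r0; exact: exprn_ge0.
have F0 (x : borel M) : W x -> 0 <= F x N by move=> _; exact: exit_tail_ge0.
have mFN : measurable_fun W (fun x : borel M => F x N).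
  by apply: measurable_funS (measurable_exit_tail X oW N).
have P : \int[vol]_(x in W) E x N0 (2 * k) + (N ^+ (2 * k))%:E * heat_content N <=
    \int[vol]_(x in W) E x N (2 * k) + (N0 ^+ (2 * k))%:E * heat_content N.
  rewrite /heat_content -!(ge0_integralZl_EFin vol mW F0 mFN); [|exact: c0|exact: c0].
  have e0 r : (0 <= r)%R -> forall x : borel M, W x -> 0 <= E x r (2 * k) by move=> r0 x _; exact: E0.
  have h0 r : (0 <= r)%R -> forall x : borel M, W x -> 0 <= (r ^+ (2 * k))%:E * F x N.
    by move=> r0 x Wx; rewrite mule_ge0 ?F0// lee_fin c0.
  have D r r' (r0 : (0 <= r)%R) (r'0 : (0 <= r')%R) :
      \int[vol]_(x in W) (E x r (2 * k) + (r' ^+ (2 * k))%:E * F x N) =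
      \int[vol]_(x in W) E x r (2 * k) + \int[vol]_(x in W) ((r' ^+ (2 * k))%:E * F x N).
    have mF' : measurable_fun W (fun x : borel M => (r' ^+ (2 * k))%:E * F x N).
      exact: measurable_funeM.
    exact: (ge0_integralD vol mW (e0 r r0) (mE (2 * k)%N r k20 r0) (h0 r' r'0) mF').
  have eqle (x y : \bar R) : x = y -> x <= y by move=> ->.
  have D1 := eqle _ _ (esym (D N0 N N00 N_0)); have D2 := eqle _ _ (D N N0 N_0 N00).
  refine (le_trans D1 (le_trans _ D2)); apply: le_integral_ge0 => x Wx.
    by apply: adde_ge0; [exact: e0|exact: h0].
  exact: (@stopped_moment_tail_le _ _ _ (law x) _ mtau tau0 (2 * k) N0 N k20 N00 N0N).
rewrite -(integral_stopped_moment N00).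
move: Q; rewrite -(integral_stopped_moment N_0).
have fE m r : (0 <= r)%R -> \int[vol]_(x in W) E x r m \is a fin_num.
  by move=> r0; apply: (@W_bounded_integral _ (r ^+ m)%R) => x; exact: stopped_bounds.
have fq : \int[vol]_(x in W) (E x N k) ^+ 2 \is a fin_num.
  apply: (@W_bounded_integral _ ((N ^+ k) ^+ 2)%R) => x.
  have := stopped_bounds x k N_0; rewrite (@stopped_moment_fin _ _ _ (law x) _ tau0 N N_0 k).
  rewrite -EFin_expe !lee_fin => /andP[h0 h1]; rewrite sqr_ge0 /=.
  by apply: lerXn2r => //; rewrite nnegrE ?h0// exprn_ge0.
move=> Q.
have V0 : 0 <= \int[vol]_(x in W) (E x N (2 * k) - (E x N k) ^+ 2).
  by apply: integral_ge0 => x _; exact: stopped_variance_ge0.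
exact: (@variance_balance _ _ _ _ _ _ _ _ b1 V0 fq (fE (2 * k)%N _ N_0)
  (fE (2 * k)%N _ N00) (heat_content_fin N) VQ P Q).
Qed.

Definition infinite_moment : set (borel M) := W `&` [set x | moment X W k x = +oo].

Let mmk : measurable_fun setT (moment X W k : borel M -> \bar R).
Proof. exact: measurable_moment. Qed.

Let mm2k : measurable_fun setT (moment X W (2 * k) : borel M -> \bar R).
Proof. exact: measurable_moment. Qed.

Let measurable_infinite_moment : measurable infinite_moment.
Proof.
apply: measurableI => //; have := mmk measurableT (emeasurable_set1 +oo).
by rewrite setTI; congr measurable; apply/seteqP; split=> x.
Qed.

Let moment_ge0 m x : 0 <= moment X W m x.
Proof. by apply: integral_ge0 => w _; exact: expe_ge0. Qed.

Let mvar : measurable_fun W (fun x : borel M => moment X W (2 * k) x - (moment X W k x) ^+ 2).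
Proof.
apply: (@measurable_funS _ _ _ _ setT) => //.
by apply: emeasurable_funB => //; exact: emeasurable_funM.
Qed.

Lemma variance_L1_ninfty : vol infinite_moment != 0 -> variance_L1 X W k = -oo.
Proof.
move=> Z0; rewrite /variance_L1 integralE.
suff -> : \int[vol]_(x in W) (fun x : borel M => moment X W (2 * k) x - (moment X W k x) ^+ 2)^\- x = +oo.
  (* The value -oo absorbs the integral of the positive part, even if that is +oo. *)
  by rewrite addeC.
apply/eqP; rewrite -leye_eq.
apply: (@le_trans _ _ (\int[vol]_(x in infinite_moment)
    (fun x : borel M => moment X W (2 * k) x - (moment X W k x) ^+ 2)^\- x)).
  rewrite (@le_trans _ _ (\int[vol]_(x in infinite_moment) +oo))//.
    rewrite integral_cst// gt0_mulye// lt0e Z0.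
    exact: measure_ge0.
  apply: le_integral_ge0 => x [_ /= Zx]; first exact: leey.
  by rewrite funenegE Zx mulyy /= addeNy /= max_l// leey.
apply: ge0_subset_integral => //; last by move=> x [].
exact: measurable_funeneg.
Qed.

Section finite_moments.
Hypothesis Z0 : vol infinite_moment = 0.

(** Markov's inequality bounds the tail at an integer N >= 1 by E tau^k / N almost everywhere, as k
    >= 1; the constant 1 dominates on W. *)
Lemma heat_content_cvg0 : heat_content i.+1%:R @[i --> \oo] --> 0.
Proof.
pose f (i : nat) (x : borel M) := F x i.+1%:R.
have mf i : measurable_fun W (f i).
  by apply: measurable_funS (measurable_exit_tail X oW _).
have int1 : vol.-integrable W (fun=> 1 : \bar R).
  apply/integrableP; split; first exact: measurable_cst.
  by under eq_integral do rewrite gee0_abs//; rewrite integral_cst// mul1e.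
have [_ _ +] : [/\ vol.-integrable W (fun=> 0 : \bar R),
   [sequence \int[vol]_(x in W) `|f i x - 0|]_i @ \oo --> 0 &
   [sequence \int[vol]_(x in W) f i x]_i @ \oo --> \int[vol]_(x in W) 0].
  apply: (dominated_convergence mW mf (measurable_cst 0) _ int1).
  - exists infinite_moment; split => //.
    move=> x /= /not_implyP[Wx ncvg]; split => //=.
    apply: contrapT => Zx; apply: ncvg.
    have mfin : moment X W k x = (fine (moment X W k x))%:E.
      rewrite fineK// ge0_fin_numE// ltey; exact/eqP.
    have h : ((fine (moment X W k x)) * i.+1%:R^-1)%:E @[i --> \oo] --> 0%R%:E.
      rewrite -(mulr0 (fine (moment X W k x))); apply: cvg_EFin; first exact: nearW.
      by apply: (@cvgZr _ _ _ \oo); exact: cvg_harmonic.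
    apply: (squeeze_cvge _ (cvg_cst 0) h).
    apply: nearW => i; rewrite exit_tail_ge0 /= EFinM -mfin.
    rewrite lee_pdivlMr//; apply: le_trans (@markov_tail _ _ _ (law x) _ mtau tau0 k i.+1%:R k0 (ler0n _ _)).
    rewrite muleC lee_wpmul2r ?exit_tail_ge0// lee_fin -natrX ler_nat.
    by rewrite -{1}(expn1 i.+1) leq_pexp2l.
  - by apply: aeW => x i _; rewrite gee0_abs ?exit_tail_ge0 ?exit_tail_le1.
by rewrite integral0.
Qed.

Lemma variance_L1_ge_stopped N : (0 <= N)%R ->
  \int[vol]_(x in W) (E x N (2 * k) - (E x N k) ^+ 2) <= variance_L1 X W k.
Proof.
move=> N0; pose v (x : borel M) := E x N (2 * k) - (E x N k) ^+ 2.
pose f (x : borel M) := moment X W (2 * k) x - (moment X W k x) ^+ 2.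
have mv : measurable_fun W v by apply: measurable_funS (measurable_stopped_variance N0).
(* The maximum changes the integrand at most on the null set of infinite moments; afterwards the two
   integrands compare at every point. *)
have -> : variance_L1 X W k = \int[vol]_(x in W) maxe (f x) (v x).
  apply: ae_eq_integral => //; first exact: measurable_maxe.
  exists infinite_moment; split => //.
  move=> x /= /not_implyP[Wx neq]; split => //=.
  apply: contrapT => Zx; apply: neq; apply/esym/max_l.
  apply: (@variance_stopped_le _ _ _ (law x) _ mtau tau0 k N k0 N0).
  by rewrite ltey; exact/eqP.
apply: le_integral_ge0 => x _; first exact: stopped_variance_ge0.
by rewrite le_max lexx orbT.
Qed.

Lemma variance_L1_ge N : (0 <= N)%R ->
  (1 - beta_ratio k)%:E * time_integral (2 * k) N heat_content <= variance_L1 X W k.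
Proof.
move=> N0; pose c := ((1 - beta_ratio k) * N ^+ (2 * k))%R.
have cH : c%:E * heat_content i.+1%:R @[i --> \oo] --> 0.
  by rewrite -(mule0 c%:E); apply: cvgeZl => //; exact: heat_content_cvg0.
apply/lee_addgt0Pr => e e0.
have e0' : 0 < e%:E by rewrite lte_fin.
have [i1 _ i1P] := cH _ (open_ereal_lt' e0').
pose i := maxn i1 (Num.truncn N).
have Ni : (N <= i.+1%:R)%R.
  by rewrite (le_trans (ltW (truncnS_gt _)))// ler_nat ltnS leq_maxr.
apply: le_trans (integral_stopped_variance_ge N0 Ni) _.
apply: leeD; first exact: variance_L1_ge_stopped (le_trans N0 Ni).
by apply/ltW/i1P; exact: leq_maxl.
Qed.

End finite_moments.

End fixed_exponent.
End variance_lower_bound.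

(** * Time integrals of exponentials *)

Section exponential_time_integral.
Local Open Scope ereal_scope.
Context {R : realType}.
Local Notation mu := (@lebesgue_measure R).
Variable a : R.
Hypothesis a0 : (0 < a)%R.

(** Primitive of t^m e^(-a t) by repeated integration by parts; it tends to 0 at infinity, so the
    integral over the half-line is minus its value at 0. *)
Fixpoint gamma_primitive (m : nat) (t : R) : R :=
  if m is m'.+1 then
    (a^-1 * (m%:R * gamma_primitive m' t - t ^+ m * expR (- (a * t))))%R
  else (- a^-1 * expR (- (a * t)))%R.

Lemma is_derive_expRN t :
  is_derive t (1 : R)%R (fun t => expR (- (a * t))) (- a * expR (- (a * t)))%R.
Proof.
have E s : (- (a * s) = 0 + - a * s)%R by rewrite add0r mulNr.
rewrite E; under [X in is_derive _ _ X]eq_fun do rewrite E.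
exact: is_derive_affine_comp (is_derive_expR _).
Qed.

Lemma is_derive_gamma_primitive m t :
  is_derive t (1 : R)%R (gamma_primitive m) (t ^+ m * expR (- (a * t)))%R.
Proof.
have an0 : (a != 0)%R by rewrite gt_eqF.
elim: m => [|m IH].
  have H := is_deriveZ (- a^-1)%R (is_derive_expRN t).
  apply: (is_derive_eq H); rewrite /GRing.scale /= expr0 mul1r.
  by rewrite mulrA mulrNN mulVf// mul1r.
have H := is_deriveZ (a^-1)%R (is_deriveB (is_deriveZ m.+1%:R%R IH)
  (is_deriveM (is_derive_power m.+1 t) (is_derive_expRN t))).
by apply: (is_derive_eq H); rewrite /GRing.scale /=; field.
Qed.

Lemma gamma_primitive0 m : gamma_primitive m 0 = (- (m`!%:R / a ^+ m.+1))%R.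
Proof.
have an0 : (a != 0)%R by rewrite gt_eqF.
elim: m => [|m IH] /=; rewrite mulr0 oppr0 expR0 mulr1.
  by rewrite fact0 mul1r.
rewrite IH expr0n subr0 factS natrM !exprS.
by field; rewrite expf_neq0.
Qed.

Lemma cvg_power_exp m : (i.+1%:R ^+ m * expR (- (a * i.+1%:R)))%R @[i --> \oo] --> (0 : R)%R.
Proof.
(* The constant comes from e^x >= x^(m+1) / (m+1)! at x = a t. *)
pose c := (m.+1`!%:R / a ^+ m.+1 : R)%R.
have ch : (c * i.+1%:R^-1)%R @[i --> \oo] --> (0 : R)%R.
  by rewrite -(mulr0 c); apply: (@cvgZr _ _ _ \oo); exact: cvg_harmonic.
apply: (squeeze_cvgr _ (cvg_cst (0 : R)%R) ch).
apply: nearW => i; rewrite mulr_ge0 ?exprn_ge0 ?expR_ge0//=.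
set t : R := i.+1%:R%R; have t0 : (0 < t)%R by rewrite ltr0n.
have at0 : (0 < a * t)%R by exact: mulr_gt0.
have f0 : (0 < m.+1`!%:R :> R)%R by rewrite ltr0n fact_gt0.
have h : ((a * t) ^+ m.+1 / m.+1`!%:R <= expR (a * t))%R.
  by apply: le_trans (expR_ge1Dxn m (ltW at0)); rewrite lerDr.
have p0 : (0 < (a * t) ^+ m.+1 / m.+1`!%:R)%R by rewrite divr_gt0// exprn_gt0.
rewrite expRN; apply: (@le_trans _ _ (t ^+ m * ((a * t) ^+ m.+1 / m.+1`!%:R)^-1)%R).
  by rewrite ler_pM2l ?exprn_gt0// lef_pV2 ?posrE ?expR_gt0.
rewrite /c exprMn exprS invf_div le_eqVlt; apply/orP; left; apply/eqP.
by rewrite [(t ^+ m.+1)%R]exprS; field; rewrite ?expf_neq0 ?gt_eqF.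
Qed.

Lemma cvg_gamma_primitive m : gamma_primitive m i.+1%:R @[i --> \oo] --> (0 : R)%R.
Proof.
elim: m => [|m IH] /=.
  rewrite -(mulr0 (- a^-1)%R); apply: (@cvgZr _ _ _ \oo).
  by have := cvg_power_exp 0; under eq_fun do rewrite expr0 mul1r.
have H1 : (m.+1%:R * gamma_primitive m i.+1%:R)%R @[i --> \oo] --> (m.+1%:R * 0 : R)%R.
  exact: (@cvgZr _ _ _ \oo).
have H2 : (m.+1%:R * gamma_primitive m i.+1%:R -
    i.+1%:R ^+ m.+1 * expR (- (a * i.+1%:R)))%R @[i --> \oo] --> (m.+1%:R * 0 - 0 : R)%R.
  exact: (@cvgB _ _ _ \oo _ _ _ _ _ H1 (cvg_power_exp m.+1)).
rewrite mulr0 subrr in H2.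
by rewrite -(mulr0 (a^-1)%R); exact: (@cvgZr _ _ _ \oo).
Qed.

Lemma continuous_gamma_integrand m : continuous (fun t : R => t ^+ m * expR (- (a * t)))%R.
Proof.
have ce : continuous (fun t => expR (- (a * t))).
  move=> t; apply/differentiable_continuous/derivable1_diffP.
  exact: (@ex_derive _ _ _ _ _ _ _ (is_derive_expRN t)).
by move=> t; apply: (@cvgM _ _ (nbhs t)); [exact: exprn_continuous|exact: ce].
Qed.

Lemma cvg_time_integral_exp k : (0 < k)%N ->
  time_integral k i.+1%:R (fun t => (expR (- (a * t)))%:E) @[i --> \oo] -->
  (k`!%:R / a ^+ k)%:E.
Proof.
move=> k0.
have E (i : nat) : time_integral k i.+1%:R (fun t => (expR (- (a * t)))%:E) =
    (k%:R * gamma_primitive k.-1 i.+1%:R + k`!%:R / a ^+ k)%:E.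
  have E' : time_integral k i.+1%:R (fun t => (expR (- (a * t)))%:E) =
      \int[mu]_(t in `[0%R, i.+1%:R]) (k%:R%:E * (t ^+ k.-1 * expR (- (a * t)))%:E).
    by apply: eq_integral => t _; rewrite -!EFinM mulrA.
  rewrite E' ge0_integralZl//.
  - rewrite (FTC2_is_derive (ler0n _ _) (is_derive_gamma_primitive k.-1)); last first.
      exact: continuous_gamma_integrand.
    have fE : (k%:R * k.-1`!%:R = k`!%:R :> R)%R by rewrite -natrM -{1 3}(prednK k0) factS.
    by rewrite -EFinM gamma_primitive0 opprK mulrDr (prednK k0) [X in (_ + X)%R]mulrA fE.
  - apply/measurable_EFinP; apply: (@measurable_funS _ _ _ _ setT) => //.
    by apply: continuous_measurable_fun; exact: continuous_gamma_integrand.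
  - by move=> t; rewrite /= in_itv/= => /andP[t0 _]; rewrite lee_fin mulr_ge0 ?exprn_ge0 ?expR_ge0.
under eq_fun do rewrite E.
apply: cvg_EFin; first exact: nearW.
rewrite -[X in _ --> X]add0r -{1}(mulr0 k%:R%R); apply: (@cvgD _ _ _ \oo); last exact: cvg_cst.
by apply: (@cvgZr _ _ _ \oo); exact: cvg_gamma_primitive.
Qed.

End exponential_time_integral.

(** * Heat content and eigenvalue *)

Section heat_content_lower_bound.
Local Open Scope ereal_scope.
Context {R : realType} {M : ptopologicalType} {n : nat}.
Context {A : smooth_atlas R M n} {g : riemannian_metric A}.
Context {vol : {measure set (borel M) -> \bar R}}.
Context {d : measure_display} {T : measurableType d}.
Variables (X : brownian_motion g vol T) (W : set (borel M)) (lam : R) (phi : M -> R).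
Hypotheses (oW : open (W : set M)) (cW : compact (closure (W : set M))).
Hypotheses (volW : vol W < +oo) (phiP : dirichlet_solution g W lam phi).

Let mW : measurable W := open_borel oW.

Lemma measurable_solution : measurable_fun W (phi : borel M -> R).
Proof.
have [_ cphi _ _] := phiP.
pose C : set (borel M) := closure (W : set M).
have mC : measurable C by apply: closed_borel; exact: closed_closure.
have WC : W `<=` C by exact: subset_closure.
exact: measurable_funS mC WC (continuous_borel_measurable mC cphi).
Qed.

Lemma bounded_integrable (f : borel M -> R) (B : R) : measurable_fun W f ->
  (forall x, W x -> `|f x| <= B)%R -> vol.-integrable W (EFin \o f).
Proof.
move=> mf fB; apply/integrableP; split; first exact/measurable_EFinP.
apply: (@le_lt_trans _ _ (\int[vol]_(x in W) (`|B|)%:E)).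
  apply: le_integral_ge0 => x Wx; first exact: abse_ge0.
  by rewrite /= lee_fin (le_trans (fB x Wx))// ler_norm.
rewrite integral_cst//.
have -> : vol W = (fine (vol W))%:E by rewrite fineK// ge0_fin_numE.
by rewrite -EFinM ltry.
Qed.

Lemma integrable_solution : vol.-integrable W (fun x : borel M => (phi x)%:E).
Proof.
have [B B0 BP] := solution_bounded cW phiP.
apply: (bounded_integrable (B := B) measurable_solution) => x Wx.
by apply: BP; exact: subset_closure.
Qed.

Lemma integrable_solution_mul (psi : M -> R) : dirichlet_solution g W lam psi ->
  measurable_fun W (psi : borel M -> R) ->
  vol.-integrable W (fun x : borel M => (phi x * psi x)%:E).
Proof.
move=> psiP mpsi; have [B B0 BP] := solution_bounded cW phiP.
have [C C0 CP] := solution_bounded cW psiP.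
apply: (bounded_integrable (B := (B * C)%R)).
  by apply: measurable_funM => //; exact: measurable_solution.
move=> x Wx; rewrite normrM; apply: ler_pM => //.
- by apply: BP; exact: subset_closure.
- by apply: CP; exact: subset_closure.
Qed.

Hypothesis phi_sq : \int[vol]_(x in W) (phi x)%:E = sq_L2norm vol W phi.
Hypothesis lam0 : (0 <= lam)%R.

(* Cauchy-Schwarz for [phi^+] and the tails, with the optimal weight in
   [2 u v <= u^2 + v^2] *)
Lemma heat_content_ge lam' t : (lam < lam')%R -> (0 < t)%R ->
  (expR (- (lam' * t)))%:E * sq_L2norm vol W phi <= heat_content X W t.
Proof.
move=> ll' t0; pose s := (t / 2)%R; have s0 : (0 < s)%R by rewrite divr_gt0.
have sst : (s + s = t)%R by rewrite /s; lra.
pose q := expR (- (lam' * s)); have q0 : (0 < q)%R by exact: expR_gt0.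
have qq : expR (- (lam' * t)) = (q * q)%R.
  by rewrite -expRD -sst mulrDr opprD.
pose u x := Num.max (phi x) 0%R; have u0 x : (0 <= u x)%R by rewrite le_max lexx orbT.
pose F x := exit_tail X W x s.
have F0 x : 0 <= F x by exact: exit_tail_ge0.
have Ff x : F x = (fine (F x))%:E.
  by rewrite fineK// ge0_fin_numE// (le_lt_trans (exit_tail_le1 X oW x s))// ltry.
have mu : measurable_fun W (fun x : borel M => (u x)%:E).
  apply/measurable_EFinP; apply: measurable_maxr; last exact: measurable_cst.
  exact: measurable_solution.
have mF : measurable_fun W (fun x : borel M => F x).
  by apply: measurable_funS (measurable_exit_tail X oW s).
set S := sq_L2norm vol W phi.
have S0 : 0 <= S by apply: integral_ge0 => x _; rewrite lee_fin sqr_ge0.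
have Sfin : S \is a fin_num.
  have := integrable_solution_mul phiP measurable_solution.
  by move=> /(integrable_fin_num mW).
have kato := positive_part_tail_ge X oW cW phiP volW lam0 ll' s0.
have Su : S <= \int[vol]_(x in W) (u x)%:E.
  rewrite /S -phi_sq; apply: le_integral => //.
  - exact: integrable_solution.
  - have [B B0 BP] := solution_bounded cW phiP.
    apply: (bounded_integrable (f := u) (B := B)); first exact/measurable_EFinP.
    move=> x Wx; rewrite ger0_norm// /u ge_max B0 andbT.
    by apply: le_trans (ler_norm _) (BP _ _); exact: subset_closure.
  - by move=> x _; rewrite lee_fin le_max lexx.
have uS : \int[vol]_(x in W) ((u x) ^+ 2)%:E <= S.
  apply: le_integral_ge0 => x _; first by rewrite lee_fin sqr_ge0.
  rewrite lee_fin /u; case: (leP 0%R (phi x)) => // _.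
  by rewrite expr0n sqr_ge0.
have FH : \int[vol]_(x in W) (F x * F x) <= heat_content X W t.
  rewrite (heat_contentE X oW (ltW t0)) -sst.
  apply: le_trans (exit_tail_product X oW volW (ltW s0) (ltW s0)).
  rewrite integral_mkcond; apply: le_integral_ge0 => x _.
    by rewrite patchE; case: ifPn => // _; rewrite mule_ge0.
  by rewrite patchE; case: ifPn => // _; rewrite mule_ge0.
(* With the weight 1 / q, the Kato bound makes the left side at least 2 S, while the right side is
   at most S + H / q^2. *)
have young : (2 / q)%:E * \int[vol]_(x in W) ((u x)%:E * F x) <=
    \int[vol]_(x in W) ((u x) ^+ 2)%:E + ((q * q)^-1)%:E * \int[vol]_(x in W) (F x * F x).
  have q20 : (0 <= 2 / q)%R by rewrite divr_ge0 ?ltW.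
  have qq0 : (0 <= (q * q)^-1)%R by rewrite invr_ge0 mulr_ge0 ?ltW.
  have uF0 (x : borel M) : W x -> 0 <= (u x)%:E * F x by move=> _; rewrite mule_ge0 ?lee_fin.
  have FF0 (x : borel M) : W x -> 0 <= F x * F x by move=> _; rewrite mule_ge0.
  have uu0 (x : borel M) : W x -> 0 <= ((u x) ^+ 2)%:E by rewrite lee_fin sqr_ge0.
  have cFF0 (x : borel M) : W x -> 0 <= ((q * q)^-1)%:E * (F x * F x).
    by move=> Wx; rewrite mule_ge0 ?FF0// lee_fin.
  have mFF : measurable_fun W (fun x : borel M => F x * F x) by exact: emeasurable_funM.
  have muF : measurable_fun W (fun x : borel M => (u x)%:E * F x) by exact: emeasurable_funM.
  have muu : measurable_fun W (fun x : borel M => ((u x) ^+ 2)%:E).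
    by apply/measurable_EFinP/measurable_funX/measurable_EFinP.
  have mcFF : measurable_fun W (fun x : borel M => ((q * q)^-1)%:E * (F x * F x)).
    exact: measurable_funeM.
  rewrite -(ge0_integralZl_EFin vol mW uF0 muF q20) -(ge0_integralZl_EFin vol mW FF0 mFF qq0).
  rewrite -(ge0_integralD vol mW uu0 muu cFF0 mcFF).
  apply: le_integral_ge0 => x Wx; first by rewrite mule_ge0 ?uF0// lee_fin.
  rewrite Ff -!EFinM -EFinD lee_fin; set y := fine _.
  have qn0 : (q != 0)%R by rewrite gt_eqF.
  have -> : (2 / q * (u x * y) = 2 * (u x * (y / q)))%R by field.
  have -> : ((q * q)^-1 * (y * y) = (y / q) ^+ 2)%R by field.
  by have := sqr_ge0 (u x - y / q)%R; rewrite sqrrB; lra.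
have H0 : 0 <= heat_content X W t by exact: heat_content_ge0.
rewrite qq; move: H0 FH; case: (heat_content X W t) => [h| |]// H0 FH; last by rewrite leey.
have step : (2 / q)%:E * (q%:E * S) <= S + ((q * q)^-1)%:E * h%:E.
  apply: (@le_trans _ _ ((2 / q)%:E * \int[vol]_(x in W) ((u x)%:E * F x))).
    rewrite lee_wpmul2l ?lee_fin ?divr_ge0 ?(ltW q0)//.
    by apply: le_trans kato; rewrite lee_wpmul2l// lee_fin ltW.
  apply: le_trans young _; apply: leeD => //.
  by rewrite lee_wpmul2l// lee_fin invr_ge0 mulr_ge0 ?ltW.
move: step; rewrite -(fineK Sfin); set r := fine S.
rewrite -!EFinM -EFinD !lee_fin.
have -> : (2 / q * (q * r) = 2 * r)%R by field; rewrite gt_eqF.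
have qq0 : (0 < q * q)%R by exact: mulr_gt0.
move=> step; have : (r <= (q * q)^-1 * h)%R by lra.
by rewrite mulrC ler_pdivlMr// mulrC.
Qed.

End heat_content_lower_bound.

(** * Projection of the constant function *)

Section projection_of_constants.
Local Open Scope ereal_scope.
Context {R : realType} {M : ptopologicalType} {n : nat}.
Context {A : smooth_atlas R M n} {g : riemannian_metric A}.
Context {vol : {measure set (borel M) -> \bar R}}.
Variables (W : set (borel M)) (lam : R) (p : M -> R).
Hypotheses (oW : open (W : set M)) (cW : compact (closure (W : set M))).
Hypotheses (volW : vol W < +oo) (pP : is_projection_of_1 g vol W lam p).

Let mW : measurable W := open_borel oW.
Let p_sol : dirichlet_solution g W lam p := pP.1.
Let mp : measurable_fun W (p : borel M -> R) := measurable_solution p_sol.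

(** Orthogonality of 1 - p to p itself. *)
Lemma projection_integral : \int[vol]_(x in W) (p x)%:E = sq_L2norm vol W p.
Proof.
have ip := integrable_solution oW cW volW p_sol.
have ipp := integrable_solution_mul oW cW volW p_sol p_sol mp.
have fS : sq_L2norm vol W p \is a fin_num by exact: integrable_fin_num ipp.
have E : \int[vol]_(x in W) (p x)%:E - sq_L2norm vol W p = 0.
  rewrite -(pP.2 p p_sol) /sq_L2norm -integralB//.
  by apply: eq_integral => x _; rewrite -EFinB mulrBl mul1r.
by rewrite -[LHS](subeK _ fS) E add0e.
Qed.

Hypothesis not_orthogonal : ~ orthogonal_to_constants g vol W lam.

(** If p had norm 0 it would vanish almost everywhere, and orthogonality of 1 - p would make the
    integral of every solution 0. *)
Lemma sq_L2norm_projection_gt0 : 0 < sq_L2norm vol W p.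
Proof.
rewrite lt0e; apply/andP; split; last by apply: integral_ge0 => x _; rewrite lee_fin sqr_ge0.
apply/eqP => S0; apply: not_orthogonal => phi phiP.
rewrite -(pP.2 phi phiP); apply: ae_eq_integral => //.
- by apply/measurable_EFinP; exact: measurable_solution phiP.
- apply/measurable_EFinP/measurable_funM; last exact: measurable_solution phiP.
  exact: measurable_funB.
have mpp : measurable_fun W (fun x : borel M => ((p x) ^+ 2)%:E).
  by apply/measurable_EFinP; exact: measurable_funX.
have : ae_eq vol W (fun x : borel M => ((p x) ^+ 2)%:E) (cst 0).
  apply/(ae_eq_integral_abs vol mW mpp); rewrite -S0; apply: eq_integral => x _.
  by rewrite gee0_abs// lee_fin sqr_ge0.
apply: filterS => x h Wx; have [/eqP] := h Wx.
by rewrite sqrf_eq0 => /eqP ->; rewrite subr0 mul1r.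
Qed.

(** The integral of p is its squared norm, which is positive. The point found here is the one that
    [eigenvalue_ge0] asks for. *)
Lemma projection_positive : exists2 x, W x & (0 < p x)%R.
Proof.
apply: contrapT => np; have := sq_L2norm_projection_gt0.
rewrite -projection_integral ltNge => /negP; apply.
rewrite -(integral0 vol W); apply: le_integral => //.
- exact: integrable_solution oW cW volW p_sol.
- exact: integrable0.
- by move=> x /set_mem Wx; rewrite lee_fin leNgt; apply/negP => px; apply: np; exists x.
Qed.

End projection_of_constants.

(** * Variance bound for every rate above the eigenvalue *)

Section variance_of_exit_time.
Local Open Scope ereal_scope.
Context {R : realType} {M : ptopologicalType} {n : nat}.
Context {A : smooth_atlas R M n} {g : riemannian_metric A}.
Context {vol : {measure set (borel M) -> \bar R}}.
Context {d : measure_display} {T : measurableType d}.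
Variables (X : brownian_motion g vol T) (W : set (borel M)) (lam : R) (p : M -> R).
Hypotheses (oW : open (W : set M)) (cW : compact (closure (W : set M))).
Hypotheses (volW : vol W < +oo) (pP : is_projection_of_1 g vol W lam p).
Hypothesis lam0 : (0 <= lam)%R.
Variables (lam' : R) (k : nat).
Hypotheses (ll' : (lam < lam')%R) (k0 : (0 < k)%N).

Let S : R := fine (sq_L2norm vol W p).

Let SE : sq_L2norm vol W p = S%:E.
Proof.
rewrite fineK//; apply: (integrable_fin_num _ (integrable_solution_mul oW cW volW pP.1 pP.1 _)).
  exact: open_borel.
exact: measurable_solution pP.1.
Qed.

Let S0 : (0 <= S)%R.
Proof. by apply: fine_ge0; apply: integral_ge0 => x _; rewrite lee_fin sqr_ge0. Qed.

Let lam'0 : (0 < lam')%R. Proof. exact: le_lt_trans ll'. Qed.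

Lemma time_integral_heat_content_ge N : (0 <= N)%R ->
  S%:E * time_integral (2 * k) N (fun t => (expR (- (lam' * t)))%:E) <=
  time_integral (2 * k) N (heat_content X W).
Proof.
move=> N0; rewrite /time_integral -ge0_integralZl//.
- apply: le_integral_ge0 => t; rewrite /= in_itv/= => /andP[t0 _].
    by rewrite !mule_ge0// lee_fin ?weight_ge0 ?expR_ge0.
  (* [heat_content_ge] asks for t > 0; at t = 0 the weight vanishes, as 2 k >= 2. *)
  rewrite muleCA; have [->|tn0] := eqVneq t 0%R.
    have -> : weight (2 * k) 0 = 0%R :> R.
      by case: k k0 => // m _; rewrite /weight mulnS /= expr0n mulr0.
    by rewrite !mul0e.
  rewrite lee_wpmul2l ?lee_fin ?weight_ge0// muleC -SE.
  by apply: (heat_content_ge X oW cW volW pP.1 (projection_integral oW cW volW pP) lam0 ll'); rewrite lt0r tn0.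
- apply/measurable_EFinP/measurable_funM; first exact: measurable_weight.
  apply: (@measurable_funS _ _ _ _ setT) => //.
  have := @continuous_gamma_integrand _ lam' 0.
  have -> : (fun t : R => t ^+ 0 * expR (- (lam' * t)))%R = (fun t => expR (- (lam' * t)))%R.
    by apply/funext => t; rewrite mul1r.
  exact: continuous_measurable_fun.
- by move=> t; rewrite /= in_itv/= => /andP[t0 _]; rewrite mule_ge0 ?lee_fin ?weight_ge0 ?expR_ge0.
Qed.

Lemma variance_L1_ge_projection : vol (infinite_moment X W k) = 0 ->
  (S * ((2 * k)`!%:R - k`!%:R ^+ 2) / lam' ^+ (2 * k))%:E <= variance_L1 X W k.
Proof.
move=> Z0.
have k20 : (0 < 2 * k)%N by rewrite muln_gt0.
pose u (i : nat) := time_integral (2 * k) i.+1%:R (fun t => (expR (- (lam' * t)))%:E).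
have cu : u i @[i --> \oo] --> ((2 * k)`!%:R / lam' ^+ (2 * k))%:E by exact: cvg_time_integral_exp.
have cSu : (1 - beta_ratio k)%:E * (S%:E * u i) @[i --> \oo] -->
    (1 - beta_ratio k)%:E * (S%:E * ((2 * k)`!%:R / lam' ^+ (2 * k))%:E).
  by apply: cvgeZl => //; apply: cvgeZl.
have -> : (S * ((2 * k)`!%:R - k`!%:R ^+ 2) / lam' ^+ (2 * k))%:E =
    (1 - beta_ratio k)%:E * (S%:E * ((2 * k)`!%:R / lam' ^+ (2 * k))%:E).
  rewrite -!EFinM /beta_ratio; congr EFin.
  have : ((2 * k)`!%:R != 0 :> R)%R by rewrite pnatr_eq0 -lt0n fact_gt0.
  have : (lam' ^+ (2 * k) != 0)%R by rewrite expf_neq0// gt_eqF.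
  move: ((2 * k)`!%:R : R)%R (k`!%:R : R)%R (lam' ^+ (2 * k))%R => a b c c0 a0.
  by field; rewrite c0.
rewrite -(cvg_lim _ cSu)//; apply: lime_le; first by apply/cvg_ex; eexists; exact: cSu.
apply: nearW => i.
apply: le_trans (variance_L1_ge oW volW k0 Z0 (ler0n R i.+1)).
apply: lee_wpmul2l; first by rewrite lee_fin subr_ge0 beta_ratio_le1.
exact: time_integral_heat_content_ge.
Qed.

Lemma variance_bound :
  (sq_L2norm vol W p * ((2 * k)`!%:R - (k`!%:R) ^+ 2)%:E / variance_L1 X W k) `^
    ((2 * k)%:R^-1) <= lam'%:E.
Proof.
have r0 : ((2 * k)%:R^-1 != 0 :> R)%R by rewrite invr_eq0 pnatr_eq0 -lt0n muln_gt0.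
rewrite SE -EFinM; set D := ((2 * k)`!%:R - _)%R.
have D0 : (0 <= D)%R.
  have := @beta_ratio_le1 R k; rewrite /beta_ratio ler_pdivrMr ?ltr0n ?fact_gt0// mul1r.
  by rewrite subr_ge0.
have x0 : (0 <= S * D)%R by exact: mulr_ge0.
have [x_0|xn0] := eqVneq (S * D)%R 0%R.
  by rewrite x_0 mul0e poweR0r// lee_fin ltW.
have xgt0 : (0 < S * D)%R by rewrite lt0r xn0.
have [Z0|Zn0] := eqVneq (vol (infinite_moment X W k)) 0; last first.
  rewrite (variance_L1_ninfty oW k0 Zn0).
  by rewrite /inve /= gt0_muleNy// ?poweRNyr// lee_fin ltW.
have pk : (0 < lam' ^+ (2 * k))%R by rewrite exprn_gt0.
have := variance_L1_ge_projection Z0; rewrite -/D.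
(* A variance +oo has inverse 0, and -oo is excluded by the lower bound. *)
case: (variance_L1 X W k) => [v| |] //=; last first.
  by move=> _; rewrite mulr0 powR0// lee_fin ltW.
rewrite lee_fin ler_pdivrMr// => Sv.
have v0 : (0 < v)%R by rewrite -(pmulr_lgt0 _ pk) (lt_le_trans xgt0).
rewrite /inve /= gt_eqF// -EFinM poweR_EFin lee_fin.
have -> : lam' = ((lam' ^+ (2 * k)) `^ ((2 * k)%:R^-1))%R.
  by rewrite -powR_mulrn ?ltW// -powRrM mulfV ?powRr1 ?ltW// -invr_eq0.
have a0 : (0 <= S * D / v)%R by exact: divr_ge0 x0 (ltW v0).
have ab : (S * D / v <= lam' ^+ (2 * k))%R by rewrite ler_pdivrMr// [leRHS]mulrC.
have s0 : (0 <= (2 * k)%:R^-1 :> R)%R by rewrite invr_ge0.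
by apply: (ge0_ler_powR s0 _ _ ab); rewrite nnegrE // ltW.
Qed.

End variance_of_exit_time.

Theorem corollary3p2
    (R : realType) (M : ptopologicalType) (n : nat)
    (A : smooth_atlas R M n) (g : riemannian_metric A)
    (M_complete : riemannian_complete g)
    (vol : {measure set (borel M) -> \bar R})
    (vol_riemannian : is_riemannian_measure g vol)
    (Omega : set M)
    (Omega_open : open Omega) (Omega_connected : connected Omega)
    (Omega_bounded : rbounded g Omega)
    (Omega_boundary : boundary Omega !=set0)
    (Omega_smooth : smooth_boundary A Omega)
    (d : measure_display) (T : measurableType d) (X : brownian_motion g vol T)
    (lambda : R)
    (lambda_eigenvalue : dirichlet_eigenvalue g Omega lambda)
    (lambda_not_orthogonal : ~ orthogonal_to_constants g vol Omega lambda)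
    (p1 : M -> R) (p1_projection : is_projection_of_1 g vol Omega lambda p1)
    (k : nat) (k_gt0 : (0 < k)%N) :
  ((sq_L2norm vol Omega p1 * ((2 * k)`!%:R - (k`!%:R) ^+ 2)%:E
     / variance_L1 X Omega k) `^ ((2 * k)%:R^-1) <= lambda%:E)%E.
Proof.
pose W : set (borel M) := Omega.
have oW : open (W : set M) by [].
have cW : compact (closure (W : set M)) := closure_bounded_compact M_complete Omega_bounded.
have volW : (vol W < +oo)%E.
  apply: (volume_compact_lty vol_riemannian cW); last exact: open_borel.
  exact: subset_closure.
have [q Wq pq] := projection_positive oW cW volW p1_projection lambda_not_orthogonal.
have lambda0 : 0 <= lambda by exact: (eigenvalue_ge0 X oW cW p1_projection.1 Wq pq).
(* The bound is available for rates strictly above lambda, here lambda + e with e > 0 arbitrary. *)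
apply/lee_addgt0Pr => e e0; rewrite -EFinD.
by apply: (variance_bound X oW cW volW p1_projection lambda0 _ k_gt0); rewrite ltrDl.
Qed.
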